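(* Let $f(z)=z^2+i$, so $P_f=\{i,\,i-1,\,-i,\,\infty\}$. For every $\gamma\in\mathcal{C}(\widehat{\mathbb{C}},P_f)$ there exists $n\ge1$ such that every component of $f^{-n}(\gamma)$ is trivial (inessential or peripheral) in $\widehat{\mathbb{C}}-P_f$.
   Context: For a finite set $P\subset\widehat{\mathbb{C}}$ with $\#P\ge3$, $\mathcal{C}(\widehat{\mathbb{C}},P)$ is the set of free homotopy classes in $\widehat{\mathbb{C}}-P$ of unoriented simple closed curves which are essential and nonperipheral (not homotopic to a point nor into arbitrarily small neighborhoods of a point of $P$); the other simple closed curves in $\widehat{\mathbb{C}}-P$ are called trivial. $P_f$ denotes the postcritical set of $f$ (here the forward orbit of the critical value $i$ together with $\infty$). *)

(* Defs.v *)
(* the Riemann sphere minus P_f, with infinity in P_f,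
   is the plane C = R^2 minus the three finite points of P_f. *)
From Stdlib Require Import Reals.
Open Scope R_scope.

Definition Cpx : Type := (R * R)%type.
Definition cdist (z w : Cpx) : R :=
  sqrt ((fst z - fst w) ^ 2 + (snd z - snd w) ^ 2).
Definition cnorm (z : Cpx) : R := sqrt (fst z ^ 2 + snd z ^ 2).

Definition f (z : Cpx) : Cpx :=
  (fst z ^ 2 - snd z ^ 2, 2 * fst z * snd z + 1).

Definition Pfin (z : Cpx) : Prop :=
  z = (0, 1) \/ z = (-1, 1) \/ z = (0, -1).

Definition X (z : Cpx) : Prop := ~ Pfin z.

Definition cont_path (g : R -> Cpx) : Prop :=
  forall t eps, eps > 0 -> exists d, d > 0 /\
    forall t', Rabs (t' - t) < d -> cdist (g t') (g t) < eps.

Definition cont2 (H : R -> R -> Cpx) : Prop :=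
  forall s t eps, eps > 0 -> exists d, d > 0 /\
    forall s' t', Rabs (s' - s) < d -> Rabs (t' - t) < d ->
      cdist (H s' t') (H s t) < eps.

Definition loop_in_X (g : R -> Cpx) : Prop :=
  cont_path g /\ (forall t, g (t + 1) = g t) /\ (forall t, X (g t)).

Definition simple_loop (g : R -> Cpx) : Prop :=
  loop_in_X g /\
  (forall s t, 0 <= s < 1 -> 0 <= t < 1 -> g s = g t -> s = t).

Definition homotopic_X (g1 g2 : R -> Cpx) : Prop :=
  exists H : R -> R -> Cpx, cont2 H /\
    (forall t, H 0 t = g1 t) /\ (forall t, H 1 t = g2 t) /\
    (forall s t, H s (t + 1) = H s t) /\
    (forall s t, 0 <= s <= 1 -> X (H s t)).

Definition null_homotopic (g : R -> Cpx) : Prop :=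
  exists c, X c /\ homotopic_X g (fun _ => c).

(* homotopic into arbitrarily small neighbourhoods of a point of P_f
   (a finite point, or infinity) *)
Definition peripheral (g : R -> Cpx) : Prop :=
  (exists p, Pfin p /\ forall eps, eps > 0 ->
     exists g', loop_in_X g' /\ homotopic_X g g' /\
                forall t, cdist (g' t) p < eps)
  \/ (forall M, exists g', loop_in_X g' /\ homotopic_X g g' /\
                forall t, cnorm (g' t) > M).

Definition trivial_curve (g : R -> Cpx) : Prop :=
  null_homotopic g \/ peripheral g.

Definition open_set (U : Cpx -> Prop) : Prop :=
  forall z, U z -> exists e, e > 0 /\ forall w, cdist w z < e -> U w.

Definition connected (A : Cpx -> Prop) : Prop :=
  forall U V, open_set U -> open_set V ->
    (forall z, A z -> U z \/ V z) ->
    (exists z, A z /\ U z) -> (exists z, A z /\ V z) ->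
    exists z, A z /\ U z /\ V z.

Definition component (S K : Cpx -> Prop) : Prop :=
  (exists z, K z) /\ (forall z, K z -> S z) /\ connected K /\
  (forall K', connected K' -> (forall z, K' z -> S z) ->
     (forall z, K z -> K' z) -> forall z, K' z -> K z).

(* f^{-n}(gamma) as a subset of the plane (infinity is not a preimage) *)
Definition preimage_curve (n : nat) (g : R -> Cpx) : Cpx -> Prop :=
  fun z => exists t, Nat.iter n f z = g t.

(* Main.v *)
(** The winding number of a simple loop about a point is 0 or a sign depending only on the loop.  A loop
    [g] lifts through [f] to two loops when its winding number about the critical value [i] is even, and to
    one loop covering [g] twice otherwise; since winding numbers about [z] and [- z] add up to the one of
    the image about [f z], at most three successive lifts of a simple loop are double covers, unless the
    loop surrounds all three finite points of [P_f].  In the flat metric |dz| / |(z - i) (z - i + 1) (z + i)|^(1/2)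
    the map [f] is expanding by the factor 2 / |z - 1 + i|^(1/2) > 1 wherever |z| <= 2, so the lifts shrink, and
    a loop of small diameter surrounds at most one point of [P_f].

    A simple loop surrounding all three points is peripheral at infinity.  It is homotopic to a simple
    lattice polygon, by erasing the short detours of a fine sampling.  Cutting that polygon open and joining
    it to a large box along a slit gives a simple polygon surrounding no point of [P_f]; such a polygon
    is contracted by pushing corners across squares, so the loop is homotopic to the box. *)

From Stdlib Require Import Reals Lra Lia Psatz ZArith List Bool Classical ClassicalEpsilon.
From Coquelicot Require Import Coquelicot.
Require Import Defs.
Import ListNotations.

Open Scope Z_scope.

(** * Winding numbers of lattice cycles *)

(** The loop [g] is only continuous and may have infinite length, so the expanding metric says
    nothing about it directly. It is replaced by a homotopic lattice polygon, which has finite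
    speed; since homotopies in [X] lift through [f], every lift of [g] is homotopic to a lift of the
    polygon. Two facts remain tied to [g] itself: a component of a preimage is a simple loop, and it
    covers [g] at most eight times. The bound 8 = 2^3 comes from the three double covers. It bounds
    the initial speed of all lifts at once, so that one [n] serves all components. Nontriviality of
    [g] enters only to exclude a loop around all three points, whose lifts would be double covers
    for ever. The expansion holds only in [|z| <= 2]; lifts get there because [|z|^2 <= |f z| + 1].
    The Jordan curve theorem is avoided: winding numbers of a simple loop are read off an
    approximating simple lattice polygon, where they are sums of crossings with a ray. *)

Fixpoint path {T} (R : T -> T -> Prop) (a : T) (l : list T) : Prop :=
  match l with [] => True | b :: l' => R a b /\ path R b l' end.
Fixpoint psum {T} (phi : T -> T -> Z) (a : T) (l : list T) : Z :=
  match l with [] => 0 | b :: l' => phi a b + psum phi b l' end.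

Lemma path_app {T} (R : T -> T -> Prop) l1 : forall a b l2,
  path R a (l1 ++ b :: l2) <-> path R a (l1 ++ [b]) /\ path R b l2.
Proof. induction l1; simpl; intros; [tauto|]. rewrite IHl1. tauto. Qed.
Lemma psum_app {T} (phi : T -> T -> Z) l1 : forall a b l2,
  psum phi a (l1 ++ b :: l2) = psum phi a (l1 ++ [b]) + psum phi b l2.
Proof. induction l1; simpl; intros; [lia|]. rewrite IHl1. lia. Qed.
Lemma psum_ext {T} (phi psi : T -> T -> Z) l : forall a,
  (forall u v, In u (a :: l) -> In v (a :: l) -> phi u v = psi u v) -> psum phi a l = psum psi a l.
Proof.
  induction l; simpl; intros b H; auto. rewrite (H b a) by auto. f_equal.
  apply IHl. intros; apply H; simpl in *; tauto.
Qed.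
Lemma psum_0 {T} (phi : T -> T -> Z) l a :
  (forall u v, In u (a :: l) -> In v (a :: l) -> phi u v = 0) -> psum phi a l = 0.
Proof.
  intros H. rewrite (psum_ext phi (fun _ _ => 0)); auto.
  clear. revert a; induction l; simpl; auto.
Qed.

(** A cyclic sequence is written as a head and a list, and a change of base vertex is a chain of
    single rotations. The rotation statements for cycles below reduce to this. *)
Lemma rot_prop {T} (P : T -> list T -> Prop) :
  (forall x y l, P x (y :: l) -> P y (l ++ [x])) ->
  forall l1 x l z l2, x :: l = l1 ++ z :: l2 -> P x l -> P z (l2 ++ l1).
Proof.
  intros HP. induction l1 as [|w l1 IH]; simpl; intros x l z l2 He H.
  - injection He as -> ->. now rewrite app_nil_r.
  - injection He as -> ->. assert (HN : exists y l', l1 ++ z :: l2 = y :: l') by (destruct l1; simpl; eauto).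
    destruct HN as (y & l' & He). rewrite He in H. apply HP in H.
    replace (l2 ++ w :: l1) with ((l2 ++ [w]) ++ l1) by (rewrite <- app_assoc; reflexivity).
    apply (IH y (l' ++ [w])); auto.
    change (z :: l2 ++ [w]) with ((z :: l2) ++ [w]). rewrite app_assoc, He. reflexivity.
Qed.

Definition V : Type := (Z * Z)%type.
Definition veq_dec (u v : V) : {u = v} + {u <> v}.
Proof. decide equality; apply Z.eq_dec. Qed.

Definition step (u v : V) : Prop :=
  v = (fst u + 1, snd u) \/ v = (fst u - 1, snd u) \/ v = (fst u, snd u + 1) \/ v = (fst u, snd u - 1).

Lemma step_sym u v : step u v -> step v u.
Proof. destruct u, v; unfold step; simpl; intros [H|[H|[H|H]]]; injection H as -> ->;
  [right; left|left|right; right; right|right; right; left]; f_equal; lia. Qed.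
(* The lattice vertex [(x, y)] stands for the point [(x + 1/2, y + 1/2)], so that the faces of the
   lattice are centred at the points with integer coordinates; [cross F] is the signed crossing
   number of an edge with the horizontal ray leaving the face [F] to the right. *)
Definition cross (F u v : V) : Z :=
  if (fst u =? fst v) && (fst F <=? fst u) then
    if (snd u =? snd F - 1) && (snd v =? snd F) then 1
    else if (snd u =? snd F) && (snd v =? snd F - 1) then -1 else 0
  else 0.

Definition edge (u v a b : V) : Z :=
  (if veq_dec a u then if veq_dec b v then 1 else 0 else 0) -
  (if veq_dec a v then if veq_dec b u then 1 else 0 else 0).

Ltac zcase := repeat (match goal with
  | |- context [veq_dec ?a ?b] => destruct (veq_dec a b)
  | |- context [?a =? ?b] => destruct (Z.eqb_spec a b)
  | |- context [?a <=? ?b] => destruct (Z.leb_spec a b)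
  | |- context [?a <? ?b] => destruct (Z.ltb_spec a b)
  end; cbn [andb]; try lia; try congruence).
Ltac vinj := repeat match goal with H : (_, _) = (_, _) |- _ => injection H; clear H; intros end.

Lemma if_veq {T} (a b c d : Z) (p p' : T) :
  (if veq_dec (a, b) (c, d) then p else p') = if (a =? c) && (b =? d) then p else p'.
Proof.
  destruct (veq_dec (a, b) (c, d)) as [H|H].
  - injection H as -> ->. now rewrite !Z.eqb_refl.
  - destruct (Z.eqb_spec a c); destruct (Z.eqb_spec b d); auto. subst. tauto.
Qed.

(** The rays leaving two horizontally adjacent faces differ only by the vertical edge between the
    faces. *)
Lemma cross_step_x a b u v : cross (a, b) u v - cross (a + 1, b) u v = edge (a, b - 1) (a, b) u v.
Proof.
  destruct u as [x y], v as [x' y']. unfold cross, edge; simpl.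
  rewrite !if_veq. zcase.
Qed.

(** Indicator of the vertices between the rays leaving [(a, b)] and [(a, b + 1)]. A step crosses the
    two rays differently only by entering or leaving this strip, and the sole way in or out without
    crossing a ray is the edge at its left end. Around a closed path the changes of the indicator
    cancel. *)
Definition below (a b : Z) (u : V) : Z := if (snd u =? b) && (a <=? fst u) then 1 else 0.

Lemma cross_step_y a b u v : step u v ->
  cross (a, b + 1) u v - cross (a, b) u v = edge (a - 1, b) (a, b) u v - (below a b v - below a b u).
Proof.
  destruct u as [x y], v as [x' y']. unfold cross, edge, below, step; simpl.
  intros [H|[H|[H|H]]]; injection H as -> ->;
  rewrite !if_veq; zcase.
Qed.

(** The length condition excludes the walk back and forth along one edge. *)
Definition cycle (x : V) (l : list V) : Prop :=
  NoDup (x :: l) /\ (2 <= length l)%nat /\ path step x (l ++ [x]).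
(* Winding number of the closed path [x :: l ++ [x]] about the centre of the face [F]. *)
Definition cw (x : V) (l : list V) (F : V) : Z := psum (cross F) x (l ++ [x]).
Definition net (x : V) (l : list V) (u v : V) : Z := psum (edge u v) x (l ++ [x]).

Lemma closed_psum_rot {T} (phi : T -> T -> Z) x y l :
  psum phi y ((l ++ [x]) ++ [y]) = psum phi x ((y :: l) ++ [x]).
Proof. rewrite <- app_assoc. simpl. rewrite psum_app. simpl. lia. Qed.

Lemma cycle_rot x y l : cycle x (y :: l) -> cycle y (l ++ [x]).
Proof.
  intros (H1 & H2 & H3). split; [|split].
  - change (y :: l ++ [x]) with ((y :: l) ++ [x]). apply (NoDup_Add (a := x) (l := y :: l)).
    + rewrite <- (app_nil_r (y :: l)) at 1. apply Add_app.
    + inversion H1; subst. split; auto.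
  - rewrite length_app in *. simpl in *. lia.
  - simpl in H3. destruct H3 as [H3 H4]. rewrite <- app_assoc. simpl.
    apply path_app. split; auto. simpl. auto.
Qed.

Lemma psum_minus {T} (phi psi : T -> T -> Z) l : forall a,
  psum phi a l - psum psi a l = psum (fun u v => phi u v - psi u v) a l.
Proof. induction l; simpl; intros; auto. rewrite <- IHl. lia. Qed.

Lemma cw_x x l a b : cw x l (a, b) - cw x l (a + 1, b) = net x l (a, b - 1) (a, b).
Proof.
  unfold cw, net. rewrite psum_minus. apply psum_ext. intros; apply cross_step_x.
Qed.

Lemma last_cons {T} (l : list T) : forall a b, last (b :: l) a = last l b.
Proof.
  induction l as [|c l IH]; intros a b; auto.
  change (last (c :: l) a = last (c :: l) b). now rewrite !IH.
Qed.

Lemma psum_potential {T} (phi psi : T -> T -> Z) (h : T -> Z) R l : forall a,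
  (forall u v, R u v -> phi u v = psi u v - (h v - h u)) -> path R a l ->
  psum phi a l = psum psi a l - (h (last l a) - h a).
Proof.
  induction l as [|b l IH]; intros a H Hp; [simpl; lia|].
  rewrite last_cons. destruct Hp as [H1 H2]. cbn [psum]. rewrite (H a b H1), (IH b H H2). lia.
Qed.

Lemma cw_y x l a b : path step x (l ++ [x]) ->
  cw x l (a, b + 1) - cw x l (a, b) = net x l (a - 1, b) (a, b).
Proof.
  intros Hp. unfold cw, net. rewrite psum_minus.
  rewrite (psum_potential _ (edge (a - 1, b) (a, b)) (below a b) step); auto.
  - rewrite last_last. lia.
  - intros u v H. now apply cross_step_y.
Qed.

Lemma edge_absent u v l a : ~ In v (a :: l) -> psum (edge u v) a l = 0.
Proof.
  intros H. apply psum_0. intros s t Hs Ht. unfold edge. zcase; subst; tauto.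
Qed.
Lemma edge_sym u v a b : edge u v a b = - edge v u a b.
Proof. unfold edge. zcase; subst; lia. Qed.
Lemma net_sym x l u v : net x l u v = - net x l v u.
Proof.
  unfold net. generalize (l ++ [x]). intros l0. revert x. induction l0; simpl; intros; auto.
  rewrite IHl0, edge_sym. lia.
Qed.

Lemma net_first x y l : cycle x (y :: l) -> net x (y :: l) x y = 1.
Proof.
  intros (H1 & H2 & _). unfold net. destruct l as [|z l]; [simpl in H2; lia|].
  simpl. rewrite edge_absent.
  - unfold edge. inversion H1 as [|? ? N1 H3]; subst. inversion H3 as [|? ? N2 H4]; subst. simpl in *.
    zcase; subst; exfalso; tauto.
  - inversion H1 as [|? ? N1 H3]; subst. inversion H3 as [|? ? N2 H4]; subst.
    simpl in *. rewrite in_app_iff. simpl. intuition.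
Qed.
Lemma net_second x y z l w : cycle x (y :: z :: l) -> w <> x -> w <> z -> net x (y :: z :: l) w y = 0.
Proof.
  intros (H1 & H2 & _) Hx Hz. unfold net. simpl. rewrite edge_absent.
  - unfold edge. inversion H1 as [|? ? N1 H3]; subst. inversion H3 as [|? ? N2 H4]; subst. simpl in *.
    zcase; subst; exfalso; tauto.
  - inversion H1 as [|? ? N1 H3]; subst. inversion H3 as [|? ? N2 H4]; subst.
    simpl in *. rewrite in_app_iff. simpl. intuition.
Qed.
Lemma net_absent x l u v : ~ In v (x :: l) -> net x l u v = 0.
Proof. intros H. apply edge_absent. simpl in *. rewrite in_app_iff. simpl. tauto. Qed.

Definition left_face (u v : V) : V :=
  if fst u =? fst v then (if snd u <? snd v then (fst u, snd v) else (fst u + 1, snd u))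
  else if fst u <? fst v then (fst v, snd u + 1) else (fst u, snd u).

(** One turns around [y] from one left face to the other without crossing the cycle: the edges at
    [y] that do not lead to [x] or [z] have [net] zero. *)
Lemma cw_left x y z l : cycle x (y :: z :: l) ->
  cw x (y :: z :: l) (left_face x y) = cw x (y :: z :: l) (left_face y z).
Proof.
  intros H. assert (Hp := H). destruct Hp as (Hnd & _ & Hp).
  set (c := y :: z :: l) in *.
  assert (Hxz : x <> z). { inversion Hnd as [|? ? N1 H3]; subst. unfold c in N1. simpl in N1. intuition. }
  assert (Hxy : step x y) by (destruct Hp; auto).
  assert (Hyz : step y z) by (destruct Hp as [_ [? _]]; auto).
  destruct y as [p q].
  assert (Nw := fun w => net_second x (p, q) z l w H). fold c in Nw.
  (* The four faces around [y = (p, q)] are compared across the four edges at [y]. *)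
  assert (S1 := cw_x x c p q). assert (S2 := cw_x x c p (q + 1)).
  assert (S3 := cw_y x c p q Hp). assert (S4 := cw_y x c (p + 1) q Hp).
  replace (q + 1 - 1) with q in S2 by lia. replace (p + 1 - 1) with p in S4 by lia.
  rewrite (net_sym _ _ (p, q) (p, q + 1)) in S2. rewrite (net_sym _ _ (p, q) (p + 1, q)) in S4.
  apply step_sym in Hxy. destruct x as [x1 x2], z as [z1 z2]. unfold step in Hxy, Hyz. simpl in Hxy, Hyz.
  destruct Hxy as [Hxy|[Hxy|[Hxy|Hxy]]]; injection Hxy as -> ->;
  destruct Hyz as [Hyz|[Hyz|[Hyz|Hyz]]]; injection Hyz as -> ->; try (exfalso; apply Hxz; reflexivity);
  unfold left_face; simpl;
  repeat match goal with
  | |- context [?a =? ?b] => destruct (Z.eqb_spec a b); try lia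
  | |- context [?a <? ?b] => destruct (Z.ltb_spec a b); try lia
  end;
  try rewrite (Nw (p + 1, q)) in S4 by (intros A; injection A; lia);
  try rewrite (Nw (p - 1, q)) in S3 by (intros A; injection A; lia);
  try rewrite (Nw (p, q + 1)) in S2 by (intros A; injection A; lia);
  try rewrite (Nw (p, q - 1)) in S1 by (intros A; injection A; lia);
  repeat match goal with |- context [?a - 1 + 1] => replace (a - 1 + 1) with a by lia end; lia.
Qed.

(** Each rotation applies [cw_left] once, which carries the value on the left face along the cycle;
    any edge may then be taken as the first one. *)
Lemma cw_left_rot x y l z m l1 l2 : cycle x (y :: l) -> x :: y :: l = l1 ++ z :: l2 -> l2 ++ l1 = m ->
  cycle z m /\ (forall F, cw z m F = cw x (y :: l) F) /\ (forall u v, net z m u v = net x (y :: l) u v) /\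
  exists w m', m = w :: m' /\ cw x (y :: l) (left_face z w) = cw x (y :: l) (left_face x y).
Proof.
  intros H He <-.
  apply (rot_prop (fun z m => cycle z m /\ (forall F, cw z m F = cw x (y :: l) F) /\
    (forall u v, net z m u v = net x (y :: l) u v) /\
    exists w m', m = w :: m' /\ cw x (y :: l) (left_face z w) = cw x (y :: l) (left_face x y))) with (3 := conj H (conj (fun F => eq_refl) (conj (fun u v => eq_refl) (ex_intro _ y (ex_intro _ l (conj eq_refl eq_refl))))))
    (l1 := l1) (2 := He).
  clear. intros u v m (Hc & Hcw & Hnet & w & m' & Hm & HL). injection Hm as <- <-.
  split; [now apply cycle_rot|]. split; [|split].
  - intros F. rewrite <- Hcw. apply closed_psum_rot.
  - intros s t. rewrite <- Hnet. apply closed_psum_rot.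
  - destruct m as [|w m]; [destruct Hc as (_ & A & _); simpl in A; lia|].
    exists w, (m ++ [u]). split; auto. rewrite <- HL, <- !Hcw. symmetry. now apply cw_left.
Qed.

Lemma psum_nonzero {T} (phi : T -> T -> Z) l : forall a, psum phi a l <> 0 ->
  exists l1 u v l2, a :: l = l1 ++ u :: v :: l2 /\ phi u v <> 0.
Proof.
  induction l as [|b l IH]; simpl; intros a H; [lia|].
  destruct (Z.eq_dec (phi a b) 0) as [E|E].
  - destruct (IH b) as (l1 & u & v & l2 & H1 & H2); [lia|]. exists (a :: l1), u, v, l2. rewrite H1; auto.
  - exists [], a, b, l. auto.
Qed.

Lemma edge_rot {T} (x : T) l u v l1 l2 : (2 <= length l)%nat -> x :: l ++ [x] = l1 ++ u :: v :: l2 ->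
  exists l1' l2' m, x :: l = l1' ++ u :: l2' /\ l2' ++ l1' = v :: m.
Proof.
  intros Hlen He. destruct l2 as [|w l2 _] using rev_ind.
  - change (l1 ++ [u; v]) with (l1 ++ [u] ++ [v]) in He. rewrite app_assoc in He.
    change (x :: l ++ [x]) with ((x :: l) ++ [x]) in He. apply app_inj_tail in He. destruct He as [He <-].
    destruct l1 as [|w l1]; simpl in He; injection He as E1 E2; [subst; simpl in Hlen; lia|].
    subst w l. exists (x :: l1), [], l1. auto.
  - change (l1 ++ u :: v :: l2 ++ [w]) with (l1 ++ (u :: v :: l2) ++ [w]) in He. rewrite app_assoc in He.
    change (x :: l ++ [x]) with ((x :: l) ++ [x]) in He. apply app_inj_tail in He. destruct He as [He <-].
    exists l1, (v :: l2), (l2 ++ l1). auto.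
Qed.

Lemma cw_far x l a b : (forall u, In u (x :: l) -> fst u < a) -> cw x l (a, b) = 0.
Proof.
  intros H. unfold cw. apply psum_0. intros u v Hu _. unfold cross; simpl.
  assert (fst u < a). { apply H. simpl in *. rewrite in_app_iff in Hu; simpl in Hu; tauto. }
  zcase; auto; lia.
Qed.
Lemma cw_above x l a b : (forall u, In u (x :: l) -> snd u < b) -> cw x l (a, b) = 0.
Proof.
  intros H. unfold cw. apply psum_0. intros u v Hu Hv. unfold cross; simpl.
  assert (snd u < b). { apply H. simpl in *. rewrite in_app_iff in Hu; simpl in Hu; tauto. }
  assert (snd v < b). { apply H. simpl in *. rewrite in_app_iff in Hv; simpl in Hv; tauto. }
  zcase; auto; lia.
Qed.

Lemma list_bound (h : V -> Z) l : exists B, forall u, In u l -> h u < B.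
Proof.
  induction l as [|v l [B HB]]; [exists 0; simpl; tauto|].
  exists (Z.max B (h v + 1)). simpl. intros u [<-|Hu]; [lia|]. specialize (HB u Hu). lia.
Qed.

(** The cycle uses the edge once, so the two faces differ by 1, and the one on its left has the
    common left value [L]. The two cases are the two directions of the edge. *)
Lemma cw_edge_x x y l a b : cycle x (y :: l) -> net x (y :: l) (a, b - 1) (a, b) <> 0 ->
  let L := cw x (y :: l) (left_face x y) in
  (cw x (y :: l) (a, b) = L /\ cw x (y :: l) (a + 1, b) = L - 1) \/
  (cw x (y :: l) (a, b) = L - 1 /\ cw x (y :: l) (a + 1, b) = L).
Proof.
  intros H Hn L. assert (Hx := cw_x x (y :: l) a b).
  destruct (psum_nonzero _ _ _ Hn) as (l1 & u & v & l2 & He & Huv).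
  destruct (edge_rot x (y :: l) u v l1 l2) as (l1' & l2' & m & E1 & E2); auto; [apply H|].
  destruct (cw_left_rot x y l u (v :: m) l1' l2' H E1 E2) as (Hc & Hcw & Hnet & w & m' & Hm & HL).
  injection Hm as <- <-. fold L in HL.
  assert (N1 := net_first u v m Hc). rewrite Hnet in N1.
  unfold edge in Huv. destruct (veq_dec u (a, b - 1)); [destruct (veq_dec v (a, b))|].
  - subst u v. left. rewrite N1 in Hx. unfold left_face in HL; simpl in HL.
    rewrite Z.eqb_refl in HL. destruct (Z.ltb_spec (b - 1) b); [|lia]. lia.
  - destruct (veq_dec u (a, b)); [|exfalso; apply Huv; reflexivity]. subst. exfalso. vinj. lia.
  - destruct (veq_dec u (a, b)); [|exfalso; apply Huv; reflexivity].
    destruct (veq_dec v (a, b - 1)); [|exfalso; apply Huv; reflexivity]. subst u v. right.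
    rewrite net_sym in N1. unfold left_face in HL; simpl in HL.
    rewrite Z.eqb_refl in HL. destruct (Z.ltb_spec b (b - 1)); [lia|]. lia.
Qed.

(* By [cw_left] the faces on the left of the cycle all have the same winding number [L], and those on its
   right have [L - 1]; a horizontal ray shows that every other value is 0 and that [L] or [L - 1] is 0. *)
Lemma cycle_cw x l : cycle x l ->
  (forall F, cw x l F = 0 \/ cw x l F = 1) \/ (forall F, cw x l F = 0 \/ cw x l F = -1).
Proof.
  intros H. destruct l as [|y l]; [destruct H as (_ & A & _); simpl in A; lia|].
  set (L := cw x (y :: l) (left_face x y)).
  destruct (list_bound fst (x :: y :: l)) as [B HB].
  (* Induction on the distance to a bound [B] on the right of the cycle, beyond which the winding
     number is 0. *)
  assert (Hscan : forall n a b, B - a < Z.of_nat n -> cw x (y :: l) (a, b) <> 0 ->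
     (cw x (y :: l) (a, b) = L \/ cw x (y :: l) (a, b) = L - 1) /\ (L = 0 \/ L = 1)).
  { induction n; intros a b Hn Hne.
    - exfalso. apply Hne. apply cw_far. intros u Hu. specialize (HB u Hu). lia.
    - assert (Hx := cw_x x (y :: l) a b).
      destruct (Z.eq_dec (net x (y :: l) (a, b - 1) (a, b)) 0) as [E|E].
      + destruct (IHn (a + 1) b); [lia|lia|]. split; auto. lia.
      + assert (He := cw_edge_x x y l a b H E). fold L in He. cbv zeta in He.
        split; [lia|]. destruct (Z.eq_dec (cw x (y :: l) (a + 1, b)) 0) as [E2|E2]; [lia|].
        apply (IHn (a + 1) b); auto. lia. }
  assert (Hs : forall F, cw x (y :: l) F <> 0 -> (cw x (y :: l) F = L \/ cw x (y :: l) F = L - 1) /\ (L = 0 \/ L = 1)).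
  { intros [a b] Hne. apply (Hscan (Z.to_nat (B - a + 1))); auto.
    assert (~ (B <= a)). { intros Hle. apply Hne. apply cw_far. intros u Hu. specialize (HB u Hu). lia. } lia. }
  destruct (Z.eq_dec L 1) as [E|E].
  - left. intros F. destruct (Z.eq_dec (cw x (y :: l) F) 0); auto. destruct (Hs F); auto. lia.
  - right. intros F. destruct (Z.eq_dec (cw x (y :: l) F) 0); auto. destruct (Hs F); auto. lia.
Qed.

(** * Contractible lattice cycles *)

Ltac norm_app := repeat (progress cbn [app] || rewrite <- app_assoc).
Tactic Notation "norm_app" "in" hyp(H) := repeat (progress cbn [app] in H || rewrite <- app_assoc in H).

Definition in_sq (F u : V) : Prop :=
  (fst u = fst F - 1 \/ fst u = fst F) /\ (snd u = snd F - 1 \/ snd u = snd F).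

(* Homotopy of lattice paths with fixed ends; the faces in [Pu] are punctured. *)
Inductive peq (Pu : V -> Prop) : list V -> list V -> Prop :=
| peq_refl l : peq Pu l l
| peq_sym l l' : peq Pu l l' -> peq Pu l' l
| peq_trans l l' l'' : peq Pu l l' -> peq Pu l' l'' -> peq Pu l l''
| peq_dup l1 a l2 : peq Pu (l1 ++ a :: a :: l2) (l1 ++ a :: l2)
| peq_spur l1 a b l2 : step a b -> peq Pu (l1 ++ a :: b :: a :: l2) (l1 ++ a :: l2)
| peq_face l1 a b c d F l2 : ~ Pu F -> in_sq F a -> in_sq F b -> in_sq F c -> in_sq F d ->
    peq Pu (l1 ++ a :: b :: c :: l2) (l1 ++ a :: d :: c :: l2).

Lemma peq_app Pu p s l l' : peq Pu l l' -> peq Pu (p ++ l ++ s) (p ++ l' ++ s).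
Proof.
  induction 1.
  - apply peq_refl.
  - now apply peq_sym.
  - eapply peq_trans; eauto.
  - rewrite <- !app_assoc, !(app_assoc p). apply peq_dup.
  - rewrite <- !app_assoc, !(app_assoc p). now apply peq_spur.
  - rewrite <- !app_assoc, !(app_assoc p). now apply (peq_face Pu (p ++ l1) a b c d F).
Qed.
Lemma peq_rev Pu l l' : peq Pu l l' -> peq Pu (rev l) (rev l').
Proof.
  induction 1.
  - apply peq_refl.
  - now apply peq_sym.
  - eapply peq_trans; eauto.
  - rewrite !rev_app_distr. simpl. rewrite <- !app_assoc. simpl. apply peq_dup.
  - rewrite !rev_app_distr. simpl. rewrite <- !app_assoc. simpl. now apply peq_spur.
  - rewrite !rev_app_distr. simpl. rewrite <- !app_assoc. simpl. now apply (peq_face Pu (rev l2) c b a d F).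
Qed.
Definition null (Pu : V -> Prop) (x : V) (l : list V) : Prop := peq Pu (x :: l ++ [x]) [x].

(** Conjugation by the edge from [y] to [x]: a spur is added in front, the contractible loop at [x]
    is removed, and a spur is left. *)
Lemma null_rot Pu x y l : step x y -> null Pu x (y :: l) -> null Pu y (l ++ [x]).
Proof.
  unfold null. intros Hs H. rewrite <- app_assoc. simpl.
  apply (peq_trans _ _ (y :: x :: y :: l ++ [x; y])).
  - apply peq_sym. apply (peq_spur Pu [] y x). now apply step_sym.
  - apply (peq_trans _ _ [y; x; y]).
    + assert (A := peq_app Pu [y] [y] _ _ H). simpl in A. rewrite <- app_assoc in A. exact A.
    + apply (peq_spur Pu [] y x []). now apply step_sym.
Qed.

Lemma null_rotated Pu x l z l1 l2 : cycle x l -> x :: l = l1 ++ z :: l2 -> null Pu x l -> null Pu z (l2 ++ l1).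
Proof.
  intros H He Hn. apply (rot_prop (fun x l => cycle x l /\ null Pu x l)) with (2 := He); auto.
  clear. intros x y l [H Hn]. split; [now apply cycle_rot|]. apply null_rot; auto. apply H.
Qed.
Lemma cycle_rotated x l z l1 l2 : cycle x l -> x :: l = l1 ++ z :: l2 -> cycle z (l2 ++ l1).
Proof.
  intros H He. apply (rot_prop cycle) with (2 := He); auto. intros; now apply cycle_rot.
Qed.
Lemma psum_rotated {T} (phi : T -> T -> Z) x l z l1 l2 : x :: l = l1 ++ z :: l2 ->
  psum phi z ((l2 ++ l1) ++ [z]) = psum phi x (l ++ [x]).
Proof.
  intros He. apply (rot_prop (fun z m => psum phi z (m ++ [z]) = psum phi x (l ++ [x]))) with (2 := He); auto.
  intros u v m <-. apply closed_psum_rot.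
Qed.
(** Rotating further leads back to [x], so [null_rotated] also serves in the reverse direction. *)
Lemma null_unrotate Pu x l z l1 l2 : cycle x l -> x :: l = l1 ++ z :: l2 -> null Pu z (l2 ++ l1) -> null Pu x l.
Proof.
  intros H He Hn. assert (Hc := cycle_rotated _ _ _ _ _ H He).
  destruct l1 as [|w l1]; simpl in He; injection He as -> ->.
  - now rewrite app_nil_r in Hn.
  - apply (null_rotated Pu z (l2 ++ w :: l1) w (z :: l2) l1); auto.
Qed.

Lemma psum_rev {T} (phi : T -> T -> Z) l : forall x y, (forall u v, phi u v = - phi v u) ->
  psum phi y (rev l ++ [x]) = - psum phi x (l ++ [y]).
Proof.
  induction l as [|z l IH]; simpl; intros x y H.
  - rewrite (H y x). lia.
  - rewrite <- app_assoc. simpl. rewrite psum_app. rewrite IH by auto. simpl. rewrite (H z x). lia.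
Qed.
Lemma path_rev {T} (R : T -> T -> Prop) l : (forall u v, R u v -> R v u) -> forall x y,
  path R x (l ++ [y]) -> path R y (rev l ++ [x]).
Proof.
  intros HR. induction l as [|z l IH]; simpl; intros x y H.
  - split; auto. apply HR, H.
  - rewrite <- app_assoc. simpl. apply path_app. destruct H as [H1 H2]. split; [apply IH; auto|]. simpl; auto.
Qed.
Lemma cross_anti F u v : cross F u v = - cross F v u.
Proof. destruct F, u, v. unfold cross; simpl. zcase. Qed.
Lemma cycle_rev x l : cycle x l -> cycle x (rev l).
Proof.
  intros (H1 & H2 & H3). split; [|split].
  - inversion H1; subst. constructor; [now rewrite <- in_rev|now apply NoDup_rev].
  - now rewrite length_rev.
  - apply path_rev; auto using step_sym.
Qed.
Lemma cw_rev x l F : cw x (rev l) F = - cw x l F.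
Proof. unfold cw. apply psum_rev. apply cross_anti. Qed.
Lemma null_rev Pu x l : null Pu x (rev l) -> null Pu x l.
Proof.
  unfold null. intros H. apply peq_rev in H. simpl in H.
  rewrite rev_app_distr, rev_involutive in H. exact H.
Qed.

Lemma top_left (l : list V) x : exists T, In T (x :: l) /\
  forall u : V, In u (x :: l) -> snd u < snd T \/ (snd u = snd T /\ fst T <= fst u).
Proof.
  induction l as [|y l (T & HT & HM)].
  - exists x. split; [now left|]. intros u [<-|[]]. lia.
  - destruct (Z_lt_ge_dec (snd T) (snd y)) as [H|H]; [|destruct (Z.eq_dec (snd y) (snd T)) as [H'|H']; [destruct (Z_lt_ge_dec (fst y) (fst T)) as [H2|H2]|]].
    1, 2: exists y; split; [simpl; auto|]; intros u [<-|[<-|Hu]];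
      [specialize (HM x (or_introl eq_refl)); lia|lia|specialize (HM u (or_intror Hu)); lia].
    all: exists T; split; [simpl in *; tauto|]; intros u [<-|[<-|Hu]];
      [specialize (HM x (or_introl eq_refl)); lia|lia|specialize (HM u (or_intror Hu)); lia].
Qed.

(* It suffices to prove [P] for cycles running clockwise through their top-left corner. *)
Lemma corner (P : V -> list V -> Prop) (x : V) (l : list V) :
  (forall x l z l1 l2, cycle x l -> x :: l = l1 ++ z :: l2 -> P z (l2 ++ l1) -> P x l) ->
  (forall x l, cycle x l -> P x (rev l) -> P x l) ->
  (forall a h m, (forall u : V, In u ((a, h) :: (a + 1, h) :: m ++ [(a, h - 1)]) -> snd u <= h) ->
     cycle (a, h) ((a + 1, h) :: m ++ [(a, h - 1)]) ->
     incl ((a, h) :: (a + 1, h) :: m ++ [(a, h - 1)]) (x :: l) ->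
     incl (x :: l) ((a, h) :: (a + 1, h) :: m ++ [(a, h - 1)]) ->
     P (a, h) ((a + 1, h) :: m ++ [(a, h - 1)])) ->
  cycle x l -> P x l.
Proof.
  intros Hrot Hrev Hmain H.
  destruct (top_left l x) as (T & HT & HM). destruct (in_split _ _ HT) as (l1 & l2 & He).
  apply (Hrot x l T l1 l2); auto. assert (Hc := cycle_rotated _ _ _ _ _ H He).
  assert (Hiff : forall u : V, In u (T :: l2 ++ l1) <-> In u (x :: l)).
  { intros u. change (In u (T :: l2 ++ l1) <-> @In V u (@cons V x l)). rewrite He, in_app_iff. simpl. rewrite in_app_iff. tauto. }
  assert (HM' : forall u, In u (T :: l2 ++ l1) -> snd u < snd T \/ (snd u = snd T /\ fst T <= fst u)).
  { intros u Hu. apply HM. now apply Hiff. }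
  assert (Hinc1 : incl (T :: l2 ++ l1) (x :: l)) by (intros u Hu; now apply Hiff).
  assert (Hinc2 : incl (x :: l) (T :: l2 ++ l1)) by (intros u Hu; now apply Hiff).
  clear Hiff.
  remember (l2 ++ l1) as r. clear Heqr He HM HT l1 l2.
  destruct Hc as (Hnd & Hlen & Hp). destruct r as [|z1 r]; [simpl in Hlen; lia|].
  destruct r as [|z2 m _] using rev_ind; [simpl in Hlen; lia|].
  assert (S1 : step T z1) by (destruct Hp; auto).
  assert (S2 : step T z2).
  { change ((z1 :: m ++ [z2]) ++ [T]) with (z1 :: ((m ++ [z2]) ++ [T])) in Hp. rewrite <- app_assoc in Hp.
    destruct Hp as [_ Hp]. simpl in Hp. apply path_app in Hp. apply step_sym. apply Hp. }
  assert (Hne : z1 <> z2).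
  { intros ->. inversion Hnd as [|? ? _ H3]; subst. inversion H3 as [|? ? N _]; subst. apply N. rewrite in_app_iff; simpl; auto. }
  assert (M1 := HM' z1 ltac:(simpl; auto)). assert (M2 := HM' z2 ltac:(simpl; rewrite in_app_iff; simpl; auto)).
  assert (Hy : forall u, In u (T :: z1 :: m ++ [z2]) -> snd u <= snd T) by (intros u Hu; specialize (HM' u Hu); lia).
  destruct T as [a h], z1 as [x1 y1], z2 as [x2 y2]. unfold step in *. simpl in *.
  (* No vertex lies above [T], nor to its left in the same row, so its neighbours on the cycle are
     the right one and the lower one. Their order is the orientation. *)
  assert (Hcase : (x1 = a + 1 /\ y1 = h /\ x2 = a /\ y2 = h - 1) \/ (x2 = a + 1 /\ y2 = h /\ x1 = a /\ y1 = h - 1)).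
  { destruct S1 as [S1|[S1|[S1|S1]]]; injection S1 as -> ->; destruct S2 as [S2|[S2|[S2|S2]]]; injection S2 as -> ->;
    try (exfalso; apply Hne; reflexivity); lia. }
  destruct Hcase as [(-> & -> & -> & ->)|(-> & -> & -> & ->)].
  - apply Hmain; auto. split; auto.
  - apply Hrev; [split; auto|]. simpl. rewrite rev_app_distr. simpl.
    assert (Hin : forall u, In u ((a, h) :: (a + 1, h) :: rev m ++ [(a, h - 1)]) <-> In u ((a, h) :: (a, h - 1) :: m ++ [(a + 1, h)])).
    { intros u. simpl. rewrite !in_app_iff, <- in_rev. simpl. clear. tauto. }
    apply Hmain.
    + intros u Hu. apply Hy. now apply Hin.
    + assert (Hcr : cycle (a, h) (rev ((a, h - 1) :: m ++ [(a + 1, h)]))) by (apply cycle_rev; split; auto).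
      simpl in Hcr. rewrite rev_app_distr in Hcr. exact Hcr.
    + intros u Hu. now apply Hinc1, Hin.
    + intros u Hu. now apply Hin, Hinc2.
Qed.

(** Measure for the contraction. Each vertex at level [Y] or above counts at least 1, so the measure
    drops both when a corner is pushed down and when the cycle is cut into two pieces. *)
Fixpoint height (Y : Z) (l : list V) : Z :=
  match l with [] => 0 | u :: l' => (snd u - Y + 1) + height Y l' end.
Lemma height_app Y l1 l2 : height Y (l1 ++ l2) = height Y l1 + height Y l2.
Proof. induction l1; simpl; lia. Qed.
Lemma height_ge Y l : (forall u : V, In u l -> Y <= snd u) -> 0 <= height Y l.
Proof. induction l; simpl; intros H; [lia|]. assert (Y <= snd a) by auto. assert (0 <= height Y l) by auto. lia. Qed.
Lemma height_rev Y l : height Y (rev l) = height Y l.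
Proof. induction l; simpl; auto. rewrite height_app, IHl. simpl. lia. Qed.

Definition face_ind (F F' : V) : Z := if veq_dec F F' then 1 else 0.

(* Pushing a corner across the square [F] changes the winding number of [F] only. *)
Lemma cross_corner a h F' :
  cross F' (a, h - 1) (a, h) + cross F' (a, h) (a + 1, h) =
  cross F' (a, h - 1) (a + 1, h - 1) + cross F' (a + 1, h - 1) (a + 1, h) - face_ind (a + 1, h) F'.
Proof.
  destruct F' as [p r]. unfold cross, face_ind; simpl. rewrite if_veq. zcase.
Qed.

(** The face above the top edge has winding number 0, and the edge is traversed to the right, so the
    face below it has -1. *)
Lemma corner_face a h m : (forall u : V, In u ((a, h) :: (a + 1, h) :: m ++ [(a, h - 1)]) -> snd u <= h) ->
  cycle (a, h) ((a + 1, h) :: m ++ [(a, h - 1)]) ->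
  cw (a, h) ((a + 1, h) :: m ++ [(a, h - 1)]) (a + 1, h) = -1.
Proof.
  intros Hy H. assert (A := cw_y _ _ (a + 1) h (proj2 (proj2 H))).
  rewrite cw_above in A. 2:{ intros u Hu. specialize (Hy u Hu). lia. }
  replace (a + 1 - 1) with a in A by lia. rewrite net_first in A by auto. lia.
Qed.

Lemma NoDup_incl_app {T} (a : T) l1 l2 : NoDup (l1 ++ a :: l2) -> NoDup (a :: l1) /\ NoDup (a :: l2).
Proof.
  intros H. split.
  - apply NoDup_remove in H. destruct H as [H1 H2]. constructor.
    + intros N. apply H2. rewrite in_app_iff; auto.
    + now apply NoDup_app_remove_r in H1.
  - now apply NoDup_app_remove_l in H.
Qed.

(* If the fourth vertex [D] of the square at the corner [T] is not on the cycle, push [T] to [D].  Otherwise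
   cutting at [D] leaves two shorter cycles of the same orientation; their winding numbers about a
   puncture have the same sign and add up to 0, so both vanish. *)
Lemma null_core Pu a h (m : list V) Y :
  let A : V := (a, h - 1) in let T : V := (a, h) in let S : V := (a + 1, h) in
  (forall u : V, In u (T :: S :: m ++ [A]) -> Y <= snd u <= h) ->
  cycle T (S :: m ++ [A]) ->
  (forall p, Pu p -> cw T (S :: m ++ [A]) p = 0) ->
  (forall x l, cycle x l -> (forall u : V, In u (x :: l) -> Y <= snd u) ->
     (forall p, Pu p -> cw x l p = 0) -> height Y (x :: l) < height Y (T :: S :: m ++ [A]) -> null Pu x l) ->
  null Pu T (S :: m ++ [A]).
Proof.
  intros A T S Hy H HP IH. set (D := (a + 1, h - 1) : V). set (F := (a + 1, h) : V).
  assert (Hcf : cw T (S :: m ++ [A]) F = -1) by (apply corner_face; auto; intros u Hu; apply Hy, Hu).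
  (* Punctures have winding number 0, whereas [F] has -1; hence the square at the corner may be
     crossed. *)
  assert (HF : ~ Pu F) by (intros N; rewrite HP in Hcf by auto; discriminate).
  assert (Hcorner : forall u, u = A \/ u = T \/ u = S \/ u = D -> in_sq F u).
  { unfold in_sq, F, A, T, S, D. intros u [-> | [-> | [-> | ->]]]; simpl; lia. }
  assert (HTA : step T A) by (unfold step, T, A; simpl; auto).
  assert (HAD : step A D) by (unfold step, D, A; simpl; auto).
  assert (HDS : step D S). { unfold step, D, S; simpl. right; right; left. f_equal; lia. }
  (* The edge [T S] becomes the detour [T A D S]: a spur to [A], then a push of the corner [A T S]
     across the square [F]. *)
  assert (Hhead : forall r, peq Pu (T :: S :: r) (T :: A :: D :: S :: r)).
  { intros r. apply (peq_trans _ _ (T :: A :: T :: S :: r)).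
    - apply peq_sym. now apply (peq_spur Pu [] T A).
    - apply (peq_face Pu [T] A T S D F); auto. }
  destruct H as (Hnd & Hlen & Hpath). assert (H : cycle T (S :: m ++ [A])) by (split; auto).
  assert (HyA : Y <= h - 1) by (apply (Hy A); simpl; rewrite in_app_iff; simpl; auto).
  destruct (classic (In D m)) as [HD|HD].
  - destruct (in_split _ _ HD) as (l1 & l2 & ->).
    rewrite <- app_assoc in *. cbn [app] in *.
    assert (HP1 : path step S (l1 ++ [D]) /\ path step D (l2 ++ [A])).
    { destruct Hpath as [_ Hpath]. rewrite <- app_assoc in Hpath. cbn [app] in Hpath.
      rewrite path_app in Hpath. destruct Hpath as [P1 P2]. rewrite <- app_assoc in P2. cbn [app] in P2.
      rewrite path_app in P2. tauto. }
    destruct HP1 as [P1 P2].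
    assert (N1 : ~ In T (S :: l1 ++ D :: l2 ++ [A])) by (now inversion Hnd).
    assert (N2 : NoDup ((S :: l1) ++ D :: l2 ++ [A])) by (now inversion Hnd).
    destruct (NoDup_incl_app _ _ _ N2) as [Q1 Q2].
    change (D :: l2 ++ [A]) with ((D :: l2) ++ A :: []) in Q2.
    destruct (NoDup_incl_app _ _ _ Q2) as [Q3 _].
    assert (HT1 : ~ In T (D :: S :: l1)).
    { intros N. apply N1. simpl in *. rewrite !in_app_iff. simpl. tauto. }
    assert (HT2 : ~ In T (A :: D :: l2)).
    { intros N. apply N1. simpl in *. rewrite !in_app_iff. simpl. rewrite in_app_iff. simpl. tauto. }
    assert (Hy1 : forall u : V, In u (D :: S :: l1) -> Y <= snd u <= h).
    { intros u Hu. apply Hy. simpl in *. rewrite !in_app_iff. simpl. tauto. }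
    assert (Hy2 : forall u : V, In u (A :: D :: l2) -> Y <= snd u <= h).
    { intros u Hu. apply Hy. simpl in *. rewrite !in_app_iff. simpl. rewrite in_app_iff. simpl. tauto. }
    assert (Hmu : height Y (T :: S :: l1 ++ D :: l2 ++ [A]) = height Y (D :: S :: l1) + height Y (A :: D :: l2) + 1).
    { cbn [height]. rewrite height_app. cbn [height]. rewrite height_app. cbn [height].
      unfold T, S, D, A; cbn [fst snd]. lia. }
    assert (Hm1 : 0 <= height Y (D :: S :: l1)) by (apply height_ge; intros u Hu; apply Hy1, Hu).
    assert (Hm2 : 0 <= height Y (A :: D :: l2)) by (apply height_ge; intros u Hu; apply Hy2, Hu).
    (* If [l1] is empty, [D] directly follows [S] and this piece is a spur, not a cycle. *)
    assert (C1 : l1 <> [] -> cycle D (S :: l1)).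
    { intros Hl. split; [auto|split].
      - destruct l1; [tauto|]. simpl; lia.
      - simpl. split; auto. }
    assert (C2 : l2 <> [] -> cycle A (D :: l2)).
    { intros Hl. split; [auto|split].
      - destruct l2; [tauto|]. simpl; lia.
      - simpl. split; auto. }
    assert (Hsum : forall p, cw T (S :: l1 ++ D :: l2 ++ [A]) p = cw D (S :: l1) p + cw A (D :: l2) p - face_ind F p).
    { intros p. unfold cw. cbn [app psum]. rewrite <- app_assoc. cbn [app]. rewrite psum_app.
      cbn [app]. rewrite <- app_assoc. cbn [app]. rewrite (psum_app _ l2). cbn [psum].
      generalize (cross_corner a h p). unfold T, S, A, D, F. lia. }
    assert (W1 : forall p, cw D (S :: l1) p = 0 \/ cw D (S :: l1) p = -1).
    { destruct (classic (l1 = [])) as [->|Hl].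
      - intros p. left. unfold cw. simpl. rewrite (cross_anti p S D). lia.
      - specialize (C1 Hl). destruct (cycle_cw _ _ C1) as [K|K]; auto. exfalso.
        (* The piece misses [T], so no edge separates [F] from the face above it, and [F] has number
           0. As [F] is on the left of the edge from [D] up to [S], the face on the right has -1,
           which excludes the other orientation. *)
        assert (B1 := cw_y D (S :: l1) (a + 1) h (proj2 (proj2 C1))).
        rewrite cw_above in B1. 2:{ intros u Hu. specialize (Hy1 u Hu). lia. }
        rewrite net_sym, net_absent in B1. 2:{ replace (a + 1 - 1) with a by lia. exact HT1. }
        assert (B2 := cw_x D (S :: l1) (a + 1) h).
        change (a + 1, h - 1) with D in B2. change (a + 1, h) with S in B2 at 2. rewrite net_first in B2 by auto.
        specialize (K (a + 1 + 1, h)). lia. }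
    assert (W2 : forall p, cw A (D :: l2) p = 0 \/ cw A (D :: l2) p = -1).
    { destruct (classic (l2 = [])) as [->|Hl].
      - intros p. left. unfold cw. simpl. rewrite (cross_anti p D A). lia.
      - specialize (C2 Hl). destruct (cycle_cw _ _ C2) as [K|K]; auto. exfalso.
        (* Again [F] has number 0. It lies above the edge from [A] to [D], so the face below that
           edge has -1. *)
        assert (B1 := cw_y A (D :: l2) (a + 1) h (proj2 (proj2 C2))).
        rewrite cw_above in B1. 2:{ intros u Hu. specialize (Hy2 u Hu). lia. }
        rewrite net_sym, net_absent in B1. 2:{ replace (a + 1 - 1) with a by lia. exact HT2. }
        assert (B2 := cw_y A (D :: l2) (a + 1) (h - 1) (proj2 (proj2 C2))).
        replace (a + 1 - 1) with a in B2 by lia. replace (h - 1 + 1) with h in B2 by lia.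
        change (a, h - 1) with A in B2. change (a + 1, h - 1) with D in B2 at 2. rewrite net_first in B2 by auto.
        specialize (K (a + 1, h - 1)). lia. }
    assert (Z1 : forall p, Pu p -> cw D (S :: l1) p = 0 /\ cw A (D :: l2) p = 0).
    { intros p Hp. assert (E := HP p Hp). rewrite Hsum in E. unfold face_ind in E.
      destruct (veq_dec F p); [subst; tauto|]. specialize (W1 p). specialize (W2 p). lia. }
    assert (X1 : null Pu D (S :: l1)).
    { destruct (classic (l1 = [])) as [->|Hl].
      - apply (peq_spur Pu [] D S []). auto.
      - apply IH; auto; [intros u Hu; apply Hy1, Hu|intros p Hp; now apply Z1|].
        rewrite Hmu. assert (0 < height Y (A :: D :: l2)); [|lia].
        change (height Y (A :: D :: l2)) with ((snd A - Y + 1) + height Y (D :: l2)).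
        assert (0 <= height Y (D :: l2)) by (apply height_ge; intros u Hu; apply Hy2; simpl in *; tauto).
        unfold A; simpl snd. lia. }
    assert (X2 : null Pu A (D :: l2)).
    { destruct (classic (l2 = [])) as [->|Hl].
      - apply (peq_spur Pu [] A D []). auto.
      - apply IH; auto; [intros u Hu; apply Hy2, Hu|intros p Hp; now apply Z1|].
        rewrite Hmu. lia. }
    unfold null in *. norm_app. norm_app in X1. norm_app in X2.
    eapply peq_trans; [apply Hhead|].
    apply (peq_trans _ _ (T :: A :: D :: l2 ++ [A; T])).
    { assert (B := peq_app Pu [T; A] (l2 ++ [A; T]) _ _ X1). norm_app in B. exact B. }
    apply (peq_trans _ _ [T; A; T]).
    { assert (B := peq_app Pu [T] [T] _ _ X2). norm_app in B. exact B. }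
    apply (peq_spur Pu [] T A []). auto.
  - assert (HDn : ~ In D (S :: m ++ [A])).
    { intros N. simpl in N. rewrite in_app_iff in N. simpl in N.
      destruct N as [N|[N|[N|[]]]]; auto; unfold S, A, D in N; injection N; lia. }
    assert (Hc : cycle D (S :: m ++ [A])).
    { split; [|split]; auto.
      - inversion Hnd; subst. now constructor.
      - cbn [app path] in *. split; auto. destruct Hpath as [_ Hpath].
        rewrite <- app_assoc in *. cbn [app] in *. rewrite path_app in *. split; [tauto|]. simpl. auto. }
    assert (Hsum : forall p, cw T (S :: m ++ [A]) p = cw D (S :: m ++ [A]) p - face_ind F p).
    { intros p. unfold cw. cbn [app psum]. rewrite <- !app_assoc. cbn [app]. rewrite (psum_app (cross p) m S A [T]), (psum_app (cross p) m S A [D]). cbn [psum].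
      generalize (cross_corner a h p). unfold T, S, A, D, F. lia. }
    assert (X : null Pu D (S :: m ++ [A])).
    { apply IH; auto.
      - intros u [<-|Hu]; [unfold D; simpl; lia|]. apply Hy. now right.
      - intros p Hp. assert (E := HP p Hp). rewrite Hsum in E. unfold face_ind in E.
        destruct (veq_dec F p); [subst; tauto|]. lia.
      - cbn [height]. unfold D, T; simpl snd. lia. }
    unfold null in *. norm_app. norm_app in X.
    eapply peq_trans; [apply Hhead|].
    (* The inserted spur [A D A] exposes the closed path at [D], which contracts by induction. *)
    apply (peq_trans _ _ (T :: A :: D :: S :: m ++ [A; D; A; T])).
    { assert (B := peq_spur Pu (T :: A :: D :: S :: m) A D [T] HAD). cbn [app] in B. apply peq_sym. exact B. }
    apply (peq_trans _ _ [T; A; D; A; T]).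
    { assert (B := peq_app Pu [T; A] [A; T] _ _ X). norm_app in B. exact B. }
    apply (peq_trans _ _ [T; A; T]).
    { apply (peq_spur Pu [T] A D [T]). auto. }
    apply (peq_spur Pu [] T A []). auto.
Qed.

(** Induction on [height] above the lowest row [Y]; [corner] reduces to the clockwise case, and none
    of the replacements goes below that row. *)
Theorem null_cycle Pu x l : cycle x l -> (forall p, Pu p -> cw x l p = 0) -> null Pu x l.
Proof.
  intros H HP. destruct (list_bound (fun u => - snd u) (x :: l)) as [B HB].
  set (Y := - B). assert (HY : forall u : V, In u (x :: l) -> Y <= snd u).
  { intros u Hu. specialize (HB u Hu). unfold Y. simpl in HB. lia. }
  clearbody Y. clear HB B.
  assert (Hmain : forall n x l, cycle x l -> (forall u : V, In u (x :: l) -> Y <= snd u) ->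
    (forall p, Pu p -> cw x l p = 0) -> height Y (x :: l) < Z.of_nat n -> null Pu x l).
  { clear. induction n; intros x l H HY HP Hmu.
    - assert (0 <= height Y (x :: l)) by (now apply height_ge). lia.
    - revert H HY HP Hmu.
      apply (corner (fun x l => (forall u : V, In u (x :: l) -> Y <= snd u) ->
        (forall p, Pu p -> cw x l p = 0) -> height Y (x :: l) < Z.of_nat (S n) -> null Pu x l)).
      + clear. intros x l z l1 l2 H He IH HY HP Hmu. apply (null_unrotate Pu x l z l1 l2); auto. apply IH.
        * intros u Hu. apply HY. change (@In V u (@cons V x l)). rewrite He, in_app_iff. simpl in *. rewrite in_app_iff in Hu. tauto.
        * intros p Hp. unfold cw. rewrite (psum_rotated _ x l z l1 l2 He). now apply HP.
        * rewrite He, height_app in Hmu. cbn [height] in *. rewrite height_app. lia.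
      + clear. intros x l H IH HY HP Hmu. apply null_rev. apply IH.
        * intros u [Hu|Hu]; apply HY; [now left|right]. now apply in_rev.
        * intros p Hp. rewrite cw_rev, HP; auto.
        * cbn [height] in *. now rewrite height_rev.
      + intros a h m Hy Hc _ _ HY HP Hmu. apply (null_core Pu a h m Y); auto.
        intros x' l' Hc' HY' HP' Hmu'. apply IHn; auto. rewrite Nat2Z.inj_succ in Hmu. apply Z.lt_succ_r in Hmu. exact (Z.lt_le_trans _ _ _ Hmu' Hmu). }
  apply (Hmain (S (Z.to_nat (height Y (x :: l))))); auto.
  assert (0 <= height Y (x :: l)) by (now apply height_ge). lia.
Qed.

(** * Lattice cycles surrounding all punctures *)

(** Free homotopy of closed lattice paths: to [peq] it adds moving the base point along the first
    edge. *)
Inductive freeq (Pu : V -> Prop) : list V -> list V -> Prop :=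
| freeq_peq l l' : peq Pu l l' -> freeq Pu l l'
| freeq_sym l l' : freeq Pu l l' -> freeq Pu l' l
| freeq_trans l l' l'' : freeq Pu l l' -> freeq Pu l' l'' -> freeq Pu l l''
| freeq_rot x y l : freeq Pu (x :: y :: l ++ [x]) (y :: l ++ [x; y]).

Lemma freeq_rev Pu l l' : freeq Pu l l' -> freeq Pu (rev l) (rev l').
Proof.
  induction 1.
  - now apply freeq_peq, peq_rev.
  - now apply freeq_sym.
  - eapply freeq_trans; eauto.
  - simpl. rewrite !rev_app_distr. simpl. apply freeq_sym.
    rewrite <- app_assoc. simpl. assert (A := freeq_rot Pu y x (rev l)). exact A.
Qed.

Lemma freeq_rotated Pu x l z l1 l2 : x :: l = l1 ++ z :: l2 ->
  freeq Pu (x :: l ++ [x]) (z :: (l2 ++ l1) ++ [z]).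
Proof.
  intros He. apply (rot_prop (fun z m => freeq Pu (x :: l ++ [x]) (z :: m ++ [z]))) with (2 := He).
  - clear. intros u v m H. eapply freeq_trans; [exact H|]. rewrite <- app_assoc. apply freeq_rot.
  - apply freeq_peq, peq_refl.
Qed.

Lemma backtrack Pu y l : forall x, path step x (l ++ [y]) -> peq Pu (y :: rev l ++ x :: l ++ [y]) [y].
Proof.
  induction l as [|z l IH]; intros x H.
  - apply (peq_spur Pu [] y x []). apply step_sym, H.
  - simpl. simpl in H. destruct H as [H1 H2]. rewrite <- app_assoc. cbn [app].
    eapply peq_trans; [|apply (IH z H2)].
    apply (peq_spur Pu (y :: rev l) z x (l ++ [y])). now apply step_sym.
Qed.

(** Conjugating a closed path by [U] does not change its free class: the base point travels along
    [U] while the two copies of [U] cancel. *)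
Lemma freeq_conj Pu K B U : forall T, path step T (U ++ [K]) ->
  freeq Pu (T :: U ++ K :: B ++ K :: rev U ++ [T]) (K :: B ++ [K]).
Proof.
  induction U as [|z U IH]; intros T H.
  - cbn [app rev]. apply (freeq_trans _ _ (K :: B ++ [K; T; K])).
    + assert (A := freeq_rot Pu T K (B ++ [K])). norm_app in A. exact A.
    + apply freeq_peq, (peq_spur Pu (K :: B) K T []). apply step_sym, H.
  - cbn [app rev]. destruct H as [H1 H2]. cbn [app] in *.
    apply (freeq_trans _ _ (z :: U ++ K :: B ++ K :: rev U ++ [z; T; z])).
    + assert (A := freeq_rot Pu T z (U ++ K :: B ++ K :: rev U ++ [z])). norm_app in A. norm_app. exact A.
    + eapply freeq_trans; [|apply (IH z H2)]. apply freeq_peq.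
      assert (A := peq_spur Pu (z :: U ++ K :: B ++ K :: rev U) z T [] (step_sym _ _ H1)).
      norm_app in A. exact A.
Qed.

Lemma path_app' {T} (R : T -> T -> Prop) l1 l2 : forall a,
  path R a (l1 ++ l2) <-> path R a l1 /\ path R (last l1 a) l2.
Proof.
  induction l1 as [|b l1 IH]; intros a; [simpl; tauto|]. rewrite last_cons. cbn [app path]. rewrite IH. tauto.
Qed.
Lemma psum_app' {T} (phi : T -> T -> Z) l1 l2 : forall a,
  psum phi a (l1 ++ l2) = psum phi a l1 + psum phi (last l1 a) l2.
Proof.
  induction l1 as [|b l1 IH]; intros a; [simpl; lia|]. rewrite last_cons. cbn [app psum]. rewrite IH. lia.
Qed.

(** Straight walk in direction [d]. The starting vertex is left out so that successive runs
    concatenate into a path without repetitions. *)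
Fixpoint run (d u : V) (n : nat) : list V :=
  match n with O => [] | S n => (fst u + fst d, snd u + snd d) :: run d (fst u + fst d, snd u + snd d) n end.

Lemma run_last d n : forall u, last (run d u n) u = (fst u + Z.of_nat n * fst d, snd u + Z.of_nat n * snd d).
Proof.
  induction n; intros u.
  - destruct u. simpl. f_equal; lia.
  - cbn [run]. rewrite last_cons, IHn. cbn [fst snd]. f_equal; lia.
Qed.
Lemma run_in d n : forall u v, In v (run d u n) ->
  exists k, 1 <= k <= Z.of_nat n /\ v = (fst u + k * fst d, snd u + k * snd d).
Proof.
  induction n; intros u v; [simpl; tauto|]. cbn [run]. intros [<-|H].
  - exists 1. split; [lia|]. f_equal; lia.
  - destruct (IHn _ _ H) as (k & Hk & ->). cbn [fst snd]. exists (k + 1). split; [lia|]. f_equal; lia.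
Qed.
Lemma run_NoDup d n : (fst d <> 0 \/ snd d <> 0) -> forall u, NoDup (run d u n).
Proof.
  intros Hd. induction n; intros u; cbn [run]; constructor; auto.
  intros H. apply run_in in H. cbn [fst snd] in H. destruct H as (k & Hk & He). injection He. nia.
Qed.
Definition unit_vec (d : V) : Prop := d = (1, 0) \/ d = (-1, 0) \/ d = (0, 1) \/ d = (0, -1).
Lemma run_path d n : unit_vec d -> forall u, path step u (run d u n).
Proof.
  intros Hd. induction n; intros u; cbn [run path]; auto. split; auto.
  unfold step. destruct u as [x y]. destruct Hd as [->|[->|[->| ->]]]; cbn [fst snd].
  - left. f_equal; lia. - right; left. f_equal; lia.
  - right; right; left. f_equal; lia. - right; right; right. f_equal; lia.
Qed.
Lemma run_snoc d n : forall u, run d u (S n) = run d u n ++ [last (run d u (S n)) u].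
Proof.
  induction n; intros u; [reflexivity|].
  change (run d u (S (S n))) with ((fst u + fst d, snd u + snd d) :: run d (fst u + fst d, snd u + snd d) (S n)).
  rewrite last_cons, IHn at 1. reflexivity.
Qed.

Lemma psum_high p r l a : (forall u : V, In u (a :: l) -> r <= snd u) -> psum (cross (p, r)) a l = 0.
Proof.
  intros H. apply psum_0. intros u v Hu Hv. apply H in Hu. apply H in Hv. unfold cross; simpl. zcase.
Qed.
Lemma psum_low p r l a : (forall u : V, In u (a :: l) -> snd u < r) -> psum (cross (p, r)) a l = 0.
Proof.
  intros H. apply psum_0. intros u v Hu Hv. apply H in Hu. apply H in Hv. unfold cross; simpl. zcase.
Qed.
Lemma psum_left p r l a : (forall u : V, In u (a :: l) -> fst u < p) -> psum (cross (p, r)) a l = 0.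
Proof.
  intros H. apply psum_0. intros u v Hu Hv. apply H in Hu. unfold cross; simpl. zcase.
Qed.
Lemma psum_run_up p r n : forall u : V, p <= fst u ->
  psum (cross (p, r)) u (run (0, 1) u n) =
  (if r <=? snd u + Z.of_nat n then 1 else 0) - (if r <=? snd u then 1 else 0).
Proof.
  induction n; intros [x y] H; cbn [fst snd] in *.
  - simpl. replace (y + 0) with y by lia. lia.
  - cbn [run psum fst snd]. rewrite IHn by (cbn [fst]; lia). cbn [fst snd].
    replace (y + 1 + Z.of_nat n) with (y + Z.of_nat (S n)) by lia.
    unfold cross; cbn [fst snd]. zcase.
Qed.

(** Two neighbouring columns above the row [h] bound only unpunctured squares, so the edge joining
    them can be pushed to the top, one square at a time. *)
Lemma ladder Pu a n r : forall h, (forall F, Pu F -> snd F <= h) ->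
  peq Pu ((a, h) :: (a + 1, h) :: run (0, 1) (a + 1, h) n ++ r)
         ((a, h) :: run (0, 1) (a, h) n ++ (a + 1, h + Z.of_nat n) :: r).
Proof.
  induction n; intros h HP.
  - cbn [run app Z.of_nat]. rewrite Z.add_0_r. apply peq_refl.
  - cbn [run app fst snd]. rewrite !Z.add_0_r.
    apply (peq_trans _ _ ((a, h) :: (a, h + 1) :: (a + 1, h + 1) :: run (0, 1) (a + 1, h + 1) n ++ r)).
    + apply (peq_face Pu [] _ _ _ _ (a + 1, h + 1)).
      * intros N. apply HP in N. simpl in N. lia.
      * unfold in_sq; simpl; lia. * unfold in_sq; simpl; lia.
      * unfold in_sq; simpl; lia. * unfold in_sq; simpl; lia.
    + replace (h + Z.of_nat (S n)) with (h + 1 + Z.of_nat n) by lia.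
      assert (A := peq_app Pu [(a, h)] [] _ _ (IHn (h + 1) ltac:(intros F HF; apply HP in HF; lia))).
      rewrite !app_nil_r in A. exact A.
Qed.

Lemma run_length d n : forall u, length (run d u n) = n.
Proof. induction n; intros u; cbn [run length]; auto. Qed.
Lemma run_rev n : forall x y,
  rev ((x, y + Z.of_nat n) :: run (0, -1) (x, y + Z.of_nat n) n) = (x, y) :: run (0, 1) (x, y) n.
Proof.
  induction n; intros x y.
  - simpl. now rewrite Z.add_0_r.
  - rewrite (run_snoc (0, 1) n), run_last. cbn [run fst snd].
    replace (x + 0) with x by lia. replace (y + Z.of_nat (S n) + -1) with (y + Z.of_nat n) by lia.
    change (rev ((x, y + Z.of_nat (S n)) :: (x, y + Z.of_nat n) :: run (0, -1) (x, y + Z.of_nat n) n))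
      with (rev ((x, y + Z.of_nat n) :: run (0, -1) (x, y + Z.of_nat n) n) ++ [(x, y + Z.of_nat (S n))]).
    rewrite IHn. cbn [app]. rewrite Z.mul_0_r, Z.add_0_r, Z.mul_1_r. reflexivity.
Qed.
Lemma last_app {T} (l1 l2 : list T) : forall a, last (l1 ++ l2) a = last l2 (last l1 a).
Proof. induction l1 as [|b l1 IH]; intros a; auto. cbn [app]. now rewrite !last_cons, IH. Qed.

Definition far (N : Z) (u : V) : Prop := N <= Z.abs (fst u) \/ N <= Z.abs (snd u).

Lemma NoDup_join {T} (l1 l2 : list T) : NoDup l1 -> NoDup l2 -> (forall a, In a l1 -> ~ In a l2) -> NoDup (l1 ++ l2).
Proof.
  induction l1 as [|a l1 IH]; intros H1 H2 H; simpl; auto. inversion H1; subst. constructor.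
  - rewrite in_app_iff. intros [N|N]; auto. now apply (H a); [left|].
  - apply IH; auto. intros b Hb. apply H. now right.
Qed.

(* Replace the top edge [T S] by two parallel columns going up to a box of half-size [N] and by the way
   around that box: the new cycle winds around no puncture, hence is contractible. *)
Lemma outer_core Pu N a h (m : list V) :
  let A : V := (a, h - 1) in let T : V := (a, h) in let S : V := (a + 1, h) in
  (forall u : V, In u (T :: S :: m ++ [A]) -> snd u <= h) ->
  (forall u : V, In u (T :: S :: m ++ [A]) -> Z.abs (fst u) < N /\ Z.abs (snd u) < N) ->
  cycle T (S :: m ++ [A]) ->
  (forall F, Pu F -> cw T (S :: m ++ [A]) F <> 0) ->
  (forall F, Pu F -> Z.abs (fst F) < N /\ Z.abs (snd F) < N) ->
  exists b B, freeq Pu (T :: (S :: m ++ [A]) ++ [T]) (b :: B ++ [b]) /\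
     path step b (B ++ [b]) /\ forall u, In u (b :: B) -> far N u.
Proof.
  intros A T S Hy HN Hc HP HPN.
  (* The face under the top edge has -1, which settles the orientation; a puncture above the row [h]
     would have number 0. *)
  assert (Hcw : forall F, Pu F -> cw T (S :: m ++ [A]) F = -1 /\ snd F <= h).
  { assert (Hcf : cw T (S :: m ++ [A]) (a + 1, h) = -1) by now apply corner_face.
    destruct (cycle_cw _ _ Hc) as [K|K]; [specialize (K (a + 1, h)); lia|].
    intros [p r] HF. specialize (HP _ HF). split; [specialize (K (p, r)); lia|].
    simpl. destruct (Z_le_gt_dec r h); auto. exfalso. apply HP, cw_above. intros u Hu. apply Hy in Hu. lia. }
  assert (HT := HN T ltac:(simpl; auto)). assert (HS := HN S ltac:(simpl; auto)). unfold T, S in HT, HS. cbn [fst snd] in HT, HS.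
  (* The detour from [T] to [S]: up the column [a] ([U]), counterclockwise around the box from
     [(a, N)] to [(a + 1, N)] ([L1], [Lf], [Bt], [Rt], [Tr]), and down the column [a + 1] ([Dn]).
     The numbers are the lengths of these runs. *)
  set (n := Z.to_nat (N - h)). assert (Hn : Z.of_nat n = N - h) by lia.
  set (n1 := Z.to_nat (a + N)). assert (Hn1 : Z.of_nat n1 = a + N) by lia.
  set (n2 := Z.to_nat (2 * N)). assert (Hn2 : Z.of_nat n2 = 2 * N) by lia.
  set (n3 := Z.to_nat (N - a - 1)). assert (Hn3 : Z.of_nat n3 = N - a - 1) by lia.
  set (U := run (0, 1) T n). set (L1 := run (-1, 0) (a, N) n1). set (Lf := run (0, -1) (-N, N) n2).
  set (Bt := run (1, 0) (-N, -N) n2). set (Rt := run (0, 1) (N, -N) n2). set (Tr := run (-1, 0) (N, N) n3).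
  set (Dn := run (0, -1) (a + 1, N) n).
  assert (EU : last U T = (a, N)). { unfold U. rewrite run_last. unfold T; cbn [fst snd]. rewrite Hn. f_equal; lia. }
  assert (EL1 : last L1 (a, N) = (-N, N)). { unfold L1. rewrite run_last. cbn [fst snd]. rewrite Hn1. f_equal; lia. }
  assert (ELf : last Lf (-N, N) = (-N, -N)). { unfold Lf. rewrite run_last. cbn [fst snd]. rewrite Hn2. f_equal; lia. }
  assert (EBt : last Bt (-N, -N) = (N, -N)). { unfold Bt. rewrite run_last. cbn [fst snd]. rewrite Hn2. f_equal; lia. }
  assert (ERt : last Rt (N, -N) = (N, N)). { unfold Rt. rewrite run_last. cbn [fst snd]. rewrite Hn2. f_equal; lia. }
  assert (ETr : last Tr (N, N) = (a + 1, N)). { unfold Tr. rewrite run_last. cbn [fst snd]. rewrite Hn3. f_equal; lia. }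
  assert (EDn : last Dn (a + 1, N) = S). { unfold Dn. rewrite run_last. cbn [fst snd]. rewrite Hn. unfold S. f_equal; lia. }
  assert (IU : forall v, In v U -> fst v = a /\ h < snd v <= N).
  { intros v Hv. apply run_in in Hv. destruct Hv as (k & Hk & ->). unfold T; cbn [fst snd]. lia. }
  assert (IL1 : forall v, In v L1 -> snd v = N /\ -N <= fst v < a).
  { intros v Hv. apply run_in in Hv. destruct Hv as (k & Hk & ->). cbn [fst snd]. lia. }
  assert (ILf : forall v, In v Lf -> fst v = -N /\ -N <= snd v < N).
  { intros v Hv. apply run_in in Hv. destruct Hv as (k & Hk & ->). cbn [fst snd]. lia. }
  assert (IBt : forall v, In v Bt -> snd v = -N /\ -N < fst v <= N).
  { intros v Hv. apply run_in in Hv. destruct Hv as (k & Hk & ->). cbn [fst snd]. lia. }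
  assert (IRt : forall v, In v Rt -> fst v = N /\ -N < snd v <= N).
  { intros v Hv. apply run_in in Hv. destruct Hv as (k & Hk & ->). cbn [fst snd]. lia. }
  assert (ITr : forall v, In v Tr -> snd v = N /\ a + 1 <= fst v < N).
  { intros v Hv. apply run_in in Hv. destruct Hv as (k & Hk & ->). cbn [fst snd]. lia. }
  assert (IDn : forall v, In v Dn -> fst v = a + 1 /\ h <= snd v < N).
  { intros v Hv. apply run_in in Hv. destruct Hv as (k & Hk & ->). cbn [fst snd]. lia. }
  assert (Im : forall v, In v (m ++ [A]) -> snd v <= h /\ Z.abs (fst v) < N /\ Z.abs (snd v) < N /\ v <> T /\ v <> S).
  { intros v Hv. assert (Hv' : In v (T :: S :: m ++ [A])) by (right; right; exact Hv).
    split; [now apply Hy|]. destruct (HN v Hv'). split; auto. split; auto.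
    destruct Hc as (Hnd & _). inversion Hnd as [|? ? N1 Hnd1]; subst. inversion Hnd1 as [|? ? N2 _]; subst.
    split; intros ->; [apply N1; now right|now apply N2]. }
  set (W := L1 ++ Lf ++ Bt ++ Rt ++ Tr).
  assert (PW : path step (a, N) W).
  { unfold W. rewrite !path_app', EL1, ELf, EBt, ERt.
    repeat split; apply run_path; unfold unit_vec; auto. }
  assert (EW : last W (a, N) = (a + 1, N)).
  { unfold W. now rewrite !last_app, EL1, ELf, EBt, ERt. }
  assert (PU : path step T U) by (apply run_path; unfold unit_vec; auto).
  assert (PD : path step (a + 1, N) Dn) by (apply run_path; unfold unit_vec; auto).
  assert (PQ : path step S ((m ++ [A]) ++ [T])) by apply Hc.
  assert (Hnm : NoDup (m ++ [A])).
  { destruct Hc as (Hnd & _). inversion Hnd as [|? ? _ Hnd1]; subst. now inversion Hnd1. }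
  set (E := m ++ [A]) in *.
  assert (Hbig : cycle T (U ++ W ++ Dn ++ E)).
  { split; [|split].
    - constructor.
      + unfold W. rewrite !in_app_iff. intros Hin.
        repeat (destruct Hin as [Hin|Hin]);
        first [apply IU in Hin|apply IL1 in Hin|apply ILf in Hin|apply IBt in Hin|apply IRt in Hin
              |apply ITr in Hin|apply IDn in Hin|apply Im in Hin]; unfold T in Hin; cbn [fst snd] in Hin; try lia.
        destruct Hin as (_ & _ & _ & Hin & _). now apply Hin.
      + unfold W. rewrite <- !app_assoc.
        assert (ND : NoDup (Dn ++ E)).
        { apply NoDup_join; auto.
          - apply run_NoDup; simpl; lia.
          - intros v Hv Hw. apply IDn in Hv. apply Im in Hw. destruct Hw as (H1 & _ & _ & _ & H2).
            apply H2. destruct v; unfold S; simpl in *. f_equal; lia. }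
        assert (IE : forall v, In v (Dn ++ E) -> snd v < N /\ Z.abs (fst v) < N /\ -N < snd v /\ (fst v = a -> snd v <= h)).
        { intros v Hv. apply in_app_iff in Hv. destruct Hv as [Hv|Hv].
          - apply IDn in Hv. lia. - apply Im in Hv. lia. }
        generalize dependent (Dn ++ E). intros DE ND IE.
        repeat (apply NoDup_join; [apply run_NoDup; simpl; lia| |]); auto;
        intros v Hv Hin; rewrite ?in_app_iff in Hin;
        first [apply IU in Hv|apply IL1 in Hv|apply ILf in Hv|apply IBt in Hv|apply IRt in Hv|apply ITr in Hv];
        repeat (destruct Hin as [Hin|Hin]);
        first [apply IE in Hin|apply IL1 in Hin|apply ILf in Hin|apply IBt in Hin|apply IRt in Hin|apply ITr in Hin]; lia.
    - rewrite length_app. unfold W. rewrite !length_app. unfold U, Lf. rewrite !run_length. lia.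
    - rewrite <- !app_assoc. rewrite !path_app', EU, EW, EDn. rewrite path_app' in PQ. auto. }
  (* Of the detour only the right side [Rt] of the box meets the ray leaving a puncture, and it
     contributes 1, which cancels the -1 of the cycle. *)
  assert (Hcwbig : forall F, Pu F -> cw T (U ++ W ++ Dn ++ E) F = 0).
  { intros [p r] HF. destruct (HPN _ HF) as [B1 B2]. destruct (Hcw _ HF) as [B3 B4]. cbn [fst snd] in *.
    unfold cw in *. change ((S :: E) ++ [T]) with (S :: E ++ [T]) in B3. cbn [psum] in B3.
    rewrite <- !app_assoc. rewrite (psum_app' _ U), EU. unfold W. rewrite <- !app_assoc.
    rewrite (psum_app' _ L1), EL1, (psum_app' _ Lf), ELf, (psum_app' _ Bt), EBt, (psum_app' _ Rt), ERt, (psum_app' _ Tr), ETr, (psum_app' _ Dn), EDn.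
    rewrite (psum_high p r U), (psum_high p r L1), (psum_left p r Lf), (psum_low p r Bt), (psum_high p r Tr), (psum_high p r Dn).
    - unfold Rt. rewrite psum_run_up by (cbn [fst]; lia). cbn [snd]. rewrite Hn2.
      assert (B5 : cross (p, r) T S = 0). { unfold cross, T, S; cbn [fst snd]. zcase. }
      destruct (Z.leb_spec r (-N + 2 * N)); [|lia]. destruct (Z.leb_spec r (-N)); [lia|]. lia.
    - intros u [<-|Hu]; [simpl; lia|]. apply IDn in Hu. lia.
    - intros u [<-|Hu]; [simpl; lia|]. apply ITr in Hu. lia.
    - intros u [<-|Hu]; [simpl; lia|]. apply IBt in Hu. lia.
    - intros u [<-|Hu]; [simpl; lia|]. apply ILf in Hu. lia.
    - intros u [<-|Hu]; [simpl; lia|]. apply IL1 in Hu. lia.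
    - intros u [<-|Hu]; [unfold T; simpl; lia|]. apply IU in Hu. lia. }
  assert (Hnull := null_cycle Pu _ _ Hbig Hcwbig). unfold null in Hnull.
  assert (SU : exists U', U = U' ++ [(a, N)]).
  { destruct n as [|n'] eqn:En; [lia|]. exists (run (0, 1) T n'). rewrite <- EU. apply run_snoc. }
  assert (SW : exists W', W = W' ++ [(a + 1, N)]).
  { destruct n3 as [|n'] eqn:En; [lia|]. exists (L1 ++ Lf ++ Bt ++ Rt ++ run (-1, 0) (N, N) n').
    unfold W. rewrite <- ETr. unfold Tr. rewrite (run_snoc _ n') at 1. now rewrite <- !app_assoc. }
  assert (SD : exists D', Dn = D' ++ [S] /\ S :: rev D' ++ [(a + 1, N)] = S :: run (0, 1) S n).
  { assert (R := run_rev n (a + 1) h). rewrite Hn in R. replace (h + (N - h)) with N in R by lia. fold Dn S in R.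
    destruct n as [|n'] eqn:En; [lia|]. exists (run (0, -1) (a + 1, N) n').
    assert (R2 : Dn = run (0, -1) (a + 1, N) n' ++ [S]) by (rewrite <- EDn; apply run_snoc).
    split; auto. rewrite R2 in R. cbn [rev] in R. rewrite rev_app_distr in R. exact R. }
  destruct SU as [U' SU], SW as [W' SW], SD as (D' & SD & SD2).
  set (Rm := U ++ W ++ D').
  assert (HRm : U ++ W ++ Dn = Rm ++ [S]) by (unfold Rm; rewrite SD; now rewrite <- !app_assoc).
  assert (PR : path step T (Rm ++ [S])).
  { rewrite <- HRm, !path_app', EU, EW. auto. }
  set (K := (a, N) : V). set (K1 := (a + 1, N) : V).
  assert (HK : step K K1) by (unfold step, K, K1; simpl; auto).
  (* The loop sought is the box traversed backwards, closed by the edge from [K] to [K1]; like the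
     cycle it runs clockwise. *)
  exists K, (rev W). split; [|split].
  (* The way from [S] back to [T] along the cycle is homotopic to [rev Rm], because the big cycle
     contracts. The ladder then merges the two columns, which leaves the box conjugated by [U]. *)
  - apply (freeq_trans _ _ (T :: S :: rev Rm ++ [T])).
    { apply freeq_peq. replace (T :: (S :: E) ++ [T]) with (T :: S :: E ++ [T]) by reflexivity.
      apply (peq_trans _ _ (T :: S :: rev Rm ++ T :: Rm ++ S :: E ++ [T])).
      - apply peq_sym. assert (B := peq_app Pu [T] (E ++ [T]) _ _ (backtrack Pu S Rm T PR)).
        norm_app in B. exact B.
      - assert (B := peq_app Pu (T :: S :: rev Rm) [] _ _ Hnull). rewrite !app_nil_r in B.
        replace ((U ++ W ++ Dn ++ E) ++ [T]) with (Rm ++ S :: E ++ [T]) in B; [exact B|].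
        replace (U ++ W ++ Dn ++ E) with ((U ++ W ++ Dn) ++ E) by now rewrite <- !app_assoc.
        rewrite HRm. now norm_app. }
    apply (freeq_trans _ _ (T :: U ++ K1 :: rev W' ++ rev U ++ [T])).
    { apply freeq_peq. assert (B := ladder Pu a n (rev W' ++ rev U ++ [T]) h (fun F HF => proj2 (Hcw F HF))).
      fold T S U in B. rewrite Hn in B. replace (h + (N - h)) with N in B by lia. fold K1 in B.
      replace (T :: S :: rev Rm ++ [T]) with (T :: S :: run (0, 1) S n ++ rev W' ++ rev U ++ [T]); [exact B|].
      unfold Rm. rewrite !rev_app_distr, SW, rev_app_distr. f_equal.
      change (S :: run (0, 1) S n ++ rev W' ++ rev U ++ [T]) with ((S :: run (0, 1) S n) ++ rev W' ++ rev U ++ [T]).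
      rewrite <- SD2. cbn [rev]. now norm_app. }
    rewrite SU at 1. rewrite SU, SW. rewrite !rev_app_distr. cbn [rev app]. fold K K1.
    assert (B := freeq_conj Pu K (K1 :: rev W') U' T). norm_app in B. norm_app. apply B.
    rewrite SU in PU. exact PU.
  - fold K in PW. rewrite SW in PW |- *. rewrite rev_app_distr. cbn [rev app path]. split; auto.
    now apply path_rev; [apply step_sym|].
  - intros u [<-|Hu]; [unfold far, K; simpl; lia|]. apply in_rev in Hu. unfold W in Hu. rewrite !in_app_iff in Hu.
    repeat (destruct Hu as [Hu|Hu]);
    first [apply IL1 in Hu|apply ILf in Hu|apply IBt in Hu|apply IRt in Hu|apply ITr in Hu]; unfold far; lia.
Qed.

Theorem outer_cycle Pu N x l : cycle x l ->
  (forall F, Pu F -> cw x l F <> 0) ->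
  (forall u, In u (x :: l) -> Z.abs (fst u) < N /\ Z.abs (snd u) < N) ->
  (forall F, Pu F -> Z.abs (fst F) < N /\ Z.abs (snd F) < N) ->
  exists b B, freeq Pu (x :: l ++ [x]) (b :: B ++ [b]) /\ path step b (B ++ [b]) /\ forall u, In u (b :: B) -> far N u.
Proof.
  intros H HP HN HPN. revert HP.
  apply (corner (fun x l => (forall F, Pu F -> cw x l F <> 0) ->
    exists b B, freeq Pu (x :: l ++ [x]) (b :: B ++ [b]) /\ path step b (B ++ [b]) /\ forall u, In u (b :: B) -> far N u) x l); auto.
  - clear. intros x l z l1 l2 H He IH HP. destruct IH as (b & B & H1 & H2 & H3).
    + intros F HF. unfold cw. rewrite (psum_rotated _ x l z l1 l2 He). now apply HP.
    + exists b, B. split; auto. eapply freeq_trans; [|exact H1]. now apply freeq_rotated.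
  - clear. intros x l H IH HP. destruct IH as (b & B & H1 & H2 & H3).
    + intros F HF. rewrite cw_rev. specialize (HP F HF). lia.
    + exists b, (rev B). split; [|split].
      * apply freeq_rev in H1. simpl in H1. rewrite !rev_app_distr, rev_involutive in H1. exact H1.
      * apply path_rev; auto using step_sym.
      * intros u [Hu|Hu]; apply H3; [now left|right]. now apply in_rev.
  - intros a h m Hy Hc Hi1 Hi2 HP. apply (outer_core Pu N a h m); auto.
Qed.

Close Scope Z_scope.
Open Scope R_scope.

(** * Continuity and compactness *)

(** The domain is an arbitrary uniform space, so that the same rules serve loops on [R] and
    homotopies on [R * R]. *)
Definition contR {U : UniformSpace} (F : U -> R) : Prop := forall x, continuous F x.
Definition contC {U : UniformSpace} (F : U -> C) : Prop :=
  contR (fun x => fst (F x)) /\ contR (fun x => snd (F x)).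

Lemma contR_const {U : UniformSpace} (a : R) : contR (fun _ : U => a).
Proof. intros x; apply continuous_const. Qed.
Lemma contR_id : contR (fun t : R => t).
Proof. intros x; apply continuous_id. Qed.
Lemma contR_fst : contR (fun p : R * R => fst p).
Proof. intros x; apply continuous_fst. Qed.
Lemma contR_snd : contR (fun p : R * R => snd p).
Proof. intros x; apply continuous_snd. Qed.
Lemma contR_plus {U : UniformSpace} (F G : U -> R) : contR F -> contR G -> contR (fun x => F x + G x).
Proof. intros H1 H2 x. exact (continuous_plus F G x (H1 x) (H2 x)). Qed.
Lemma contR_minus {U : UniformSpace} (F G : U -> R) : contR F -> contR G -> contR (fun x => F x - G x).
Proof. intros H1 H2 x. exact (continuous_minus F G x (H1 x) (H2 x)). Qed.
Lemma contR_opp {U : UniformSpace} (F : U -> R) : contR F -> contR (fun x => - F x).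
Proof. intros H1 x. exact (continuous_opp F x (H1 x)). Qed.
Lemma contR_mult {U : UniformSpace} (F G : U -> R) : contR F -> contR G -> contR (fun x => F x * G x).
Proof. intros H1 H2 x. exact (continuous_mult F G x (H1 x) (H2 x)). Qed.
Lemma contR_comp {U : UniformSpace} (phi : R -> R) (F : U -> R) :
  (forall y, continuity_pt phi y) -> contR F -> contR (fun x => phi (F x)).
Proof.
  intros H1 H2 x. apply continuous_comp; [apply H2|].
  apply continuity_pt_filterlim, H1.
Qed.
Lemma contR_comp' {U : UniformSpace} (phi : R -> R) (F : U -> R) :
  contR phi -> contR F -> contR (fun x => phi (F x)).
Proof. intros H1 H2 x. apply continuous_comp; [apply H2|apply H1]. Qed.
Lemma contR_div {U : UniformSpace} (F G : U -> R) :
  contR F -> contR G -> (forall x, G x <> 0) -> contR (fun x => F x / G x).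
Proof.
  intros H1 H2 H3 x. unfold Rdiv.
  apply (continuous_mult F (fun x => / G x) x); [apply H1|].
  apply (continuous_comp G Rinv); [apply H2|].
  apply continuity_pt_filterlim. apply (continuity_pt_inv (fun y => y)).
  - apply continuity_pt_id.
  - apply H3.
Qed.
Lemma contR_sqrt {U : UniformSpace} (F : U -> R) : contR F -> contR (fun x => sqrt (F x)).
Proof. intros H1 x. apply continuous_comp; [apply H1|apply continuous_sqrt]. Qed.
Lemma contR_abs {U : UniformSpace} (F : U -> R) : contR F -> contR (fun x => Rabs (F x)).
Proof. intros. apply contR_comp; auto. apply Rcontinuity_abs. Qed.
Lemma contR_cos {U : UniformSpace} (F : U -> R) : contR F -> contR (fun x => cos (F x)).
Proof. intros. apply contR_comp; auto. apply continuity_cos. Qed.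
Lemma contR_sin {U : UniformSpace} (F : U -> R) : contR F -> contR (fun x => sin (F x)).
Proof. intros. apply contR_comp; auto. apply continuity_sin. Qed.
Lemma contR_atan {U : UniformSpace} (F : U -> R) : contR F -> contR (fun x => atan (F x)).
Proof. intros H. apply contR_comp'; auto. intros y; apply continuous_atan. Qed.
Lemma contR_ext {U : UniformSpace} (F G : U -> R) : (forall x, F x = G x) -> contR F -> contR G.
Proof. intros H H1 x. apply (continuous_ext F); auto. Qed.
Lemma contR_comp2 {U : UniformSpace} (F : R * R -> R) (a b : U -> R) :
  contR F -> contR a -> contR b -> contR (fun x => F (a x, b x)).
Proof.
  intros H1 H2 H3 x.
  apply (continuous_comp_2 a b (fun s t => F (s, t))); [apply H2|apply H3|].
  apply (continuous_ext F); [intros [s t]; reflexivity|]. apply H1.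
Qed.

Lemma Rmax_alt a b : Rmax a b = (a + b + Rabs (a - b)) / 2.
Proof. unfold Rmax; destruct (Rle_dec a b); [rewrite Rabs_left1|rewrite Rabs_right]; lra. Qed.
Lemma Rmin_alt a b : Rmin a b = (a + b - Rabs (a - b)) / 2.
Proof. unfold Rmin; destruct (Rle_dec a b); [rewrite Rabs_left1|rewrite Rabs_right]; lra. Qed.
(** Retraction onto the unit interval. It extends maps of that interval to all of [R], and sums of
    clamped pieces concatenate paths without a case distinction. *)
Definition clamp (x : R) : R := Rmax 0 (Rmin 1 x).
Lemma clamp_range x : 0 <= clamp x <= 1.
Proof. unfold clamp, Rmax, Rmin; repeat destruct Rle_dec; lra. Qed.
Lemma clamp_id x : 0 <= x <= 1 -> clamp x = x.
Proof. unfold clamp, Rmax, Rmin; repeat destruct Rle_dec; lra. Qed.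
Lemma clamp_lip x y : Rabs (clamp x - clamp y) <= Rabs (x - y).
Proof. unfold clamp, Rmax, Rmin, Rabs; repeat destruct Rle_dec; repeat destruct Rcase_abs; lra. Qed.
Lemma contR_max {U : UniformSpace} (F G : U -> R) : contR F -> contR G -> contR (fun x => Rmax (F x) (G x)).
Proof.
  intros H1 H2. apply (contR_ext (fun x => (F x + G x + Rabs (F x - G x)) * / 2)).
  { intros x; rewrite Rmax_alt; reflexivity. }
  apply contR_mult, contR_const. apply contR_plus; [now apply contR_plus|].
  apply contR_abs. now apply contR_minus.
Qed.
Lemma contR_min {U : UniformSpace} (F G : U -> R) : contR F -> contR G -> contR (fun x => Rmin (F x) (G x)).
Proof.
  intros H1 H2. apply (contR_ext (fun x => (F x + G x - Rabs (F x - G x)) * / 2)).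
  { intros x; rewrite Rmin_alt; reflexivity. }
  apply contR_mult, contR_const. apply contR_minus; [now apply contR_plus|].
  apply contR_abs. now apply contR_minus.
Qed.
Lemma contR_clamp {U : UniformSpace} (F : U -> R) : contR F -> contR (fun x => clamp (F x)).
Proof. intros. apply contR_max; [apply contR_const|]. apply contR_min; auto using contR_const. Qed.

Lemma contC_const {U : UniformSpace} (a : C) : contC (fun _ : U => a).
Proof. split; apply contR_const. Qed.
Lemma contC_plus {U : UniformSpace} (F G : U -> C) : contC F -> contC G -> contC (fun x => F x + G x)%C.
Proof. intros [? ?] [? ?]; split; simpl; now apply contR_plus. Qed.
Lemma contC_opp {U : UniformSpace} (F : U -> C) : contC F -> contC (fun x => - F x)%C.
Proof. intros [? ?]; split; simpl; now apply contR_opp. Qed.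
Lemma contC_minus {U : UniformSpace} (F G : U -> C) : contC F -> contC G -> contC (fun x => F x - G x)%C.
Proof. intros; apply contC_plus; auto using contC_opp. Qed.
Lemma contC_mult {U : UniformSpace} (F G : U -> C) : contC F -> contC G -> contC (fun x => F x * G x)%C.
Proof.
  intros [? ?] [? ?]; split; simpl;
  [apply contR_minus|apply contR_plus]; now apply contR_mult.
Qed.
Lemma contC_RtoC {U : UniformSpace} (F : U -> R) : contR F -> contC (fun x => RtoC (F x)).
Proof. intros; split; simpl; auto using contR_const. Qed.
Lemma contC_ext {U : UniformSpace} (F G : U -> C) : (forall x, F x = G x) -> contC F -> contC G.
Proof. intros H [H1 H2]; split; [eapply contR_ext;[|exact H1]|eapply contR_ext;[|exact H2]]; intros; simpl; now rewrite H. Qed.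
Lemma contC_comp {U : UniformSpace} (g : R -> C) (F : U -> R) : contC g -> contR F -> contC (fun x => g (F x)).
Proof.
  intros [H1 H2] HF; split.
  - exact (contR_comp' (fun t => fst (g t)) F H1 HF).
  - exact (contR_comp' (fun t => snd (g t)) F H2 HF).
Qed.
Lemma contC_comp2 {U : UniformSpace} (H : R * R -> C) (a b : U -> R) :
  contC H -> contR a -> contR b -> contC (fun x => H (a x, b x)).
Proof.
  intros [H1 H2] Ha Hb; split.
  - exact (contR_comp2 (fun t => fst (H t)) a b H1 Ha Hb).
  - exact (contR_comp2 (fun t => snd (H t)) a b H2 Ha Hb).
Qed.
Lemma contR_Cmod {U : UniformSpace} (F : U -> C) : contC F -> contR (fun x => Cmod (F x)).
Proof.
  intros [H1 H2]; unfold Cmod. apply contR_sqrt.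
  apply contR_plus; simpl.
  - apply contR_mult; auto. apply contR_mult; auto using contR_const.
  - apply contR_mult; auto. apply contR_mult; auto using contR_const.
Qed.

Ltac cont := cbn beta; repeat first
  [ assumption
  | match goal with
    | |- contC (fun _ => ?a) => apply (contC_const a)
    | |- contC (fun x => (@?F x - @?G x)%C) => apply (contC_minus F G)
    | |- contC (fun x => (@?F x + @?G x)%C) => apply (contC_plus F G)
    | |- contC (fun x => (@?F x * @?G x)%C) => apply (contC_mult F G)
    | |- contC (fun x => (- @?F x)%C) => apply (contC_opp F)
    | |- contC (fun x => RtoC (@?F x)) => apply (contC_RtoC F)
    | |- contR (fun _ => ?a) => apply (contR_const a)
    | |- contR (fun x => x) => apply contR_id
    | |- contR (fun x => fst x) => apply contR_fst
    | |- contR (fun x => snd x) => apply contR_snd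
    | |- contR (fun x => @?F x - @?G x) => apply (contR_minus F G)
    | |- contR (fun x => @?F x + @?G x) => apply (contR_plus F G)
    | |- contR (fun x => @?F x * @?G x) => apply (contR_mult F G)
    | |- contR (fun x => - @?F x) => apply (contR_opp F)
    | |- contR (fun x => clamp (@?F x)) => apply (contR_clamp F)
    | |- contR (fun x => Cmod (@?F x)) => apply (contR_Cmod F)
    | |- contR (fun x => sqrt (@?F x)) => apply (contR_sqrt F)
    | |- contR (fun x => atan (@?F x)) => apply (contR_atan F)
    | |- contR (fun x => Rmax (@?F x) (@?G x)) => apply (contR_max F G)
    | |- contR (fun x => Rmin (@?F x) (@?G x)) => apply (contR_min F G)
    | H : contC ?g |- contC (fun x => ?g (@?a x, @?b x)) => apply (contC_comp2 g a b H)
    | H : contC ?g |- contC (fun x => ?g (@?a x)) => apply (contC_comp g a H)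
    | H : contR ?g |- contR (fun x => ?g (@?a x, @?b x)) => apply (contR_comp2 g a b H)
    | H : contR ?g |- contR (fun x => ?g (@?a x)) => apply (contR_comp' g a H)
    end ].

Lemma cdist_Cmod z w : cdist z w = Cmod (z - w)%C.
Proof. reflexivity. Qed.
Lemma cnorm_Cmod z : cnorm z = Cmod z.
Proof. reflexivity. Qed.

Lemma Cmod_le_sum (z : C) : Cmod z <= Rabs (fst z) + Rabs (snd z).
Proof.
  unfold Cmod. rewrite <- (sqrt_Rsqr (Rabs (fst z) + Rabs (snd z))).
  2:{ generalize (Rabs_pos (fst z)) (Rabs_pos (snd z)); lra. }
  apply sqrt_le_1_alt. unfold Rsqr.
  rewrite <- (pow2_abs (fst z)), <- (pow2_abs (snd z)).
  generalize (Rabs_pos (fst z)) (Rabs_pos (snd z)); nra.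
Qed.
Lemma fst_le_Cmod (z : C) : Rabs (fst z) <= Cmod z.
Proof. eapply Rle_trans; [apply Rmax_l|apply Rmax_Cmod]. Qed.
Lemma snd_le_Cmod (z : C) : Rabs (snd z) <= Cmod z.
Proof. eapply Rle_trans; [apply Rmax_r|apply Rmax_Cmod]. Qed.

Lemma continuous_eps {U : UniformSpace} (F : U -> R) x : continuous F x <->
  forall eps, eps > 0 -> locally x (fun y => Rabs (F y - F x) < eps).
Proof.
  split.
  - intros H eps He.
    exact (proj1 (filterlim_locally F (F x)) H (mkposreal eps He)).
  - intros H. apply filterlim_locally. intros eps. apply (H eps), cond_pos.
Qed.

Lemma cont_path_cC (g : R -> C) : cont_path g <-> contC g.
Proof.
  split.
  - intros H; split; intros t; apply continuous_eps; intros eps He;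
    destruct (H t eps He) as [d [Hd Hd']]; exists (mkposreal d Hd);
    intros y Hy; specialize (Hd' y Hy); rewrite cdist_Cmod in Hd';
    eapply Rle_lt_trans; [|exact Hd'| |exact Hd'].
    + apply (fst_le_Cmod (g y - g t)%C).
    + apply (snd_le_Cmod (g y - g t)%C).
  - intros [H1 H2] t eps He.
    destruct (proj1 (continuous_eps _ t) (H1 t) (eps / 2) ltac:(lra)) as [d1 Hd1].
    destruct (proj1 (continuous_eps _ t) (H2 t) (eps / 2) ltac:(lra)) as [d2 Hd2].
    exists (Rmin d1 d2). split; [apply Rmin_pos; apply cond_pos|].
    intros t' Ht'. rewrite cdist_Cmod. eapply Rle_lt_trans; [apply Cmod_le_sum|].
    assert (A1 := Hd1 t' (Rlt_le_trans _ _ _ Ht' (Rmin_l _ _))).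
    assert (A2 := Hd2 t' (Rlt_le_trans _ _ _ Ht' (Rmin_r _ _))).
    simpl in *. unfold Rminus in *. lra.
Qed.

Lemma cont2_cC (H : R -> R -> C) : cont2 H <-> contC (fun p : R * R => H (fst p) (snd p)).
Proof.
  split.
  - intros HH; split; intros [s t]; apply continuous_eps; intros eps He;
    destruct (HH s t eps He) as [d [Hd Hd']]; exists (mkposreal d Hd);
    intros [s' t'] [Hy1 Hy2]; specialize (Hd' s' t' Hy1 Hy2); rewrite cdist_Cmod in Hd';
    eapply Rle_lt_trans; [|exact Hd'| |exact Hd'].
    + apply (fst_le_Cmod (H s' t' - H s t)%C).
    + apply (snd_le_Cmod (H s' t' - H s t)%C).
  - intros [H1 H2] s t eps He.
    destruct (proj1 (continuous_eps _ (s, t)) (H1 (s, t)) (eps / 2) ltac:(lra)) as [d1 Hd1].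
    destruct (proj1 (continuous_eps _ (s, t)) (H2 (s, t)) (eps / 2) ltac:(lra)) as [d2 Hd2].
    exists (Rmin d1 d2). split; [apply Rmin_pos; apply cond_pos|].
    intros s' t' Hs' Ht'. rewrite cdist_Cmod. eapply Rle_lt_trans; [apply Cmod_le_sum|].
    assert (A1 := Hd1 (s', t') (conj (Rlt_le_trans _ _ _ Hs' (Rmin_l _ _)) (Rlt_le_trans _ _ _ Ht' (Rmin_l _ _)))).
    assert (A2 := Hd2 (s', t') (conj (Rlt_le_trans _ _ _ Hs' (Rmin_r _ _)) (Rlt_le_trans _ _ _ Ht' (Rmin_r _ _)))).
    simpl in *. unfold Rminus in *. lra.
Qed.

Lemma choice_fun {A B : Type} (P : A -> B -> Prop) :
  (forall x, exists y, P x y) -> exists F, forall x, P x (F x).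
Proof.
  intros H. exists (fun x => proj1_sig (constructive_indefinite_description _ (H x))).
  intros x. exact (proj2_sig (constructive_indefinite_description _ (H x))).
Qed.

(* Lebesgue-number form of compactness of the unit square. *)
Lemma lebesgue_square (P : R -> R -> R -> Prop) :
  (forall s t, 0 <= s <= 1 -> 0 <= t <= 1 -> exists d, d > 0 /\
     forall s' t', Rabs (s' - s) < d -> Rabs (t' - t) < d -> P s' t' d) ->
  (forall s t d d', d' <= d -> P s t d -> P s t d') ->
  exists d, d > 0 /\ forall s t, 0 <= s <= 1 -> 0 <= t <= 1 -> P s t d.
Proof.
  intros H Hmon.
  assert (HH : forall st : R * R, exists d : posreal,
    (0 <= fst st <= 1 -> 0 <= snd st <= 1 ->
     forall s' t', Rabs (s' - fst st) < d -> Rabs (t' - snd st) < d -> P s' t' d)).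
  { intros [s t]. destruct (classic (0 <= s <= 1 /\ 0 <= t <= 1)) as [[Hs Ht]|N].
    - destruct (H s t Hs Ht) as [d [Hd Hd']]. exists (mkposreal d Hd). intros _ _. exact Hd'.
    - exists (mkposreal 1 Rlt_0_1). simpl. tauto. }
  destruct (choice_fun _ HH) as [del Hdel].
  destruct (compactness_value_2d 0 1 0 1 (fun s t => del (s, t))) as [d Hd].
  exists d. split; [apply cond_pos|]. intros s t Hs Ht.
  apply NNPP. intros N. apply (Hd s t Hs Ht). intros (u & v & Hu & Hv & A & B & Cc).
  apply N. eapply Hmon; [exact Cc|]. apply (Hdel (u, v)); auto.
Qed.

Lemma lebesgue_segment (P : R -> R -> Prop) :
  (forall s, 0 <= s <= 1 -> exists d, d > 0 /\
     forall s', Rabs (s' - s) < d -> P s' d) ->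
  (forall s d d', d' <= d -> P s d -> P s d') ->
  exists d, d > 0 /\ forall s, 0 <= s <= 1 -> P s d.
Proof.
  intros H Hm.
  destruct (lebesgue_square (fun s _ d => P s d)) as [d [Hd Hd']].
  - intros s t0 Hs _. destruct (H s Hs) as [d [Hd Hd']]. exists d; split; auto.
  - intros s t0 d d1 ? ?. eapply Hm; eauto.
  - exists d; split; auto. intros s Hs. apply (Hd' s 0); lra.
Qed.

(** * Continuous arguments *)

Definition cis (a : R) : C := (cos a, sin a).
(* [a] is an argument of [z]; every [a] is an argument of 0. *)
Definition lift (a : R) (z : C) : Prop := z = (RtoC (Cmod z) * cis a)%C.

Lemma cis_add a b : cis (a + b) = (cis a * cis b)%C.
Proof. unfold cis, Cmult; simpl. rewrite cos_plus, sin_plus. f_equal; ring. Qed.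
Lemma cos_IZR_2PI x (n : Z) : cos (x + 2 * PI * IZR n) = cos x.
Proof.
  replace (2 * PI * IZR n) with (2 * IZR n * PI) by ring.
  destruct (Z.le_ge_cases 0 n) as [H|H].
  - rewrite <- (Z2Nat.id n) by assumption. rewrite <- INR_IZR_INZ. apply cos_period.
  - replace x with (x + 2 * IZR n * PI + 2 * INR (Z.to_nat (- n)) * PI) at 2.
    + now rewrite cos_period.
    + rewrite INR_IZR_INZ, Z2Nat.id by lia. rewrite opp_IZR. ring.
Qed.
Lemma sin_IZR_2PI x (n : Z) : sin (x + 2 * PI * IZR n) = sin x.
Proof.
  replace (2 * PI * IZR n) with (2 * IZR n * PI) by ring.
  destruct (Z.le_ge_cases 0 n) as [H|H].
  - rewrite <- (Z2Nat.id n) by assumption. rewrite <- INR_IZR_INZ. apply sin_period.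
  - replace x with (x + 2 * IZR n * PI + 2 * INR (Z.to_nat (- n)) * PI) at 2.
    + now rewrite sin_period.
    + rewrite INR_IZR_INZ, Z2Nat.id by lia. rewrite opp_IZR. ring.
Qed.
Lemma cis_2PI x (n : Z) : cis (x + 2 * PI * IZR n) = cis x.
Proof. unfold cis. now rewrite cos_IZR_2PI, sin_IZR_2PI. Qed.
Lemma cis_inj a b : cis a = cis b -> exists n : Z, a = b + 2 * PI * IZR n.
Proof.
  intros H. injection H as H1 H2.
  assert (Hc : cos (a - b) = 1).
  { rewrite cos_minus, H1, H2. generalize (sin2_cos2 b); unfold Rsqr; lra. }
  replace (a - b) with (2 * ((a - b) / 2)) in Hc by field.
  rewrite cos_2a_sin in Hc.
  assert (Hs : sin ((a - b) / 2) = 0) by nra.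
  destruct (sin_eq_0_0 _ Hs) as [k Hk]. exists k. lra.
Qed.
Lemma cis_PI x : cis (x + PI) = (- cis x)%C.
Proof. unfold cis. rewrite neg_cos, neg_sin. reflexivity. Qed.

Lemma contC_cis {U : UniformSpace} (F : U -> R) : contR F -> contC (fun x => cis (F x)).
Proof. intros; split; simpl; auto using contR_cos, contR_sin. Qed.

Lemma Cmod_RtoC_pos r : 0 <= r -> Cmod (RtoC r) = r.
Proof. intros. rewrite Cmod_R. now apply Rabs_right, Rle_ge. Qed.
Lemma lift_mult a b z w : lift a z -> lift b w -> lift (a + b) (z * w)%C.
Proof.
  unfold lift; intros Hz Hw. rewrite Cmod_mult, cis_add, RtoC_mult.
  rewrite Hz at 1. rewrite Hw at 1. ring.
Qed.
Lemma lift_scal r a z : 0 < r -> lift a (RtoC r * z)%C -> lift a z.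
Proof.
  unfold lift. intros Hr H. rewrite Cmod_mult, Cmod_RtoC_pos, RtoC_mult in H by lra.
  assert (Hr' : RtoC r <> RtoC 0) by (intros A; apply RtoC_inj in A; lra).
  transitivity (/ RtoC r * (RtoC r * z))%C; [field; assumption|].
  rewrite H at 1. field; assumption.
Qed.
Lemma lift_unique a b z : z <> RtoC 0 -> lift a z -> lift b z ->
  exists n : Z, a = b + 2 * PI * IZR n.
Proof.
  intros Hz Ha Hb. apply cis_inj. unfold lift in *.
  assert (Hm : RtoC (Cmod z) <> RtoC 0).
  { intros A; apply RtoC_inj in A. now apply Hz, Cmod_eq_0. }
  rewrite Ha in Hb at 1.
  transitivity (/ RtoC (Cmod z) * (RtoC (Cmod z) * cis a))%C; [field; assumption|].
  rewrite Hb. field; assumption.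
Qed.
Lemma lift_exists z : exists a, lift a z.
Proof.
  destruct (Ceq_dec z 0) as [->|Hz].
  { exists 0. unfold lift. rewrite Cmod_0. ring. }
  set (r := Cmod z). assert (Hr : 0 < r) by now apply Cmod_gt_0.
  assert (Hsq : fst z * fst z + snd z * snd z = r * r).
  { assert (A := Cmod2_alt z). unfold Re, Im in A. fold r in A. lra. }
  set (x := fst z / r). set (y := snd z / r).
  assert (Hxy : x * x + y * y = 1).
  { unfold x, y. apply (Rmult_eq_reg_r (r * r)); [|nra].
    field_simplify; [|lra]. lra. }
  assert (Hx : -1 <= x <= 1) by nra.
  assert (Hz' : z = (RtoC r * (x, y))%C).
  { unfold Cmult, RtoC, x, y; simpl. destruct z as [u v]; simpl. f_equal; field; lra. }
  destruct (Rle_dec 0 y) as [Hy|Hy].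
  - exists (acos x). unfold lift. fold r. rewrite Hz'. f_equal. unfold cis.
    rewrite cos_acos, sin_acos by assumption. f_equal.
    replace (1 - x²) with (y * y) by (unfold Rsqr; lra). now rewrite sqrt_square.
  - exists (- acos x). unfold lift. fold r. rewrite Hz'. f_equal. unfold cis.
    rewrite cos_neg, sin_neg, cos_acos, sin_acos by assumption. f_equal.
    replace (1 - x²) with ((- y) * (- y)) by (unfold Rsqr; lra).
    rewrite sqrt_square; lra.
Qed.

(** Principal argument, an argument of [z] only in the right half plane. *)
Definition arg (z : C) : R := atan (snd z / fst z).
Lemma lift_arg z : 0 < fst z -> lift (arg z) z.
Proof.
  intros Hz. destruct z as [x y]; simpl in *. unfold lift, arg, cis; simpl.
  rewrite cos_atan, sin_atan. unfold Cmod; simpl fst; simpl snd.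
  assert (Hs : sqrt (x ^ 2 + y ^ 2) = x * sqrt (1 + (y / x)²)).
  { rewrite <- (sqrt_square x) at 2 by lra. rewrite <- sqrt_mult_alt by nra.
    f_equal. unfold Rsqr. field. lra. }
  rewrite Hs.
  assert (Hp : 0 < sqrt (1 + (y / x)²)).
  { apply sqrt_lt_R0. generalize (Rle_0_sqr (y / x)); lra. }
  unfold RtoC, Cmult; simpl. f_equal; field; lra.
Qed.

Lemma close_dot (z w : C) : Cmod (z - w)%C < Cmod w -> 0 < fst (z * Cconj w)%C.
Proof.
  intros H.
  assert (A := Cmod2_alt (z - w)%C). assert (B := Cmod2_alt w).
  assert (D : Cmod (z - w)%C ^ 2 < Cmod w ^ 2).
  { generalize (Cmod_ge_0 (z - w)%C). nra. }
  rewrite A, B in D. unfold Re, Im in D. simpl in *. nra.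
Qed.

(** [Cconj w] is a positive multiple of [/ w], so [arg] is taken of the quotient [z / w] up to
    scaling; closeness puts it in the right half plane. *)
Lemma lift_step a z w : w <> RtoC 0 -> Cmod (z - w)%C < Cmod w -> lift a w ->
  lift (a + arg (z * Cconj w)%C) z.
Proof.
  intros Hw Hc Ha. apply (lift_scal (Cmod w ^ 2)).
  { apply pow_lt. now apply Cmod_gt_0. }
  replace (RtoC (Cmod w ^ 2) * z)%C with (w * (z * Cconj w))%C.
  - apply lift_mult; auto. apply lift_arg. now apply close_dot.
  - rewrite Cmod2_conj. ring.
Qed.

Lemma contC_near {U : UniformSpace} (F : U -> C) x eps : contC F -> eps > 0 ->
  locally x (fun y => Cmod (F y - F x)%C < eps).
Proof.
  intros [H1 H2] He.
  assert (A := proj1 (continuous_eps _ x) (H1 x) (eps / 2) ltac:(lra)).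
  assert (B := proj1 (continuous_eps _ x) (H2 x) (eps / 2) ltac:(lra)).
  generalize (filter_and _ _ A B). apply filter_imp.
  intros y [? ?]. eapply Rle_lt_trans; [apply Cmod_le_sum|].
  simpl. unfold Rminus in *. lra.
Qed.

Definition flr (x : R) : Z := (up x - 1)%Z.
Lemma flr_spec x : IZR (flr x) <= x < IZR (flr x) + 1.
Proof. unfold flr. rewrite minus_IZR. destruct (archimed x). lra. Qed.
Lemma flr_unique x n : IZR n <= x < IZR n + 1 -> flr x = n.
Proof.
  intros H. assert (A := flr_spec x).
  assert (IZR (flr x) < IZR n + 1) by lra. assert (IZR n < IZR (flr x) + 1) by lra.
  rewrite <- plus_IZR in *. apply lt_IZR in H0. apply lt_IZR in H1. lia.
Qed.
Lemma flr_add1 x : flr (x + 1) = (flr x + 1)%Z.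
Proof. apply flr_unique. rewrite plus_IZR. generalize (flr_spec x); lra. Qed.

Lemma periodic_Z {T} (g : R -> T) : (forall t, g (t + 1) = g t) ->
  forall (n : Z) t, g (t + IZR n) = g t.
Proof.
  intros H. assert (Hn : forall n : nat, forall t, g (t + INR n) = g t).
  { induction n; intros t. - simpl; now rewrite Rplus_0_r.
    - rewrite S_INR, <- Rplus_assoc, H. apply IHn. }
  intros n t. destruct (Z.le_ge_cases 0 n) as [A|A].
  - rewrite <- (Z2Nat.id n), <- INR_IZR_INZ by assumption. apply Hn.
  - rewrite <- (Hn (Z.to_nat (- n)) (t + IZR n)). f_equal.
    rewrite INR_IZR_INZ, Z2Nat.id, opp_IZR by lia. ring.
Qed.
Lemma reduce_unit t : exists (n : Z) u, 0 <= u < 1 /\ t = u + IZR n.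
Proof.
  exists (flr t), (t - IZR (flr t)). generalize (flr_spec t). intros; split; lra.
Qed.

Lemma strip_fine (G : R * R -> C) :
  contC G -> (forall s t, 0 <= s <= 1 -> G (s, t) <> RtoC 0) ->
  (forall s t, G (s, t + 1) = G (s, t)) ->
  exists d, d > 0 /\ forall s s' t, 0 <= s <= 1 -> 0 <= s' <= 1 -> Rabs (s' - s) < d ->
    Cmod (G (s', t) - G (s, t))%C < Cmod (G (s, t)).
Proof.
  intros HG Hnz Hper.
  destruct (lebesgue_square (fun s t d => forall s', 0 <= s' <= 1 -> Rabs (s' - s) < d ->
    Cmod (G (s', t) - G (s, t))%C < Cmod (G (s, t)))) as [d [Hd Hd']].
  - intros s t Hs Ht.
    (* Both values lie within [a / 3] of [G (s, t)]: they differ by less than [2 * a / 3], and their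
       moduli exceed it. *)
    set (a := Cmod (G (s, t))). assert (Ha : 0 < a) by (apply Cmod_gt_0, Hnz, Hs).
    destruct (contC_near G (s, t) (a / 3) HG ltac:(lra)) as [d Hd].
    exists (d / 2). split; [generalize (cond_pos d); lra|].
    assert (Hp := cond_pos d).
    intros s1 t1 Hs1 Ht1 s2 Hs2 H2.
    assert (A1 : Cmod (G (s1, t1) - G (s, t))%C < a / 3).
    { apply Hd. split; simpl.
      - change (Rabs (s1 - s) < d). lra.
      - change (Rabs (t1 - t) < d). lra. }
    assert (A2 : Cmod (G (s2, t1) - G (s, t))%C < a / 3).
    { apply Hd. split; simpl.
      - change (Rabs (s2 - s) < d).
        replace (s2 - s) with ((s2 - s1) + (s1 - s)) by ring.
        eapply Rle_lt_trans; [apply Rabs_triang|]. lra.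
      - change (Rabs (t1 - t) < d). lra. }
    assert (A3 : a <= Cmod (G (s1, t1)) + Cmod (G (s1, t1) - G (s, t))%C).
    { unfold a. replace (G (s, t)) with (G (s1, t1) + - (G (s1, t1) - G (s, t)))%C at 1 by ring.
      eapply Rle_trans; [apply Cmod_triangle|]. rewrite Cmod_opp. lra. }
    assert (A4 : Cmod (G (s2, t1) - G (s1, t1))%C <=
      Cmod (G (s2, t1) - G (s, t))%C + Cmod (G (s1, t1) - G (s, t))%C).
    { replace (G (s2, t1) - G (s1, t1))%C with ((G (s2, t1) - G (s, t)) + - (G (s1, t1) - G (s, t)))%C by ring.
      eapply Rle_trans; [apply Cmod_triangle|]. rewrite Cmod_opp. lra. }
    lra.
  - intros s t d d' Hd H s' Hs' Hl. apply H; auto; lra.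
  - exists d. split; auto. intros s s' t Hs Hs' Hl.
    destruct (reduce_unit t) as (n & u & Hu & ->).
    assert (Hp : forall s, G (s, u + IZR n) = G (s, u)).
    { intros r. apply (periodic_Z (fun t => G (r, t))). intros; apply Hper. }
    rewrite !Hp. apply Hd'; auto; lra.
Qed.

(* The argument at [(s, t)] is obtained from the one at [(0, t)] by adding the principal arguments of the
   quotients of the values of [G] at consecutive points of a subdivision of the segment between them. *)
Lemma strip_lift (G : R * R -> C) (th0 : R -> R) :
  contC G -> (forall s t, 0 <= s <= 1 -> G (s, t) <> RtoC 0) ->
  (forall s t, G (s, t + 1) = G (s, t)) ->
  contR th0 -> (forall t, lift (th0 t) (G (0, t))) ->
  exists th : R * R -> R, contR th /\
    (forall s t, 0 <= s <= 1 -> lift (th (s, t)) (G (s, t))) /\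
    (forall t, th (0, t) = th0 t) /\
    (forall s t, th (s, t + 1) - th (s, t) = th0 (t + 1) - th0 t).
Proof.
  intros HG Hnz Hper Hth0 Hl0.
  destruct (strip_fine G HG Hnz Hper) as [d [Hd Hfine]].
  destruct (archimed_cor1 d Hd) as [m [Hm Hm0]].
  assert (HmR : 0 < INR m) by (now apply lt_0_INR).
  set (st := fun (k : nat) (p : R * R) => G (clamp (fst p) * (INR k / INR m), snd p)).
  set (sum := fix sum (k : nat) (p : R * R) : R :=
    match k with O => 0 | S j => sum j p + arg (st (S j) p * Cconj (st j p))%C end).
  assert (Hrange : forall k s, (k <= m)%nat -> 0 <= clamp s * (INR k / INR m) <= 1).
  { intros k s Hk. apply le_INR in Hk. generalize (clamp_range s) (pos_INR k); intros A B.
    assert (0 <= INR k / INR m <= 1).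
    { split. - apply Rmult_le_pos; auto. left; now apply Rinv_0_lt_compat.
      - apply (Rmult_le_reg_r (INR m)); auto. field_simplify; lra. }
    nra. }
  assert (Hst : forall k, contC (st k)).
  { intros k. unfold st. cont. }
  assert (Hnzst : forall k p, (k <= m)%nat -> st k p <> RtoC 0).
  { intros k p Hk. apply Hnz. now apply Hrange. }
  assert (Hclose : forall k p, (S k <= m)%nat -> Cmod (st (S k) p - st k p)%C < Cmod (st k p)).
  { intros k p Hk. apply Hfine; try (apply Hrange; lia).
    rewrite <- Rmult_minus_distr_l, S_INR.
    replace ((INR k + 1) / INR m - INR k / INR m) with (/ INR m) by (field; lra).
    rewrite Rabs_right.
    - generalize (clamp_range (fst p)) (Rinv_0_lt_compat _ HmR). intros. nra.
    - generalize (clamp_range (fst p)) (Rinv_0_lt_compat _ HmR). intros. nra. }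
  assert (Hsumc : forall k, (k <= m)%nat -> contR (sum k)).
  { induction k; intros Hk; simpl; [apply contR_const|].
    apply contR_plus; [apply IHk; lia|]. unfold arg.
    assert (Hcc : contC (fun p => (st (S k) p * Cconj (st k p))%C)).
    { apply contC_mult; auto. destruct (Hst k) as [U V]. split; simpl; auto. now apply contR_opp. }
    destruct Hcc as [U V].
    apply contR_atan, contR_div; auto.
    intros p Hp. generalize (close_dot _ _ (Hclose k p Hk)). rewrite Hp. lra. }
  exists (fun p => th0 (snd p) + sum m p). repeat split.
  - apply contR_plus; [cont|now apply Hsumc].
  - intros s t Hs. simpl.
    assert (Hk : forall k, (k <= m)%nat -> lift (th0 t + sum k (s, t)) (st k (s, t))).
    { induction k; intros Hk; simpl.
      - unfold st; simpl. rewrite Rplus_0_r. replace (clamp s * (0 / INR m)) with 0 by (field; lra). apply Hl0.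
      - rewrite <- Rplus_assoc. apply lift_step; [apply Hnzst; lia|apply Hclose; lia|apply IHk; lia]. }
    specialize (Hk m (le_n _)). unfold st in Hk at 1. simpl in Hk.
    replace (clamp s * (INR m / INR m)) with s in Hk; [exact Hk|].
    rewrite clamp_id by assumption. field; lra.
  - intros t. simpl.
    (* At time 0 all points of the subdivision coincide, and every increment is the argument of a
       nonnegative real number. *)
    assert (Hk : forall k, (k <= m)%nat -> sum k (0, t) = 0).
    { induction k; intros Hk; simpl; auto. rewrite IHk by lia.
      unfold st; simpl fst. rewrite clamp_id by lra. rewrite !Rmult_0_l.
      unfold arg. simpl. replace (_ / _) with 0; [rewrite atan_0; ring|].
      unfold Rdiv. replace (fst (G (0, t)) * - snd (G (0, t)) + snd (G (0, t)) * fst (G (0, t))) with 0 by ring. ring. }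
    rewrite Hk by lia. ring.
  - intros s t. simpl.
    (* The increments are periodic in [t], so the lift has the same gain over a period as [th0]. *)
    assert (Hk : forall k, sum k (s, t + 1) = sum k (s, t)).
    { assert (Hq : forall k, st k (s, t + 1) = st k (s, t)) by (intros; unfold st; simpl; apply Hper).
      induction k; simpl; auto. now rewrite IHk, !Hq. }
    rewrite Hk. ring.
Qed.

(** Extension of [F] from the unit interval to the line, with gain [c] per period; the condition
    [F 1 = F 0 + c] makes the pieces agree at the integers. *)
Lemma floor_ext_cont (F : R -> R) (c : R) : contR F -> F 1 = F 0 + c ->
  contR (fun t => F (t - IZR (flr t)) + c * IZR (flr t)).
Proof.
  intros HF H1 t. assert (Hn := flr_spec t). remember (flr t) as n eqn:En.
  destruct (Req_dec t (IZR n)) as [Heq|Hneq].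
  - apply continuous_eps. intros eps He.

    destruct (proj1 (continuous_eps _ 0) (HF 0) eps He) as [d0 Hd0].
    destruct (proj1 (continuous_eps _ 1) (HF 1) eps He) as [d1 Hd1].
    assert (Hm : 0 < Rmin (Rmin d0 d1) 1).
    { apply Rmin_pos; [apply Rmin_pos; apply cond_pos|lra]. }
    exists (mkposreal _ Hm). intros y Hy. change (Rabs (y - t) < Rmin (Rmin d0 d1) 1) in Hy. rewrite <- En.
    assert (A0 : Rabs (y - t) < d0) by (eapply Rlt_le_trans; [exact Hy|]; eapply Rle_trans; [apply Rmin_l|apply Rmin_l]).
    assert (A1 : Rabs (y - t) < d1) by (eapply Rlt_le_trans; [exact Hy|]; eapply Rle_trans; [apply Rmin_l|apply Rmin_r]).
    assert (A2 : Rabs (y - t) < 1) by (eapply Rlt_le_trans; [exact Hy|apply Rmin_r]).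
    destruct (Rle_dec t y) as [Hty|Hty].
    + assert (Hf : flr y = n). { apply flr_unique. rewrite Rabs_right in A2; lra. }
      rewrite Hf.
      replace (F (y - IZR n) + c * IZR n - (F (t - IZR n) + c * IZR n)) with (F (y - IZR n) - F 0).
      2:{ rewrite Heq. replace (IZR n - IZR n) with 0 by ring. ring. }
      apply Hd0. change (Rabs (y - IZR n - 0) < d0). now rewrite Rminus_0_r, <- Heq.
    + assert (Hf : flr y = (n - 1)%Z).
      { apply flr_unique. rewrite minus_IZR. rewrite Rabs_left in A2; lra. }
      rewrite Hf, minus_IZR.
      replace (F (y - (IZR n - 1)) + c * (IZR n - 1) - (F (t - IZR n) + c * IZR n)) with (F (y - (IZR n - 1)) - F 1).
      2:{ rewrite Heq. replace (IZR n - IZR n) with 0 by ring. rewrite H1. ring. }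
      apply Hd1. change (Rabs (y - (IZR n - 1) - 1) < d1).
      replace (y - (IZR n - 1) - 1) with (y - t) by (rewrite Heq; ring). exact A1.
  - apply (continuous_ext_loc _ (fun y => F (y - IZR n) + c * IZR n)).
    + assert (Hm : 0 < Rmin (t - IZR n) (IZR n + 1 - t)) by (apply Rmin_pos; lra).
      exists (mkposreal _ Hm). intros y Hy. change (Rabs (y - t) < Rmin (t - IZR n) (IZR n + 1 - t)) in Hy.
      assert (B1 := Rlt_le_trans _ _ _ Hy (Rmin_l _ _)). assert (B2 := Rlt_le_trans _ _ _ Hy (Rmin_r _ _)).
      apply Rabs_def2 in B1. apply Rabs_def2 in B2.
      rewrite (flr_unique y n); [reflexivity|lra].
    + apply (contR_plus (fun y => F (y - IZR n)) (fun _ => c * IZR n)); cont.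
Qed.

Lemma loop_lift (h : R -> C) :
  contC h -> (forall t, h (t + 1) = h t) -> (forall t, h t <> RtoC 0) ->
  exists (th : R -> R) (n : Z), contR th /\ (forall t, lift (th t) (h t)) /\
    forall t, th (t + 1) = th t + 2 * PI * IZR n.
Proof.
  intros Hc Hp Hnz.
  destruct (lift_exists (h 0)) as [a Ha].
  (* The loop parameter plays the role of the homotopy time; nothing depends on the periodic
     variable. *)
  destruct (strip_lift (fun p => h (fst p)) (fun _ => a)) as (th & Hth & Hl & H0 & _).
  - cont.
  - intros s t _; apply Hnz.
  - reflexivity.
  - cont.
  - intros t; exact Ha.
  - simpl in Hl. set (F := fun t => th (t, 0)).
    assert (HF : contR F) by (unfold F; cont).
    destruct (lift_unique (F 1) (F 0) (h 0)) as [n Hn]; auto.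
    + rewrite <- (Rplus_0_l 1) at 1. unfold F. rewrite <- (Hp 0). rewrite Rplus_0_l.
      apply Hl. lra.
    + apply Hl. lra.
    + exists (fun t => F (t - IZR (flr t)) + (2 * PI * IZR n) * IZR (flr t)), n.
      split; [|split].
      * now apply floor_ext_cont.
      * intros t. assert (A := flr_spec t).
        assert (B : h t = h (t - IZR (flr t))).
        { rewrite <- (periodic_Z h Hp (flr t) (t - IZR (flr t))). f_equal; ring. }
        rewrite B. unfold lift. rewrite Rmult_assoc, <- mult_IZR, cis_2PI. apply Hl. lra.
      * intros t. rewrite flr_add1, plus_IZR.
        replace (t + 1 - (IZR (flr t) + 1)) with (t - IZR (flr t)) by ring. ring.
Qed.

(** * Homotopies, winding numbers and lifts *)

Ltac cring := first [ring | match goal with |- @eq _ ?a ?b => change (@eq C a b); ring end].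

Definition loop (g : R -> C) : Prop := contC g /\ forall t, g (t + 1) = g t.

(** Free homotopy in an arbitrary set: the same argument is needed in [X], off one point, and off
    the face centres of a lattice. For [X] it is convertible to [homotopic_X]. *)
Definition hom (S : C -> Prop) (g1 g2 : R -> C) : Prop :=
  exists H : R -> R -> C, cont2 H /\
    (forall t, H 0 t = g1 t) /\ (forall t, H 1 t = g2 t) /\
    (forall s t, H s (t + 1) = H s t) /\
    (forall s t, 0 <= s <= 1 -> S (H s t)).

(** Clamping the time keeps the homotopy in [S] for all real times, not only in the unit
    interval. *)
Lemma hom_normal S g1 g2 : hom S g1 g2 -> exists G : R * R -> C,
  contC G /\ (forall t, G (0, t) = g1 t) /\ (forall t, G (1, t) = g2 t) /\
  (forall s t, G (s, t + 1) = G (s, t)) /\ (forall s t, S (G (s, t))).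
Proof.
  intros (H & Hc & H0 & H1 & Hp & HS). exists (fun p => H (clamp (fst p)) (snd p)).
  apply cont2_cC in Hc. repeat split; simpl.
  - apply (contC_comp2 (fun p => H (fst p) (snd p)) (fun p => clamp (fst p)) (fun p => snd p)); auto using contR_snd.
    apply contR_clamp, contR_fst.
  - apply (contC_comp2 (fun p => H (fst p) (snd p)) (fun p => clamp (fst p)) (fun p => snd p)); auto using contR_snd.
    apply contR_clamp, contR_fst.
  - intros t. rewrite clamp_id by lra. apply H0.
  - intros t. rewrite clamp_id by lra. apply H1.
  - intros; apply Hp.
  - intros; apply HS, clamp_range.
Qed.

Lemma hom_intro S g1 g2 (G : R * R -> C) :
  contC G -> (forall t, G (0, t) = g1 t) -> (forall t, G (1, t) = g2 t) ->
  (forall s t, G (s, t + 1) = G (s, t)) -> (forall s t, 0 <= s <= 1 -> S (G (s, t))) -> hom S g1 g2.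
Proof.
  intros Hc H0 H1 Hp HS. exists (fun s t => G (s, t)). repeat split; auto.
  apply cont2_cC. apply (contC_ext G); [|exact Hc]. now intros [s t].
Qed.

Lemma hom_mono (S S' : C -> Prop) g1 g2 : (forall z, S z -> S' z) -> hom S g1 g2 -> hom S' g1 g2.
Proof. intros HS (H & A & B & D & F & K). exists H. repeat split; auto. Qed.

Lemma hom_sym S g1 g2 : hom S g1 g2 -> hom S g2 g1.
Proof.
  intros H. destruct (hom_normal _ _ _ H) as (G & Hc & H0 & H1 & Hp & HS).
  apply (hom_intro S g2 g1 (fun p => G (1 - fst p, snd p))); simpl; auto.
  - cont.
  - intros t. now rewrite Rminus_0_r.
  - intros t. now replace (1 - 1) with 0 by ring.
Qed.

Lemma hom_trans S g1 g2 g3 : hom S g1 g2 -> hom S g2 g3 -> hom S g1 g3.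
Proof.
  intros A B. destruct (hom_normal _ _ _ A) as (G & Gc & G0 & G1 & Gp & GS).
  destruct (hom_normal _ _ _ B) as (K & Kc & K0 & K1 & Kp & KS).
  (* At each time one of the two homotopies is constant and cancels against [K (0, _)]. *)
  apply (hom_intro S g1 g3 (fun p => G (clamp (2 * fst p), snd p) + K (clamp (2 * fst p - 1), snd p) - K (0, snd p))%C); simpl.
  - cont.
  - intros t. replace (clamp (2 * 0)) with 0 by (unfold clamp, Rmax, Rmin; repeat destruct Rle_dec; lra).
    replace (clamp (2 * 0 - 1)) with 0 by (unfold clamp, Rmax, Rmin; repeat destruct Rle_dec; lra).
    rewrite G0. ring.
  - intros t. replace (clamp (2 * 1)) with 1 by (unfold clamp, Rmax, Rmin; repeat destruct Rle_dec; lra).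
    replace (clamp (2 * 1 - 1)) with 1 by (unfold clamp, Rmax, Rmin; repeat destruct Rle_dec; lra).
    rewrite G1, K0, K1. ring.
  - intros s t. now rewrite Gp, !Kp.
  - intros s t Hs. destruct (Rle_dec s (1 / 2)).
    + replace (clamp (2 * s - 1)) with 0 by (unfold clamp, Rmax, Rmin; repeat destruct Rle_dec; lra).
      match goal with |- S ?z => replace z with (G (clamp (2 * s), t)) by ring end. apply GS.
    + replace (clamp (2 * s)) with 1 by (unfold clamp, Rmax, Rmin; repeat destruct Rle_dec; lra).
      rewrite G1, <- K0.
      match goal with |- S ?z => replace z with (K (clamp (2 * s - 1), t)) by ring end. apply KS.
Qed.

Lemma hom_line (S : C -> Prop) g1 g2 : loop g1 -> loop g2 ->
  (forall s t, 0 <= s <= 1 -> S (g1 t + RtoC s * (g2 t - g1 t))%C) -> hom S g1 g2.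
Proof.
  intros [C1 P1] [C2 P2] HS.
  apply (hom_intro S g1 g2 (fun p => g1 (snd p) + RtoC (fst p) * (g2 (snd p) - g1 (snd p)))%C); simpl; auto.
  - cont.
  - intros t. ring.
  - intros t. ring.
  - intros s t. now rewrite P1, P2.
Qed.

(** The parameter moves linearly from [t] to [phi t], so the homotopy stays in the image of the
    loop. *)
Lemma hom_reparam (S : C -> Prop) g phi : loop g -> (forall t, S (g t)) -> contR phi ->
  (forall t, phi (t + 1) = phi t + 1) -> hom S g (fun t => g (phi t)).
Proof.
  intros [Cg Pg] HS Hc Hp.
  apply (hom_intro S _ _ (fun p => g (snd p + fst p * (phi (snd p) - snd p)))); simpl; auto.
  - cont.
  - intros t. f_equal; ring.
  - intros t. f_equal; ring.
  - intros s t. rewrite Hp, <- (Pg (t + s * (phi t - t))). f_equal; ring.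
Qed.

Lemma hom_refl (S : C -> Prop) g : loop g -> (forall t, S (g t)) -> hom S g g.
Proof.
  intros Hg HS. apply hom_line; auto. intros s t _.
  match goal with |- S ?z => replace z with (g t) by ring end. auto.
Qed.

Lemma hom_comp_lin (S : C -> Prop) g1 g2 (k : Z) : hom S g1 g2 ->
  hom S (fun t => g1 (IZR k * t)) (fun t => g2 (IZR k * t)).
Proof.
  intros H. destruct (hom_normal _ _ _ H) as (G & Hc & H0 & H1 & Hp & HS).
  apply (hom_intro S _ _ (fun p => G (fst p, IZR k * snd p))); simpl; auto.
  - cont.
  - intros s t. rewrite Rmult_plus_distr_l, Rmult_1_r.
    apply (periodic_Z (fun u => G (s, u))). intros; apply Hp.
Qed.

Lemma loop_comp_lin g (k : Z) : loop g -> loop (fun t => g (IZR k * t)).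
Proof.
  intros [Hc Hp]; split.
  - cont.
  - intros t. rewrite Rmult_plus_distr_l, Rmult_1_r. now apply periodic_Z.
Qed.
Lemma loop_shift g c : loop g -> loop (fun t => g (t + c)).
Proof.
  intros [Hc Hp]; split.
  - cont.
  - intros t. rewrite <- (Hp (t + c)). f_equal; ring.
Qed.
Lemma loop_const c : loop (fun _ => c).
Proof. split; auto. cont. Qed.

Lemma loop_in_X_iff g : loop_in_X g <-> loop g /\ forall t, X (g t).
Proof. unfold loop_in_X, loop. rewrite cont_path_cC. tauto. Qed.

Lemma hom_X g1 g2 : hom X g1 g2 <-> homotopic_X g1 g2.
Proof. reflexivity. Qed.

Lemma trivial_hom c c' : hom X c c' -> trivial_curve c' -> trivial_curve c.
Proof.
  intros H [(z & Hz & Hn)|[(p & Hp & Hper)|Hper]].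
  - left. exists z; split; auto. apply (hom_trans X c c' _ H Hn).
  - right; left. exists p; split; auto. intros eps He.
    destruct (Hper eps He) as (g' & A & B & D). exists g'. split; [|split]; auto. apply (hom_trans X c c' _ H B).
  - right; right. intros M. destruct (Hper M) as (g' & A & B & D). exists g'. split; [|split]; auto. apply (hom_trans X c c' _ H B).
Qed.

(** The gain of a continuous argument over one period. As every real number is an argument of 0, the
    number is determined only when [g] avoids [p]. *)
Definition wind (g : R -> C) (p : C) (n : Z) : Prop :=
  exists th : R -> R, contR th /\ (forall t, lift (th t) (g t - p)%C) /\
    forall t, th (t + 1) = th t + 2 * PI * IZR n.

Lemma C_neq_sub (z w : C) : z <> w -> (z - w)%C <> RtoC 0.
Proof. intros H A. apply H. replace z with ((z - w) + w)%C by ring. rewrite A. ring. Qed.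

Lemma wind_exists g p : loop g -> (forall t, g t <> p) -> exists n, wind g p n.
Proof.
  intros [Hc Hp] Hn. destruct (loop_lift (fun t => g t - p)%C) as (th & n & A & B & D).
  - cont.
  - intros t. now rewrite Hp.
  - intros t. now apply C_neq_sub.
  - exists n, th. auto.
Qed.

Lemma PI_IZR_inj (n k : Z) : 2 * PI * IZR n = 2 * PI * IZR k -> n = k.
Proof. intros H. apply eq_IZR. generalize PI_RGT_0; intros. apply (Rmult_eq_reg_l (2 * PI)); lra. Qed.

Lemma int_valued_const (phi : R -> R) : contR phi ->
  (forall t, exists n : Z, phi t = 2 * PI * IZR n) -> forall s t, phi s = phi t.
Proof.
  intros Hc Hn s t. destruct (Hn s) as [a Ha], (Hn t) as [b Hb].
  destruct (Z.eq_dec a b) as [->|Hab]; [congruence|exfalso].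
  assert (HPI := PI_RGT_0).
  destruct (IVT_gen phi s t (2 * PI * (IZR (Z.min a b) + 1 / 2))) as [x [_ Hx]].
  - intros x. apply continuity_pt_filterlim, Hc.
  - rewrite Ha, Hb. assert (D : (Z.min a b + 1 <= Z.max a b)%Z) by lia.
    apply IZR_le in D. rewrite plus_IZR in D.
    destruct (Z.le_ge_cases a b).
    + rewrite Z.min_l, Z.max_r in * by lia. rewrite Rmin_left, Rmax_right by nra. nra.
    + rewrite Z.min_r, Z.max_l in * by lia. rewrite Rmin_right, Rmax_left by nra. nra.
  - destruct (Hn x) as [c Hcx]. rewrite Hcx in Hx.
    assert (IZR c = IZR (Z.min a b) + 1 / 2) by (apply (Rmult_eq_reg_l (2 * PI)); lra).
    assert (E1 : IZR (2 * c) = IZR (2 * Z.min a b + 1)) by (rewrite plus_IZR, !mult_IZR; lra).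
    apply eq_IZR in E1. lia.
Qed.

Lemma wind_unique g p n k : (forall t, g t <> p) -> wind g p n -> wind g p k -> n = k.
Proof.
  intros Hn (th & A & B & D) (th' & A' & B' & D').
  assert (E1 := int_valued_const (fun t => th t - th' t) (contR_minus _ _ A A')).
  simpl in E1. apply PI_IZR_inj.
  assert (E2 : th (0 + 1) - th' (0 + 1) = th 0 - th' 0).
  { apply E1. intros t. destruct (lift_unique (th t) (th' t) (g t - p)%C) as [m Hm]; auto.
    - now apply C_neq_sub.
    - exists m. lra. }
  rewrite D, D' in E2. lra.
Qed.

(** [strip_lift] transports the argument along the homotopy, and its last clause preserves the gain
    over a period. *)
Lemma wind_hom g1 g2 p n : hom (fun z => z <> p) g1 g2 -> wind g1 p n -> wind g2 p n.
Proof.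
  intros H (th & A & B & D). destruct (hom_normal _ _ _ H) as (G & Hc & H0 & H1 & Hp & HS).
  destruct (strip_lift (fun q => G q - p)%C th) as (T & T1 & T2 & T3 & T4); auto.
  - cont.
  - intros s t _. now apply C_neq_sub.
  - intros s t. now rewrite Hp.
  - intros t. rewrite H0. apply B.
  - exists (fun t => T (1, t)). split; [|split].
    + cont.
    + intros t. rewrite <- H1. apply T2. lra.
    + intros t. generalize (T4 1 t) (D t). lra.
Qed.

(** * Effect of [f] on winding numbers, and lifting of homotopies through [f] *)

Lemma f_C z : f z = (z * z + Ci)%C.
Proof. destruct z as [x y]. unfold f, Ci, Cmult, Cplus; simpl. f_equal; ring. Qed.

(** [f w - f z = (w - z) * (w + z)], and arguments add. *)
Lemma wind_f d z a b : wind d z a -> wind d (- z)%C b -> wind (fun t => f (d t)) (f z) (a + b).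
Proof.
  intros (th & A & B & D) (th' & A' & B' & D').
  exists (fun t => th t + th' t). split; [|split].
  - cont.
  - intros t. rewrite !f_C. replace (d t * d t + Ci - (z * z + Ci))%C with ((d t - z) * (d t - - z))%C by ring.
    now apply lift_mult.
  - intros t. rewrite D, D', plus_IZR. ring.
Qed.

Lemma wind_shift d p n c : wind d p n -> wind (fun t => d (t + c)) p n.
Proof.
  intros (th & A & B & D). exists (fun t => th (t + c)). split; [|split]; auto.
  - cont.
  - intros t. rewrite <- D. f_equal; ring.
Qed.
Lemma wind_neg d p n : wind d p n -> wind (fun t => - d t)%C (- p)%C n.
Proof.
  intros (th & A & B & D). exists (fun t => th t + PI). split; [|split]; auto.
  - cont.
  - intros t. unfold lift. rewrite cis_PI. replace (- d t - - p)%C with (- (d t - p))%C by ring.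
    rewrite Cmod_opp. rewrite (B t) at 1. ring.
  - intros t. rewrite D. ring.
Qed.
Lemma wind_double g p n : wind g p n -> wind (fun t => g (2 * t)) p (2 * n).
Proof.
  intros (th & A & B & D). exists (fun t => th (2 * t)). split; [|split]; auto.
  - cont.
  - intros t. replace (2 * (t + 1)) with (2 * t + 1 + 1) by ring. rewrite !D, mult_IZR. ring.
Qed.
Lemma wind_ext g g' p n : (forall t, g t = g' t) -> wind g p n -> wind g' p n.
Proof. intros H (th & A & B & D). exists th. split; [|split]; auto. intros t. rewrite <- H. auto. Qed.

(** The square root of [z] selected by the argument [th]; adding [2 * PI] to [th] changes its
    sign. *)
Definition csqrt (th : R) (z : C) : C := (RtoC (sqrt (Cmod z)) * cis (th / 2))%C.
Lemma csqrt_sqr th z : lift th z -> (csqrt th z * csqrt th z)%C = z.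
Proof.
  intros H. unfold csqrt. rewrite H at 3.
  transitivity (RtoC (sqrt (Cmod z) * sqrt (Cmod z)) * (cis (th / 2) * cis (th / 2)))%C.
  - rewrite RtoC_mult. ring.
  - rewrite <- cis_add, sqrt_sqrt by apply Cmod_ge_0. now replace (th / 2 + th / 2) with th by field.
Qed.
Lemma contC_csqrt {U : UniformSpace} (th : U -> R) (F : U -> C) : contR th -> contC F -> contC (fun x => csqrt (th x) (F x)).
Proof.
  intros H1 H2. unfold csqrt. apply contC_mult; [cont|apply contC_cis; unfold Rdiv; cont].
Qed.

Lemma f_P z : Pfin z -> Pfin (f z).
Proof.
  unfold Pfin, f. intros [Hz|[Hz|Hz]]; rewrite Hz; simpl.
  - right; left. f_equal; ring.
  - right; right. f_equal; ring.
  - right; left. f_equal; ring.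
Qed.
Lemma X_f z : X (f z) -> X z.
Proof. intros H Hp. now apply H, f_P. Qed.
Lemma Pfin_i : Pfin Ci. Proof. now left. Qed.
Lemma X_neq_i z : X z -> z <> Ci.
Proof. intros H ->. apply H, Pfin_i. Qed.
Lemma C_sqr_eq (z w : C) : (z * z = w * w)%C -> z = w \/ z = (- w)%C.
Proof.
  intros H. destruct (Ceq_dec z w) as [|N]; auto. right.
  assert (A : ((z - w) * (z + w) = 0)%C) by (transitivity (z * z - w * w)%C; [ring|rewrite H; ring]).
  destruct (Ceq_dec (z + w)%C 0) as [B|B].
  - replace z with ((z + w) - w)%C by ring. rewrite B. ring.
  - exfalso. apply (C_neq_sub _ _ N).
    transitivity ((z - w) * (z + w) * / (z + w))%C; [field; auto|rewrite A; field; auto].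
Qed.
Lemma f_eq z w : f z = f w -> z = w \/ z = (- w)%C.
Proof.
  rewrite !f_C. intros H. apply C_sqr_eq.
  transitivity ((z * z + Ci) - Ci)%C; [ring|]. rewrite H. ring.
Qed.

(** Homotopy lifting for the squaring map. Twice an argument of [c2] is an argument of [c1 - Ci];
    continued along the homotopy it defines a root that starts at [c2]. Its gain over a period stays
    an even multiple of [2 * PI], so the lifted curves close up. *)
Lemma hom_lift c1 c1' c2 : hom X c1 c1' -> loop c2 -> (forall t, f (c2 t) = c1 t) ->
  exists c2', loop c2' /\ hom X c2 c2' /\ forall t, f (c2' t) = c1' t.
Proof.
  intros H [Cc2 Pc2] Hf. destruct (hom_normal _ _ _ H) as (G & Hc & H0 & H1 & Hp & HS).
  assert (Hsq : forall t, (c2 t * c2 t = G (0, t) - Ci)%C).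
  { intros t. rewrite H0, <- Hf, f_C. ring. }
  assert (HGn : forall s t, (G (s, t) - Ci)%C <> RtoC 0).
  { intros s t. apply C_neq_sub, X_neq_i, HS. }
  destruct (loop_lift c2) as (th & n & T1 & T2 & T3); auto.
  { intros t A. apply (HGn 0 t). rewrite <- Hsq, A. ring. }
  destruct (strip_lift (fun q => G q - Ci)%C (fun t => th t + th t)) as (T & Tc & Tl & T0 & Tp).
  - cont.
  - intros; apply HGn.
  - intros s t. now rewrite Hp.
  - cont.
  - intros t. rewrite <- Hsq. now apply lift_mult.
  - set (K := fun p => csqrt (T p) (G p - Ci)%C).
    assert (KC : contC K) by (apply contC_csqrt; cont).
    assert (Kp : forall s t, K (s, t + 1) = K (s, t)).
    { intros s t. unfold K, csqrt. rewrite Hp. apply f_equal.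
      replace (T (s, t + 1) / 2) with (T (s, t) / 2 + 2 * PI * IZR n); [apply cis_2PI|].
      generalize (Tp s t) (T3 t). lra. }
    assert (Kf : forall s t, 0 <= s <= 1 -> f (K (s, t)) = G (s, t)).
    { intros s t Hs. rewrite f_C. unfold K. rewrite csqrt_sqr by auto. cring. }
    exists (fun t => K (1, t)). split; [|split].
    + split; auto. cont.
    + apply (hom_intro X c2 _ K); auto.
      * intros t. unfold K. rewrite T0, <- Hsq. unfold csqrt.
        rewrite Cmod_mult, sqrt_square by apply Cmod_ge_0.
        replace ((th t + th t) / 2) with (th t) by field. symmetry. apply T2.
      * intros s t Hs. apply X_f. rewrite Kf; auto.
    + intros t. rewrite Kf, H1 by lra. reflexivity.
Qed.

(** * Contraction of lifts in the flat metric *)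

(* [q = f i = i - 1]; the finite postcritical points are [i], [q] and [- i]. *)
Definition q : C := (-1, 1).

Lemma Pfin_iff z : Pfin z <-> z = Ci \/ z = q \/ z = (- Ci)%C.
Proof.
  unfold Pfin, Ci, q. replace (- (0, 1))%C with ((0, -1) : C); [tauto|].
  unfold Copp; simpl. f_equal; ring.
Qed.
Lemma f_sub_i z : (f z - Ci)%C = (z * z)%C.
Proof. rewrite f_C. ring. Qed.
Lemma f_sub_q z : (f z - q)%C = ((z - Ci) * (z + Ci))%C.
Proof.
  rewrite f_C. replace q with (Ci - 1)%C by (unfold q, Ci, Cminus, Cplus, Copp, RtoC; simpl; f_equal; ring).
  transitivity (z * z - Ci * Ci)%C; [|ring]. replace (Ci * Ci)%C with (- (1))%C by (unfold Ci, Cmult, Copp, RtoC; simpl; f_equal; ring). ring.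
Qed.
Lemma f_add_i z : (f z + Ci)%C = ((z - q) * (z + q))%C.
Proof.
  rewrite f_C. transitivity (z * z - q * q)%C; [|ring].
  replace (q * q)%C with (- (2 * Ci))%C by (unfold q, Ci, Cmult, Copp, RtoC; simpl; f_equal; ring). ring.
Qed.

(* [f] multiplies the metric [|dz| / flat z] by [2 / sqrt (Cmod (z + q))], see [flat_f]. *)
Definition flat (z : C) : R := sqrt (Cmod (z - Ci) * Cmod (z - q) * Cmod (z + Ci)).

Lemma flat_ge_0 z : 0 <= flat z. Proof. apply sqrt_pos. Qed.
(** The three factors at [f z] multiply to [z ^ 2 * (z + q)] times the three factors at [z]. Hence
    the factor [Cmod z] of the derivative of [f] cancels in the metric. *)
Lemma flat_f z : flat (f z) = Cmod z * sqrt (Cmod (z + q)) * flat z.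
Proof.
  unfold flat. rewrite f_sub_i, f_sub_q, f_add_i, !Cmod_mult.
  assert (A := Cmod_ge_0 z). assert (A0 := Cmod_ge_0 (z - Ci)). assert (A1 := Cmod_ge_0 (z + Ci)).
  assert (A2 := Cmod_ge_0 (z - q)). assert (A3 := Cmod_ge_0 (z + q)).
  transitivity (sqrt ((Cmod z * Cmod z) * Cmod (z + q) * (Cmod (z - Ci) * Cmod (z - q) * Cmod (z + Ci)))).
  { f_equal; ring. }
  rewrite !sqrt_mult; auto; try (repeat apply Rmult_le_pos; assumption).
  now rewrite sqrt_sqrt.
Qed.
Lemma Cmod_q : Cmod q <= 3 / 2.
Proof.
  unfold Cmod, q; simpl fst; simpl snd. rewrite <- (sqrt_Rsqr (3 / 2)) by lra.
  apply sqrt_le_1_alt. unfold Rsqr. lra.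
Qed.
Lemma Cmod_sub_le (z w : C) : Cmod (z - w) <= Cmod z + Cmod w.
Proof. eapply Rle_trans; [apply Cmod_triangle|]. rewrite Cmod_opp. lra. Qed.
Lemma Cmod_rev_triangle (z w : C) : Cmod z - Cmod w <= Cmod (z + w).
Proof.
  replace z with ((z + w) - w)%C at 1 by ring. generalize (Cmod_sub_le (z + w) w). lra.
Qed.
Lemma flat_pos z : X z -> 0 < flat z.
Proof.
  intros H. apply sqrt_lt_R0. assert (N : z <> Ci /\ z <> q /\ z <> (- Ci)%C).
  { unfold X in H. rewrite Pfin_iff in H. tauto. }
  destruct N as (N1 & N2 & N3).
  repeat apply Rmult_lt_0_compat; apply Cmod_gt_0.
  - now apply C_neq_sub.
  - now apply C_neq_sub.
  - replace (z + Ci)%C with (z - - Ci)%C by ring. now apply C_neq_sub.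
Qed.
Lemma flat_le z : Cmod z <= 2 -> flat z <= 6.
Proof.
  (* The three distances are at most 3, 7/2 and 3, and their product is below 36. *)
  intros H. unfold flat. rewrite <- (sqrt_Rsqr 6) by lra. apply sqrt_le_1_alt. unfold Rsqr.
  assert (A1 := Cmod_sub_le z Ci). assert (A2 := Cmod_sub_le z q). assert (A3 := Cmod_triangle z Ci).
  rewrite Cmod_Ci in *. assert (B := Cmod_q).
  assert (A0 := Cmod_ge_0 (z - Ci)). assert (A4 := Cmod_ge_0 (z + Ci)). assert (A5 := Cmod_ge_0 (z - q)).
  assert (C1 : Cmod (z - Ci) * Cmod (z - q) <= 3 * (7 / 2)) by (apply Rmult_le_compat; lra).
  assert (C2 : Cmod (z - Ci) * Cmod (z - q) * Cmod (z + Ci) <= (3 * (7 / 2)) * 3).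
  { apply Rmult_le_compat; try lra. now apply Rmult_le_pos. }
  lra.
Qed.

(* [c] has speed at most [L] in the metric [|dz| / flat z]; no differentiability is assumed. *)
Definition flat_speed (c : R -> C) (L : R) : Prop :=
  forall t eps, eps > 0 -> exists d, d > 0 /\ forall t', Rabs (t' - t) < d ->
    Cmod (c t' - c t)%C <= (L + eps) * flat (c t) * Rabs (t' - t).

(** From [f z' - f z = (z' - z) * (z' + z)], the increment of the lift is that of [c] divided by
    about [2 * Cmod z]; by [flat_f] the factor [Cmod z] cancels. The remaining [sqrt (Cmod (z + q))]
    is at most [sqrt (B + 3 / 2)]. *)
Lemma flat_speed_lift c c' L B : contC c' -> (forall t, f (c' t) = c t) -> (forall t, X (c t)) ->
  0 <= L -> (forall t, Cmod (c' t) <= B) -> flat_speed c L -> flat_speed c' (L * (sqrt (B + 3 / 2) / 2)).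
Proof.
  intros Hc Hf HX HL HB H t eps He.
  set (S := sqrt (B + 3 / 2)). set (z := c' t).
  assert (HB0 : 0 <= B) by (eapply Rle_trans; [apply Cmod_ge_0|apply (HB 0)]).
  assert (HS : 0 < S) by (apply sqrt_lt_R0; lra).
  (* The critical value [f 0 = Ci] is postcritical, so a lift of a loop in [X] avoids 0. *)
  assert (Hz : 0 < Cmod z).
  { apply Cmod_gt_0. intros Hz. apply (HX t). rewrite <- Hf. fold z. rewrite Hz. left. unfold f, RtoC; simpl; f_equal; ring. }
  assert (HLS : 0 <= L * (S / 2)) by (apply Rmult_le_pos; lra).
  (* [eta] and [e1] are chosen so that [(L * (S / 2) + eps) * (2 * Cmod z - eta)] and
     [(L + e1) * (Cmod z * S)] both equal [L * S * Cmod z + eps * Cmod z]. *)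
  set (eta := eps * Cmod z / (L * (S / 2) + eps)).
  assert (Heta : 0 < eta).
  { apply Rmult_lt_0_compat; [now apply Rmult_lt_0_compat|apply Rinv_0_lt_compat; lra]. }
  set (e1 := eps / S). assert (He1 : 0 < e1) by (apply Rmult_lt_0_compat; [lra|now apply Rinv_0_lt_compat]).
  destruct (H t e1 He1) as [d1 [Hd1 Hd1']].
  destruct (contC_near c' t (Rmin eta (Cmod z)) Hc) as [d2 Hd2]. { now apply Rmin_pos. }
  exists (Rmin d1 d2). split. { apply Rmin_pos; auto. apply cond_pos. }
  intros t' Ht'. assert (K1 := Hd1' t' (Rlt_le_trans _ _ _ Ht' (Rmin_l _ _))).
  assert (K2 := Hd2 t' (Rlt_le_trans _ _ _ Ht' (Rmin_r _ _))). fold z in K2.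
  rewrite <- !Hf, flat_f in K1. fold z in K1. fold z. set (z' := c' t') in *.
  rewrite !f_C in K1. replace (z' * z' + Ci - (z * z + Ci))%C with ((z' - z) * (z' + z))%C in K1 by ring.
  rewrite Cmod_mult in K1.
  assert (K3 : 2 * Cmod z - eta <= Cmod (z' + z)).
  { replace (z' + z)%C with ((2 * z) + (z' - z))%C by ring.
    generalize (Cmod_rev_triangle (2 * z) (z' - z)). rewrite Cmod_mult, Cmod_RtoC_pos by lra.
    generalize (Rmin_l eta (Cmod z)). lra. }
  assert (K4 : 0 < Cmod (z' + z)).
  { replace (z' + z)%C with ((2 * z) + (z' - z))%C by ring.
    generalize (Cmod_rev_triangle (2 * z) (z' - z)). rewrite Cmod_mult, Cmod_RtoC_pos by lra.
    generalize (Rmin_r eta (Cmod z)). lra. }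
  assert (K5 : sqrt (Cmod (z + q)) <= S).
  { apply sqrt_le_1_alt. generalize (Cmod_triangle z q) Cmod_q (HB t). fold z. lra. }
  assert (K6 : (L + e1) * (Cmod z * S) <= (L * (S / 2) + eps) * Cmod (z' + z)).
  { apply Rle_trans with ((L * (S / 2) + eps) * (2 * Cmod z - eta)).
    - replace ((L * (S / 2) + eps) * (2 * Cmod z - eta)) with (L * S * Cmod z + eps * Cmod z)
        by (unfold eta; field; lra).
      replace ((L + e1) * (Cmod z * S)) with (L * S * Cmod z + eps * Cmod z) by (unfold e1; field; lra). lra.
    - apply Rmult_le_compat_l; lra. }
  apply (Rmult_le_reg_r (Cmod (z' + z))); auto.
  eapply Rle_trans; [exact K1|].
  assert (Hs := flat_ge_0 z). assert (Ht := Rabs_pos (t' - t)).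
  apply Rle_trans with ((L + e1) * (Cmod z * S) * (flat z * Rabs (t' - t))).
  - replace ((L + e1) * (Cmod z * sqrt (Cmod (z + q)) * flat z) * Rabs (t' - t))
      with (((L + e1) * Cmod z * (flat z * Rabs (t' - t))) * sqrt (Cmod (z + q))) by ring.
    replace ((L + e1) * (Cmod z * S) * (flat z * Rabs (t' - t)))
      with (((L + e1) * Cmod z * (flat z * Rabs (t' - t))) * S) by ring.
    apply Rmult_le_compat_l; auto. repeat apply Rmult_le_pos; lra.
  - replace ((L * (S / 2) + eps) * flat z * Rabs (t' - t) * Cmod (z' + z))
      with ((L * (S / 2) + eps) * Cmod (z' + z) * (flat z * Rabs (t' - t))) by ring.
    apply Rmult_le_compat_r; auto. now apply Rmult_le_pos.
Qed.

(** A mean value inequality without derivatives: the supremum of the times reached with constant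
    [K + eps] is itself reached and can be exceeded until the end. *)
Lemma local_lipschitz (c : R -> C) K :
  (forall t eps, eps > 0 -> exists d, d > 0 /\ forall t', Rabs (t' - t) < d ->
     Cmod (c t' - c t)%C <= (K + eps) * Rabs (t' - t)) ->
  forall s t, Cmod (c t - c s)%C <= K * Rabs (t - s).
Proof.
  intros H.
  assert (Hmain : forall eps, eps > 0 -> forall s t, s <= t -> Cmod (c t - c s)%C <= (K + eps) * (t - s)).
  { intros eps He s t Hst.
    set (P := fun x => s <= x <= t /\ Cmod (c x - c s)%C <= (K + eps) * (x - s)).
    assert (Ps : P s).
    { split; [lra|]. replace (c s - c s)%C with (RtoC 0) by ring. rewrite Cmod_0. lra. }
    destruct (completeness P) as [m [Hub Hlub]].
    { exists t. intros x [Hx _]. lra. } { exists s; auto. }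
    assert (Hsm : s <= m) by now apply Hub.
    assert (Hmt : m <= t) by (apply Hlub; intros x [Hx _]; lra).
    destruct (H m eps He) as [d [Hd Hd']].
    assert (Hm : P m).
    { destruct (classic (exists y, P y /\ m - d < y)) as [[y [[Hy Py] Hyd]]|N].
      - assert (Hym : y <= m) by (apply Hub; split; auto).
        assert (A := Hd' y). rewrite Rabs_left1 in A by lra. specialize (A ltac:(lra)).
        split; [lra|].
        replace (c m - c s)%C with (- (c y - c m) + (c y - c s))%C by ring.
        eapply Rle_trans; [apply Cmod_triangle|]. rewrite Cmod_opp.
        replace ((K + eps) * (m - s)) with ((K + eps) * - (y - m) + (K + eps) * (y - s)) by ring. lra.
      - exfalso. assert (m <= m - d); [|lra]. apply Hlub. intros y Hy.
        apply Rnot_lt_le. intros Hl. apply N. exists y; auto. }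
    destruct (Req_dec m t) as [->|Hne]; [apply Hm|exfalso].
    set (y := Rmin t (m + d / 2)).
    assert (Hy : m < y <= t /\ y < m + d).
    { unfold y. split; [split|]. - apply Rmin_glb_lt; lra. - apply Rmin_l.
      - eapply Rle_lt_trans; [apply Rmin_r|]; lra. }
    assert (A := Hd' y). rewrite Rabs_right in A by lra. specialize (A ltac:(lra)).
    assert (y <= m); [|lra]. apply Hub. split; [lra|].
    replace (c y - c s)%C with ((c y - c m) + (c m - c s))%C by ring.
    eapply Rle_trans; [apply Cmod_triangle|]. destruct Hm as [_ Hm].
    replace ((K + eps) * (y - s)) with ((K + eps) * (y - m) + (K + eps) * (m - s)) by ring. lra. }
  assert (Hle : forall s t, s <= t -> Cmod (c t - c s)%C <= K * (t - s)).
  { intros s t Hst. apply le_epsilon. intros e He.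
    specialize (Hmain (e / (t - s + 1))). eapply Rle_trans.
    - apply Hmain; auto. apply Rmult_lt_0_compat; [lra|apply Rinv_0_lt_compat; lra].
    - rewrite Rmult_plus_distr_r. apply Rplus_le_compat_l.
      apply (Rmult_le_reg_r (t - s + 1)); [lra|]. field_simplify; nra. }
  intros s t. destruct (Rle_dec s t).
  - rewrite Rabs_right by lra. auto.
  - rewrite Rabs_left by lra. replace (c t - c s)%C with (- (c s - c t))%C by ring.
    rewrite Cmod_opp. replace (- (t - s)) with (s - t) by ring. apply Hle; lra.
Qed.

(* [chain c n d]: the loop [d] is an [n]-fold lift of [c] through [f]. *)
Inductive chain (c : R -> C) : nat -> (R -> C) -> Prop :=
| chain_O : loop c -> chain c 0 c
| chain_S n d e : chain c n d -> loop e -> (forall t, f (e t) = d t) -> chain c (S n) e.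

Lemma chain_loop c n d : chain c n d -> loop d.
Proof. now intros []. Qed.
Lemma chain_X c n d : (forall t, X (c t)) -> chain c n d -> forall t, X (d t).
Proof.
  intros HX H. induction H; auto. intros t. apply X_f. now rewrite H1.
Qed.
Lemma chain_split c m n d : chain c (m + n) d -> exists e, chain c n e /\ chain e m d.
Proof.
  revert d. induction m; simpl; intros d H.
  - exists d; split; auto. constructor. eapply chain_loop; eauto.
  - inversion H; subst. destruct (IHm _ H1) as (e' & A1 & A2). exists e'; split; auto.
    econstructor; eauto.
Qed.
(** Lifting the homotopy level by level; this is what lets a polygon stand in for the given loop. *)
Lemma chain_hom c c' n d : hom X c c' -> loop c' -> chain c n d ->
  exists d', chain c' n d' /\ hom X d d'.
Proof.
  intros H Hl Hc. induction Hc.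
  - exists c'; split; auto. now constructor.
  - destruct IHHc as (d' & A1 & A2).
    destruct (hom_lift d d' e A2 H0 H1) as (e' & B1 & B2 & B3).
    exists e'; split; auto. econstructor; eauto.
Qed.

Lemma f_norm z : Cmod z ^ 2 <= Cmod (f z) + 1.
Proof.
  replace (Cmod z ^ 2) with (Cmod (f z - Ci)).
  - generalize (Cmod_sub_le (f z) Ci). rewrite Cmod_Ci. lra.
  - rewrite f_sub_i, Cmod_mult. ring.
Qed.

(** A lift of a loop of radius [b] has radius at most [sqrt (b + 1)]. This is at most [9 / 10 * b]
    for [b >= 2], as [sqrt 3 < 1.8], and at most 2 for [b <= 2]. *)
Lemma chain_norm c n d B : (forall t, Cmod (c t) <= B) -> chain c n d ->
  forall t, Cmod (d t) <= Rmax 2 ((9 / 10) ^ n * B).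
Proof.
  intros HB H. induction H.
  - intros t. simpl. rewrite Rmult_1_l. eapply Rle_trans; [apply HB|apply Rmax_r].
  - intros t. specialize (IHchain t). assert (A := f_norm (e t)). rewrite H1 in A.
    assert (A0 := Cmod_ge_0 (e t)).
    simpl pow. rewrite Rmult_assoc. set (b := (9 / 10) ^ n * B) in *.
    unfold Rmax in *. repeat destruct Rle_dec; nra.
Qed.

Lemma chain_speed c n d L B : (forall t, X (c t)) -> 0 <= L -> 2 <= B -> (forall t, Cmod (c t) <= B) ->
  flat_speed c L -> chain c n d -> flat_speed d (L * (sqrt (B + 3 / 2) / 2) ^ n).
Proof.
  intros HX HL HB2 HB H Hc. induction Hc.
  - simpl. now rewrite Rmult_1_r.
  - simpl pow. rewrite (Rmult_comm _ (_ ^ n)), <- Rmult_assoc.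
    apply (flat_speed_lift d e); auto.
    + apply H0. + eapply chain_X; eauto.
    + apply Rmult_le_pos; auto. apply pow_le. generalize (sqrt_pos (B + 3 / 2)). lra.
    + intros t. assert (Hce : chain c (S n) e) by (econstructor; eauto).
      eapply Rle_trans; [apply (chain_norm c (S n) e B HB Hce)|].
      apply Rmax_lub; auto.
      assert ((9 / 10) ^ S n <= 1).
      { rewrite <- (pow1 (S n)). apply pow_incr; lra. }
      nra.
Qed.

Lemma pow_small r L k : 0 <= r < 1 -> 0 < k -> exists n, (1 <= n)%nat /\ r ^ n * L <= k.
Proof.
  intros Hr Hk. destruct (Rle_dec L 0) as [HL|HL].
  - exists 1%nat. simpl. split; [lia|nra].
  - destruct (pow_lt_1_zero r ltac:(rewrite Rabs_right; lra) (k / L)) as [N HN].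
    { apply Rmult_lt_0_compat; [lra|apply Rinv_0_lt_compat; lra]. }
    exists (S N). split; [lia|]. specialize (HN (S N) ltac:(lia)). rewrite Rabs_right in HN by (apply Rle_ge, pow_le; lra).
    replace k with (k / L * L) by (field; lra). apply Rmult_le_compat_r; lra.
Qed.

(** Two stages. The first [n0] lifts bring the loop into the disc of radius 2, where the speed may
    still grow, but by a known factor. Each of the next [n1] lifts multiplies it by at most
    [sqrt (7 / 2) / 2 < 1]. The final factor 6 of [flat_le] turns flat speed into Euclidean
    speed. *)
Lemma chain_contract L B k : 0 <= L -> 2 <= B -> 0 < k -> exists N, (1 <= N)%nat /\ forall c d,
  (forall t, X (c t)) -> (forall t, Cmod (c t) <= B) -> flat_speed c L -> chain c N d ->
  forall s t, Cmod (d t - d s)%C <= k * Rabs (t - s).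
Proof.
  intros HL HB Hk.
  destruct (pow_small (9 / 10) B 2) as (n0 & _ & Hn0); try lra.
  set (L' := L * (sqrt (B + 3 / 2) / 2) ^ n0).
  assert (HL' : 0 <= L').
  { apply Rmult_le_pos; auto. apply pow_le. generalize (sqrt_pos (B + 3 / 2)). lra. }
  set (r := sqrt (2 + 3 / 2) / 2).
  assert (Hr : 0 <= r < 1).
  { unfold r. generalize (sqrt_pos (2 + 3 / 2)). intros.
    assert (sqrt (2 + 3 / 2) < sqrt (Rsqr 2)) by (apply sqrt_lt_1_alt; unfold Rsqr; lra).
    rewrite sqrt_Rsqr in * by lra. lra. }
  destruct (pow_small r (L' * 6) k) as (n1 & Hn1p & Hn1); try lra.
  exists (n1 + n0)%nat. split; [lia|]. intros c d HX Hcb Hs Hc.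
  destruct (chain_split _ _ _ _ Hc) as (e & C1 & C2).
  assert (He : forall t, Cmod (e t) <= 2).
  { intros t. eapply Rle_trans; [apply (chain_norm c n0 e B Hcb C1)|]. apply Rmax_lub; lra. }
  assert (Hd : forall t, Cmod (d t) <= 2).
  { intros t. eapply Rle_trans; [apply (chain_norm e n1 d 2 He C2)|]. apply Rmax_lub; try lra.
    assert ((9 / 10) ^ n1 <= 1) by (rewrite <- (pow1 n1); apply pow_incr; lra). nra. }
  assert (Hse := chain_speed c n0 e L B HX HL HB Hcb Hs C1). fold L' in Hse.
  assert (Hsd := chain_speed e n1 d L' 2 (chain_X _ _ _ HX C1) HL' ltac:(lra) He Hse C2). fold r in Hsd.
  apply local_lipschitz. intros t eps Heps.
  destruct (Hsd t (eps / 6) ltac:(lra)) as [dd [Hdd Hdd']]. exists dd; split; auto.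
  intros t' Ht'. eapply Rle_trans; [now apply Hdd'|].
  apply Rmult_le_compat_r; [apply Rabs_pos|].
  apply Rle_trans with ((L' * r ^ n1 + eps / 6) * 6); [|lra].
  apply Rmult_le_compat_l.
  - assert (0 <= L' * r ^ n1) by (apply Rmult_le_pos; auto; apply pow_le; lra). lra.
  - apply flat_le, Hd.
Qed.

(** * Loops of small diameter *)

Lemma Cmod_fst_lt (z : C) r : Cmod z < r -> Rabs (fst z) < r.
Proof. intros. eapply Rle_lt_trans; [apply fst_le_Cmod|auto]. Qed.
Lemma Cmod_snd_lt (z : C) r : Cmod z < r -> Rabs (snd z) < r.
Proof. intros. eapply Rle_lt_trans; [apply snd_le_Cmod|auto]. Qed.

Lemma Pfin_apart p p' : Pfin p -> Pfin p' -> Cmod (p - p') < 1 -> p = p'.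
Proof.
  intros H H' Hd. assert (A := Cmod_fst_lt _ _ Hd). assert (B := Cmod_snd_lt _ _ Hd).
  apply Rabs_def2 in A. apply Rabs_def2 in B.
  destruct H as [H|[H|H]], H' as [H'|[H'|H']]; subst; simpl in *; auto; exfalso; lra.
Qed.

(** The loop stays within 1/4 of [d 0]. If [d 0] is within 1/2 of a point [p] of [Pfin], the loop
    lies in the disc of radius 3/4 about [p], which contains no other such point, and it shrinks
    radially towards [p]. Otherwise the contraction to [d 0] meets no such point. *)
Lemma small_loop_trivial d : loop d -> (forall t, X (d t)) ->
  (forall s t, Cmod (d t - d s)%C <= 1 / 4 * Rabs (t - s)) -> trivial_curve d.
Proof.
  intros Hl HX Hs.
  assert (Hd : forall t, Cmod (d t - d 0)%C <= 1 / 4).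
  { intros t. destruct (reduce_unit t) as (n & u & Hu & ->). destruct Hl as [_ Hp].
    rewrite (periodic_Z d Hp). eapply Rle_trans; [apply Hs|]. rewrite Rabs_right; lra. }
  destruct (classic (exists p, Pfin p /\ Cmod (d 0 - p)%C < 1 / 2)) as [(p & Hp & Hdp)|N].
  - right; left. exists p; split; auto. intros eps He.
    (* Scaling the disc of radius less than 1 by [k < eps] puts the loop within [eps] of [p]. *)
    set (k := Rmin 1 eps / 2). assert (Hk : 0 < k <= 1 / 2 /\ k < eps).
    { unfold k, Rmin; destruct Rle_dec; lra. }
    assert (Hpt : forall t, Cmod (d t - p)%C < 1).
    { intros t. replace (d t - p)%C with ((d t - d 0) + (d 0 - p))%C by ring.
      eapply Rle_lt_trans; [apply Cmod_triangle|]. specialize (Hd t). lra. }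
    assert (Hscal : forall r t, 0 < r <= 1 -> X (p + RtoC r * (d t - p))%C).
    { intros r t Hr Hq. specialize (Hpt t).
      assert (Heq : (p + RtoC r * (d t - p))%C = p).
      { apply Pfin_apart; auto.
        replace (p + RtoC r * (d t - p) - p)%C with (RtoC r * (d t - p))%C by ring.
        rewrite Cmod_mult, Cmod_RtoC_pos by lra. generalize (Cmod_ge_0 (d t - p)). nra. }
      assert (Hz : (RtoC r * (d t - p) = 0)%C).
      { transitivity (p + RtoC r * (d t - p) - p)%C; [ring|]. rewrite Heq. ring. }
      apply (f_equal Cmod) in Hz. rewrite Cmod_mult, Cmod_0, Cmod_RtoC_pos in Hz by lra.
      assert (Hne : d t <> p) by (intros A; apply (HX t); now rewrite A).
      assert (G := proj1 (Cmod_gt_0 (d t - p)%C) (C_neq_sub _ _ Hne)). nra. }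
    exists (fun t => p + RtoC k * (d t - p))%C.
    assert (Hl' : loop (fun t => p + RtoC k * (d t - p))%C).
    { destruct Hl as [Hc Hper]. split.
      - cont.
      - intros t. now rewrite Hper. }
    split; [|split].
    + apply loop_in_X_iff. split; auto. intros t. apply Hscal. lra.
    + apply hom_X, hom_line; auto. intros s t Hs1.
      replace (d t + RtoC s * (p + RtoC k * (d t - p) - d t))%C
        with (p + RtoC (1 - s * (1 - k)) * (d t - p))%C.
      * apply Hscal. nra.
      * rewrite RtoC_minus, RtoC_mult, RtoC_minus. ring.
    + intros t. rewrite cdist_Cmod. replace (p + RtoC k * (d t - p) - p)%C with (RtoC k * (d t - p))%C by ring.
      rewrite Cmod_mult, Cmod_RtoC_pos by lra. specialize (Hpt t). generalize (Cmod_ge_0 (d t - p)). nra.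
  - left. exists (d 0). split; auto. apply hom_X, hom_line; auto using loop_const.
    intros s t Hs1 Hq. apply N. eexists; split; [exact Hq|].
    replace (d 0 - (d t + RtoC s * (d 0 - d t)))%C with (- (RtoC (1 - s) * (d t - d 0)))%C.
    + rewrite Cmod_opp, Cmod_mult, Cmod_RtoC_pos by lra. specialize (Hd t).
      generalize (Cmod_ge_0 (d t - d 0)). nra.
    + rewrite RtoC_minus. ring.
Qed.

(** * A number of lifts that works for all multiplicities *)

Lemma periodic_bounds (phi : R -> R) : contR phi -> (forall t, phi (t + 1) = phi t) ->
  exists a b, forall t, phi a <= phi t <= phi b.
Proof.
  intros Hc Hp.
  destruct (continuity_ab_min phi 0 1) as [a [Ha _]]; try lra.
  { intros x _. apply continuity_pt_filterlim, Hc. }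
  destruct (continuity_ab_maj phi 0 1) as [b [Hb _]]; try lra.
  { intros x _. apply continuity_pt_filterlim, Hc. }
  exists a, b. intros t. destruct (reduce_unit t) as (n & u & Hu & ->).
  rewrite (periodic_Z phi Hp). split; [apply Ha|apply Hb]; lra.
Qed.

Lemma lipschitz_flat_speed c K b : 0 < b -> (forall t, b <= flat (c t)) ->
  0 <= K -> (forall s t, Cmod (c t - c s)%C <= K * Rabs (t - s)) -> flat_speed c (K / b).
Proof.
  intros Hb Hsig HK HL t eps He. exists 1; split; [lra|]. intros t' _.
  eapply Rle_trans; [apply HL|]. apply Rmult_le_compat_r; [apply Rabs_pos|].
  apply Rle_trans with (K / b * flat (c t)).
  - replace K with (K / b * b) at 1 by (field; lra). apply Rmult_le_compat_l; auto.
    apply Rmult_le_pos; auto. left; now apply Rinv_0_lt_compat.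
  - apply Rmult_le_compat_r; [apply flat_ge_0|lra].
Qed.

(** [N] depends neither on [k] nor on the lift: traversing the Lipschitz loop [k <= m] times gives
    speed at most [K * m] divided by the minimum of [flat] along the loop. *)
Lemma lifts_eventually_trivial g g' K (m : Z) :
  loop g' -> (forall t, X (g' t)) -> hom X g g' ->
  0 <= K -> (forall s t, Cmod (g' t - g' s)%C <= K * Rabs (t - s)) -> (0 <= m)%Z ->
  exists N, (1 <= N)%nat /\ forall k d, (0 <= k <= m)%Z -> chain (fun t => g (IZR k * t)) N d -> trivial_curve d.
Proof.
  intros Hl HX Hh HK HL Hm.
  assert (Hcs : contR (fun t => flat (g' t))).
  { destruct Hl as [Hc _]. unfold flat. cont. }
  destruct (periodic_bounds (fun t => flat (g' t))) as (a & a' & Ha); auto.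
  { intros t. now rewrite (proj2 Hl). }
  destruct (periodic_bounds (fun t => Cmod (g' t))) as (b' & b & Hb).
  { destruct Hl. cont. } { intros t. now rewrite (proj2 Hl). }
  set (B := Rmax 2 (Cmod (g' b))).
  destruct (chain_contract (K * IZR m / flat (g' a)) B (1 / 4)) as (N & HN1 & HN).
  - apply Rmult_le_pos. + apply Rmult_le_pos; auto. now apply IZR_le.
    + left. apply Rinv_0_lt_compat. now apply flat_pos.
  - apply Rmax_l.
  - lra.
  - exists N. split; auto. intros k d Hk Hc.
    set (gk := fun t => g (IZR k * t)) in *. set (gk' := fun t => g' (IZR k * t)).
    assert (Hlk : loop gk') by now apply loop_comp_lin.
    assert (HXk : forall t, X (gk' t)) by (intros; apply HX).
    destruct (chain_hom gk gk' N d) as (d' & Hc' & Hd'); auto. { now apply hom_comp_lin. }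
    apply (trivial_hom d d' Hd'). apply small_loop_trivial.
    + eapply chain_loop; eauto.
    + eapply chain_X; eauto.
    + apply (HN gk' d'); auto.
      * intros t. eapply Rle_trans; [apply Hb|apply Rmax_r].
      * apply lipschitz_flat_speed; auto.
        -- now apply flat_pos.
        -- intros t. apply Ha.
        -- apply Rmult_le_pos; auto. now apply IZR_le.
        -- intros s t. unfold gk'. eapply Rle_trans; [apply HL|].
           rewrite <- Rmult_minus_distr_l, Rabs_mult, <- Rmult_assoc.
           apply Rmult_le_compat_r; [apply Rabs_pos|]. apply Rmult_le_compat_l; auto.
           rewrite <- abs_IZR. apply IZR_le. lia.
Qed.

Lemma simple_loop_iff g : simple_loop g <-> (loop g /\ (forall t, X (g t)) /\
  forall s t, 0 <= s < 1 -> 0 <= t < 1 -> g s = g t -> s = t).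
Proof. unfold simple_loop. rewrite loop_in_X_iff. tauto. Qed.

Lemma simple_loop_intro g : contC g -> (forall t, g (t + 1) = g t) -> (forall t, X (g t)) ->
  (forall s t, 0 <= s < 1 -> 0 <= t < 1 -> g s = g t -> s = t) -> simple_loop g.
Proof. intros. apply simple_loop_iff. unfold loop. auto. Qed.

Lemma simple_loop_inj g s t : simple_loop g -> g s = g t -> exists n : Z, s = t + IZR n.
Proof.
  intros H He. apply simple_loop_iff in H. destruct H as ([_ Hp] & _ & Hi).
  destruct (reduce_unit s) as (n & u & Hu & ->), (reduce_unit t) as (m & v & Hv & ->).
  rewrite !(periodic_Z g Hp) in He. rewrite (Hi u v Hu Hv He).
  exists (n - m)%Z. rewrite minus_IZR. cring.
Qed.

(** * Polygonal loops *)

(* The polygonal path through the points [a :: l], one unit of time per edge. *)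
Fixpoint pl (a : C) (l : list C) (t : R) : C :=
  match l with
  | [] => a
  | b :: l' => (a + RtoC (clamp t) * (b - a) + (pl b l' (t - 1) - b))%C
  end.

Lemma clamp_neg t : t <= 0 -> clamp t = 0.
Proof. intros. unfold clamp, Rmax, Rmin. repeat destruct Rle_dec; lra. Qed.
Lemma clamp_big t : 1 <= t -> clamp t = 1.
Proof. intros. unfold clamp, Rmax, Rmin. repeat destruct Rle_dec; lra. Qed.

Lemma contC_pl l : forall a, contC (pl a l).
Proof.
  induction l as [|b l IH]; intros a; simpl; [cont|]. specialize (IH b). cont.
Qed.
Lemma pl_neg l : forall a t, t <= 0 -> pl a l t = a.
Proof.
  induction l as [|b l IH]; intros a t Ht; simpl; auto.
  rewrite IH, clamp_neg by lra. cring.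
Qed.
Lemma pl_app l r : forall a t, pl a (l ++ r) t =
  (pl a l t + (pl (last l a) r (t - INR (length l)) - last l a))%C.
Proof.
  induction l as [|b l IH]; intros a t.
  - simpl. rewrite Rminus_0_r. cring.
  - rewrite last_cons. cbn [app pl length]. rewrite IH, S_INR.
    replace (t - (INR (length l) + 1)) with (t - 1 - INR (length l)) by ring. cring.
Qed.
Lemma pl_end l : forall a t, INR (length l) <= t -> pl a l t = last l a.
Proof.
  induction l as [|b l IH]; intros a t Ht; [reflexivity|].
  rewrite last_cons. cbn [pl]. cbn [length] in Ht. rewrite S_INR in Ht.
  rewrite IH by lra. rewrite clamp_big by (generalize (pos_INR (length l)); lra). cring.
Qed.

Definition ploop (a : C) (l : list C) (t : R) : C := pl a l (INR (length l) * (t - IZR (flr t))).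

Lemma ploop_at a l (k : Z) x : last l a = a -> 0 <= x <= 1 ->
  ploop a l (IZR k + x) = pl a l (INR (length l) * x).
Proof.
  intros Hl Hx. unfold ploop. destruct (Req_dec x 1) as [->|Hne].
  - rewrite (flr_unique (IZR k + 1) (k + 1)) by (rewrite plus_IZR; lra).
    rewrite plus_IZR. replace (IZR k + 1 - (IZR k + 1)) with 0 by ring.
    rewrite pl_neg by lra. rewrite pl_end by lra. auto.
  - rewrite (flr_unique (IZR k + x) k) by lra. do 2 f_equal. ring.
Qed.
Lemma ploop_loop a l : last l a = a -> loop (ploop a l).
Proof.
  intros Hl. assert (Hc := contC_pl l a). destruct Hc as [H1 H2]. set (n := INR (length l)).
  assert (E0 : pl a l (n * 0) = a) by (apply pl_neg; lra).
  assert (E1 : pl a l (n * 1) = a) by (unfold n; rewrite pl_end; auto; lra).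
  assert (Hn : contR (fun u : R => n * u)) by cont.
  split; [split|].
  - apply (contR_ext (fun t => fst (pl a l (n * (t - IZR (flr t)))) + 0 * IZR (flr t))).
    { intros t. unfold ploop, n. cbn beta. ring. }
    apply (floor_ext_cont (fun u => fst (pl a l (n * u))) 0).
    + apply (contR_comp' (fun u => fst (pl a l u))); auto.
    + rewrite E0, E1. ring.
  - apply (contR_ext (fun t => snd (pl a l (n * (t - IZR (flr t)))) + 0 * IZR (flr t))).
    { intros t. unfold ploop, n. cbn beta. ring. }
    apply (floor_ext_cont (fun u => snd (pl a l (n * u))) 0).
    + apply (contR_comp' (fun u => snd (pl a l u))); auto.
    + rewrite E0, E1. ring.
  - intros t. unfold ploop. rewrite flr_add1, plus_IZR. do 2 f_equal. ring.
Qed.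

Fixpoint all2 (Q : C -> C -> C -> C -> Prop) (a : C) (l : list C) (a' : C) (l' : list C) : Prop :=
  match l, l' with
  | [], [] => True
  | b :: m, b' :: m' => Q a b a' b' /\ all2 Q b m b' m'
  | _, _ => False
  end.
Lemma all2_length Q l : forall a a' l', all2 Q a l a' l' -> length l = length l'.
Proof. induction l; intros b a' [|c l']; simpl; intros H; try tauto. f_equal. eapply IHl; apply H. Qed.
Lemma pl_seg Q l : forall a a' l', all2 Q a l a' l' -> l <> [] -> forall t, exists u v u' v' s,
  0 <= s <= 1 /\ Q u v u' v' /\ pl a l t = (u + RtoC s * (v - u))%C /\ pl a' l' t = (u' + RtoC s * (v' - u'))%C.
Proof.
  induction l as [|b l IH]; intros a a' [|b' l'] H Hne t; simpl in H; try tauto.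
  destruct H as [H1 H2]. cbn [pl].
  destruct (classic (t <= 1 \/ l = [])) as [Hc|Hc].
  - exists a, b, a', b', (clamp t). split; [apply clamp_range|]. split; auto.
    assert (E : pl b l (t - 1) = b /\ pl b' l' (t - 1) = b').
    { destruct Hc as [Hc| ->].
      - split; apply pl_neg; lra.
      - destruct l'; simpl in *; tauto. }
    destruct E as [-> ->]. split; cring.
  - destruct (IH b b' l' H2 ltac:(tauto) (t - 1)) as (u & v & u' & v' & s & Hs & HQ & E1 & E2).
    exists u, v, u', v', s. rewrite E1, E2, clamp_big by tauto || lra. repeat split; auto; try lra; cring.
Qed.

Definition seg_in (S : C -> Prop) (u v : C) : Prop := forall s, 0 <= s <= 1 -> S (u + RtoC s * (v - u))%C.
Definition quad_in (S : C -> Prop) (u v u' v' : C) : Prop := forall s r, 0 <= s <= 1 -> 0 <= r <= 1 ->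
  S ((u + RtoC s * (v - u)) + RtoC r * ((u' + RtoC s * (v' - u')) - (u + RtoC s * (v - u))))%C.

(** Polygons with equally many edges are parametrised alike, so the straight-line homotopy can be
    checked on each pair of corresponding edges. *)
Lemma quad_hom S a l a' l' : last l a = a -> last l' a' = a' -> l <> [] ->
  all2 (quad_in S) a l a' l' -> hom S (ploop a l) (ploop a' l').
Proof.
  intros H1 H2 Hne H. apply hom_line; auto using ploop_loop.
  intros s t Hs. unfold ploop. rewrite <- (all2_length _ _ _ _ _ H).
  destruct (pl_seg _ _ _ _ _ H Hne (INR (length l) * (t - IZR (flr t)))) as (u & v & u' & v' & r & Hr & HQ & -> & ->).
  apply HQ; auto.
Qed.

Lemma ploop_in S a l : l <> [] -> path (seg_in S) a l -> forall t, S (ploop a l t).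
Proof.
  intros Hne H t.
  assert (HA : all2 (fun u v _ _ => seg_in S u v) a l a l).
  { clear Hne. revert a H. induction l; simpl; auto. intros b [? ?]; auto. }
  destruct (pl_seg _ _ _ _ _ HA Hne (INR (length l) * (t - IZR (flr t)))) as (u & v & _ & _ & s & Hs & HQ & E1 & _).
  unfold ploop. rewrite E1. now apply HQ.
Qed.

(* A time change that stops during [[j, j + 1]]. *)
Definition squeeze (j t : R) : R := Rmin t (Rmax j (t - 1)).
Lemma pl_dup_head a l t : pl a (a :: l) t = pl a l (t - 1).
Proof. simpl. cring. Qed.
Lemma pl_dup (a : C) l2 : forall l1 x t,
  pl x (l1 ++ a :: a :: l2) t = pl x (l1 ++ a :: l2) (squeeze (INR (S (length l1))) t).
Proof.
  induction l1 as [|y l1 IH]; intros x t; cbn [app pl length].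
  - unfold squeeze. rewrite S_INR. simpl (INR 0).
    replace (clamp (Rmin t (Rmax (0 + 1) (t - 1)))) with (clamp t)
      by (unfold clamp, Rmin, Rmax; repeat destruct Rle_dec; lra).
    destruct (Rle_dec t 2).
    + rewrite (pl_neg l2 a (t - 1 - 1)) by lra.
      rewrite (pl_neg l2 a (Rmin t (Rmax (0 + 1) (t - 1)) - 1)) by (unfold Rmin, Rmax; repeat destruct Rle_dec; lra). cring.
    + replace (Rmin t (Rmax (0 + 1) (t - 1)) - 1) with (t - 1 - 1) by (unfold Rmin, Rmax; repeat destruct Rle_dec; lra). cring.
  - rewrite IH. assert (Hp := pos_INR (length l1)). unfold squeeze. rewrite !S_INR.
    replace (clamp (Rmin t (Rmax (INR (length l1) + 1 + 1) (t - 1)))) with (clamp t)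
      by (unfold clamp, Rmin, Rmax; repeat destruct Rle_dec; lra).
    replace (Rmin t (Rmax (INR (length l1) + 1 + 1) (t - 1)) - 1)
      with (Rmin (t - 1) (Rmax (INR (length l1) + 1) (t - 1 - 1)))
      by (unfold clamp, Rmin, Rmax; repeat destruct Rle_dec; lra). reflexivity.
Qed.

Definition PL (L : list C) : R -> C := match L with [] => fun _ => RtoC 0 | a :: l => ploop a l end.
Definition closedL {T} (L : list T) : Prop := match L with [] => False | a :: l => l <> [] /\ last l a = a end.
Definition pathL {T} (R : T -> T -> Prop) (L : list T) : Prop := match L with [] => True | a :: l => path R a l end.

(** A repeated vertex makes the polygonal path rest for one unit of time. The longer loop is thus
    the shorter one after a time change, with [F] rescaling from [n + 1] edges to [n]. *)
Lemma pl_squeeze_hom S a l a2 l2 j : last l a = a -> last l2 a2 = a2 -> l <> [] ->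
  length l2 = Datatypes.S (length l) -> (forall t, S (ploop a l t)) ->
  0 <= j <= INR (length l) -> (forall t, 0 <= t -> pl a2 l2 t = pl a l (squeeze j t)) ->
  hom S (ploop a l) (ploop a2 l2).
Proof.
  intros Hl Hl2 Hne Hlen HS Hj Heq. set (n := INR (length l)) in *.
  assert (Hn : 0 < n) by (apply lt_0_INR; destruct l; [tauto|simpl; lia]).
  set (F := fun u => squeeze j ((n + 1) * u) * / n).
  assert (F0 : F 0 = 0).
  { unfold F, squeeze. replace (Rmin ((n + 1) * 0) (Rmax j ((n + 1) * 0 - 1))) with 0; [ring|].
    unfold Rmin, Rmax; repeat destruct Rle_dec; lra. }
  assert (F1 : F 1 = F 0 + 1).
  { rewrite F0. unfold F, squeeze. replace (Rmin ((n + 1) * 1) (Rmax j ((n + 1) * 1 - 1))) with n; [field; lra|].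
    unfold Rmin, Rmax; repeat destruct Rle_dec; lra. }
  assert (FC : contR F).
  { unfold F, squeeze. cont. }
  assert (Fr : forall u, 0 <= u <= 1 -> 0 <= F u <= 1).
  { intros u Hu. assert (0 <= squeeze j ((n + 1) * u) <= n).
    { unfold squeeze. assert (0 <= (n + 1) * u <= n + 1) by nra. unfold Rmin, Rmax; repeat destruct Rle_dec; lra. }
    unfold F. split; [apply Rmult_le_pos; [lra|left; now apply Rinv_0_lt_compat]|].
    apply (Rmult_le_reg_r n); auto. rewrite Rmult_assoc, Rinv_l by lra. lra. }
  set (phi := fun t => F (t - IZR (flr t)) + 1 * IZR (flr t)).
  assert (Hphi : forall t, ploop a2 l2 t = ploop a l (phi t)).
  { intros t. unfold phi. set (u := t - IZR (flr t)). assert (Hu : 0 <= u <= 1) by (unfold u; generalize (flr_spec t); lra).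
    replace (F u + 1 * IZR (flr t)) with (IZR (flr t) + F u) by ring. rewrite ploop_at by auto.
    unfold ploop. rewrite Hlen, S_INR. fold n u. rewrite Heq by nra. f_equal. unfold F. field. lra. }
  destruct (hom_reparam S (ploop a l) phi) as (H & HH); auto using ploop_loop.
  - now apply floor_ext_cont.
  - intros t. unfold phi. rewrite flr_add1, plus_IZR.
    replace (t + 1 - (IZR (flr t) + 1)) with (t - IZR (flr t)) by ring. ring.
  - exists H. destruct HH as (A1 & A2 & A3 & A4 & A5). repeat split; auto. intros t. rewrite Hphi. auto.
Qed.

Lemma dup_hom S l1 a l2 : closedL (l1 ++ a :: l2) -> pathL (seg_in S) (l1 ++ a :: l2) ->
  hom S (PL (l1 ++ a :: l2)) (PL (l1 ++ a :: a :: l2)).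
Proof.
  intros Hc Hp. destruct l1 as [|x l1]; cbn [app PL closedL pathL] in *.
  - destruct Hc as [Hne Hl]. apply (pl_squeeze_hom S a l2 a (a :: l2) 0); auto.
    + now rewrite last_cons.
    + now apply ploop_in.
    + split; [lra|apply pos_INR].
    + intros t Ht. rewrite pl_dup_head. unfold squeeze. destruct (Rle_dec t 1).
      * rewrite !pl_neg; auto; unfold Rmin, Rmax; repeat destruct Rle_dec; lra.
      * f_equal. unfold Rmin, Rmax; repeat destruct Rle_dec; lra.
  - destruct Hc as [Hne Hl]. apply (pl_squeeze_hom S x (l1 ++ a :: l2) x (l1 ++ a :: a :: l2) (INR (Datatypes.S (length l1)))); auto.
    + rewrite last_app in *. now rewrite !last_cons in *.
    + rewrite !length_app. simpl. lia.
    + now apply ploop_in.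
    + split; [apply pos_INR|]. apply le_INR. rewrite length_app. simpl. lia.
    + intros t _. apply pl_dup.
Qed.

(** Moving the base vertex by one edge is the time shift by [/ n], where [n] is the number of
    edges. *)
Lemma rot_hom S x y l : pathL (seg_in S) (x :: y :: l ++ [x]) ->
  hom S (PL (x :: y :: l ++ [x])) (PL (y :: l ++ [x; y])).
Proof.
  intros Hp. cbn [PL app pathL] in *.
  set (m := l ++ [x]) in *. replace (l ++ [x; y]) with (m ++ [y]) by (unfold m; rewrite <- app_assoc; reflexivity).
  assert (Hm : last m y = x) by (unfold m; apply last_last).
  assert (Hl1 : last (y :: m) x = x) by now rewrite last_cons.
  assert (Hl2 : last (m ++ [y]) y = y) by apply last_last.
  set (n := INR (length (y :: m))).
  assert (Hn : n = INR (length m) + 1) by (unfold n; cbn [length]; apply S_INR).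
  assert (Hn0 := pos_INR (length m)).
  assert (Hnm : INR (length (m ++ [y])) = n) by (rewrite length_app, plus_INR; simpl; lra).
  assert (Heq : forall t, ploop y (m ++ [y]) t = ploop x (y :: m) (t + / n)).
  { intros t. set (u := t - IZR (flr t)). assert (Hu : 0 <= u < 1) by (unfold u; generalize (flr_spec t); lra).
    unfold ploop at 1. fold u. rewrite Hnm, pl_app, Hm.
    assert (Hin : 0 < / n <= 1).
    { split; [apply Rinv_0_lt_compat; lra|]. rewrite <- Rinv_1. apply Rinv_le_contravar; lra. }
    assert (Hnn : n * / n = 1) by (apply Rinv_r; lra).
    destruct (Rle_dec (u + / n) 1) as [Hle|Hgt].
    - replace (t + / n) with (IZR (flr t) + (u + / n)) by (unfold u; ring).
      rewrite ploop_at by (auto; lra). fold n. rewrite Rmult_plus_distr_l, Hnn.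
      assert (n * u <= n - 1) by nra.
      rewrite (pl_neg [y] x) by lra. cbn [pl]. rewrite clamp_big by nra.
      replace (n * u + 1 - 1) with (n * u) by ring. cring.
    - replace (t + / n) with (IZR (flr t + 1) + (u + / n - 1)) by (rewrite plus_IZR; unfold u; ring).
      rewrite ploop_at by (auto; lra). fold n.
      assert (n - 1 < n * u) by nra.
      rewrite pl_end by lra. rewrite Hm. cbn [pl].
      replace (n * (u + / n - 1)) with (n * u - INR (length m)) by (rewrite Hn in *; ring_simplify; nra).
      rewrite (pl_neg m y) by nra. cring. }
  destruct (hom_reparam S (ploop x (y :: m)) (fun t => t + / n)) as (H & HH).
  - now apply ploop_loop.
  - apply ploop_in; [discriminate|exact Hp].
  - cont.
  - intros t. ring.
  - exists H. destruct HH as (A1 & A2 & A3 & A4 & A5). repeat split; auto. intros t. rewrite Heq. auto.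
Qed.

Lemma all2_refl S l : forall a, path (seg_in S) a l -> all2 (quad_in S) a l a l.
Proof.
  induction l as [|b l IH]; simpl; auto. intros a [H1 H2]. split; auto.
  intros s r Hs Hr. match goal with |- S ?z => replace z with (a + RtoC s * (b - a))%C by ring end. auto.
Qed.
Lemma all2_app Q l1 : forall a a' b b' l2 l1' l2', length l1 = length l1' ->
  all2 Q a (l1 ++ [b]) a' (l1' ++ [b']) -> all2 Q b l2 b' l2' ->
  all2 Q a (l1 ++ b :: l2) a' (l1' ++ b' :: l2').
Proof.
  induction l1 as [|c l1 IH]; intros a a' b b' l2 [|c' l1'] l2' Hlen; simpl in *; try discriminate.
  - tauto.
  - intros [H1 H2] H3. split; auto.
Qed.

Lemma swap_hom S l1 a b b' c l2 : closedL (l1 ++ a :: b :: c :: l2) ->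
  pathL (seg_in S) (l1 ++ a :: b :: c :: l2) -> quad_in S a b a b' -> quad_in S b c b' c ->
  hom S (PL (l1 ++ a :: b :: c :: l2)) (PL (l1 ++ a :: b' :: c :: l2)).
Proof.
  intros Hc Hp Q1 Q2. destruct l1 as [|x l1]; cbn [app PL closedL pathL] in *; destruct Hc as [_ Hl].
  - cbn [path] in Hp. apply quad_hom; auto.
    + now rewrite !last_cons in *.
    + cbn [all2]. split; auto. split; auto. apply all2_refl. tauto.
  - apply quad_hom; auto.
    + rewrite last_app in *. now rewrite !last_cons in *.
    + destruct l1; discriminate.
    + rewrite path_app in Hp. cbn [path] in Hp. apply all2_app; auto.
      * apply all2_refl. tauto.
      * cbn [all2]. split; auto. split; auto. apply all2_refl. tauto.
Qed.

(** * Lattice paths as polygons in the plane *)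

Definition pos (k : R) (u : V) : C := ((IZR (fst u) + 1 / 2) / k, (IZR (snd u) + 1 / 2) / k).
(** For a positive integer [k] every point with integer coordinates, in particular every finite
    postcritical point, is the centre of a face. *)
Definition ctr (k : R) (F : V) : C := (IZR (fst F) / k, IZR (snd F) / k).
Definition away (k : R) (Pu : V -> Prop) (z : C) : Prop := forall F, Pu F -> z <> ctr k F.

(** Pairs of vertices that a segment joins without meeting a puncture. Besides edges, the moves of
    [peq] produce repeated vertices and diagonals of unpunctured squares. *)
Definition conn (Pu : V -> Prop) (u v : V) : Prop :=
  u = v \/ step u v \/ exists F, ~ Pu F /\ in_sq F u /\ in_sq F v.

Lemma IZR_half_neq (x y : Z) : IZR x + 1 / 2 <> IZR y.
Proof.
  intros H. assert (E1 : IZR (2 * x + 1) = IZR (2 * y)) by (rewrite plus_IZR, !mult_IZR; lra).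
  apply eq_IZR in E1. lia.
Qed.

Lemma square_away k Pu F z : 0 < k -> ~ Pu F ->
  IZR (fst F) - 1 / 2 <= k * fst z <= IZR (fst F) + 1 / 2 ->
  IZR (snd F) - 1 / 2 <= k * snd z <= IZR (snd F) + 1 / 2 -> away k Pu z.
Proof.
  intros Hk HF Hx Hy [a b] HP Hz. subst z. unfold ctr in *. simpl in *.
  replace (k * (IZR a / k)) with (IZR a) in Hx by (field; lra).
  replace (k * (IZR b / k)) with (IZR b) in Hy by (field; lra).
  destruct F as [x y]; simpl in *. apply HF.
  assert (a = x). { assert (IZR a < IZR (x + 1)) by (rewrite plus_IZR; lra). assert (IZR x < IZR (a + 1)) by (rewrite plus_IZR; lra).
    apply lt_IZR in H. apply lt_IZR in H0. lia. }
  assert (b = y). { assert (IZR b < IZR (y + 1)) by (rewrite plus_IZR; lra). assert (IZR y < IZR (b + 1)) by (rewrite plus_IZR; lra).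
    apply lt_IZR in H0. apply lt_IZR in H1. lia. }
  now subst.
Qed.

Lemma in_sq_pos k F u : 0 < k -> in_sq F u ->
  IZR (fst F) - 1 / 2 <= k * fst (pos k u) <= IZR (fst F) + 1 / 2 /\
  IZR (snd F) - 1 / 2 <= k * snd (pos k u) <= IZR (snd F) + 1 / 2.
Proof.
  intros Hk [H1 H2]. unfold pos; simpl.
  replace (k * ((IZR (fst u) + 1 / 2) / k)) with (IZR (fst u) + 1 / 2) by (field; lra).
  replace (k * ((IZR (snd u) + 1 / 2) / k)) with (IZR (snd u) + 1 / 2) by (field; lra).
  destruct H1 as [-> | ->], H2 as [-> | ->]; rewrite ?minus_IZR; lra.
Qed.

Lemma conv2 lo hi a b s : lo <= a <= hi -> lo <= b <= hi -> 0 <= s <= 1 -> lo <= a + s * (b - a) <= hi.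
Proof. intros. nra. Qed.

Lemma quad_square k Pu F a b a' b' : 0 < k -> ~ Pu F -> in_sq F a -> in_sq F b -> in_sq F a' -> in_sq F b' ->
  quad_in (away k Pu) (pos k a) (pos k b) (pos k a') (pos k b').
Proof.
  intros Hk HF Ha Hb Ha' Hb' s r Hs Hr.
  apply (in_sq_pos k F) in Ha, Hb, Ha', Hb'; auto.
  apply (square_away k Pu F); auto.
  - match goal with |- _ <= ?t <= _ => replace t with ((k * fst (pos k a) + s * (k * fst (pos k b) - k * fst (pos k a))) +
      r * ((k * fst (pos k a') + s * (k * fst (pos k b') - k * fst (pos k a'))) -
           (k * fst (pos k a) + s * (k * fst (pos k b) - k * fst (pos k a)))))
      by (unfold Cminus, Cplus, Cmult, Copp, RtoC; cbn [fst snd]; ring) end.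
    apply conv2; auto; apply conv2; tauto.
  - match goal with |- _ <= ?t <= _ => replace t with ((k * snd (pos k a) + s * (k * snd (pos k b) - k * snd (pos k a))) +
      r * ((k * snd (pos k a') + s * (k * snd (pos k b') - k * snd (pos k a'))) -
           (k * snd (pos k a) + s * (k * snd (pos k b) - k * snd (pos k a)))))
      by (unfold Cminus, Cplus, Cmult, Copp, RtoC; cbn [fst snd]; ring) end.
    apply conv2; auto; apply conv2; tauto.
Qed.

(** At mesh [1 / k] an edge has one constant coordinate that is half an odd integer, whereas centres
    have integer ones; a diagonal stays in a closed square whose only centre is unpunctured. *)
Lemma seg_conn k Pu u v : 0 < k -> conn Pu u v -> seg_in (away k Pu) (pos k u) (pos k v).
Proof.
  intros Hk H s Hs. destruct H as [->|[H|(F & HF & Hu & Hv)]].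
  - intros F _ He. replace (pos k v + RtoC s * (pos k v - pos k v))%C with (pos k v) in He by ring.
    unfold pos, ctr in He. injection He as H1 _. apply (IZR_half_neq (fst v) (fst F)).
    apply (Rmult_eq_reg_r (/ k)); [exact H1|]. apply Rinv_neq_0_compat. lra.
  - intros F _ He. unfold pos, ctr, Cminus, Cplus, Cmult, Copp, RtoC in He.
    destruct u as [x y]. destruct H as [->|[->|[->| ->]]]; cbn [fst snd] in He; injection He as H1 H2.
    + apply (IZR_half_neq y (snd F)). apply (Rmult_eq_reg_r (/ k)); [|apply Rinv_neq_0_compat; lra].
      unfold Rdiv in H2. rewrite <- H2, ?plus_IZR, ?minus_IZR. unfold Rdiv. ring.
    + apply (IZR_half_neq y (snd F)). apply (Rmult_eq_reg_r (/ k)); [|apply Rinv_neq_0_compat; lra].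
      unfold Rdiv in H2. rewrite <- H2, ?plus_IZR, ?minus_IZR. unfold Rdiv. ring.
    + apply (IZR_half_neq x (fst F)). apply (Rmult_eq_reg_r (/ k)); [|apply Rinv_neq_0_compat; lra].
      unfold Rdiv in H1. rewrite <- H1, ?plus_IZR, ?minus_IZR. unfold Rdiv. ring.
    + apply (IZR_half_neq x (fst F)). apply (Rmult_eq_reg_r (/ k)); [|apply Rinv_neq_0_compat; lra].
      unfold Rdiv in H1. rewrite <- H1, ?plus_IZR, ?minus_IZR. unfold Rdiv. ring.
  - assert (Q := quad_square k Pu F u v u v Hk HF Hu Hv Hu Hv s 0 Hs ltac:(lra)).
    match type of Q with away _ _ ?z => replace z with (pos k u + RtoC s * (pos k v - pos k u))%C in Q by ring end.
    exact Q.
Qed.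

Lemma path_map {T T'} (h : T -> T') (R : T -> T -> Prop) (R' : T' -> T' -> Prop) l : forall a,
  (forall u v, R u v -> R' (h u) (h v)) -> path R a l -> path R' (h a) (map h l).
Proof. induction l; simpl; auto. intros b H [H1 H2]; auto. Qed.
Lemma pathL_map {T T'} (h : T -> T') (R : T -> T -> Prop) (R' : T' -> T' -> Prop) L :
  (forall u v, R u v -> R' (h u) (h v)) -> pathL R L -> pathL R' (map h L).
Proof. destruct L; simpl; auto. intros; now apply path_map with (R := R). Qed.
Lemma last_map {T T'} (h : T -> T') l : forall a, last (map h l) (h a) = h (last l a).
Proof. induction l; intros b; auto. cbn [map]. now rewrite !last_cons. Qed.
Lemma closedL_map {T T'} (h : T -> T') L : closedL L -> closedL (map h L).
Proof.
  destruct L as [|a l]; simpl; auto. intros [H1 H2]. rewrite last_map, H2. split; auto. now destruct l.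
Qed.
Lemma pathL_app {T} (R : T -> T -> Prop) l1 a l2 :
  pathL R (l1 ++ a :: l2) <-> pathL R (l1 ++ [a]) /\ path R a l2.
Proof.
  destruct l1 as [|b l1]; simpl; [tauto|]. apply path_app.
Qed.

Definition same_ends {T} (L L' : list T) : Prop := (forall d, hd d L = hd d L') /\ forall d, last L d = last L' d.
(** Unlike [closedL] this admits the path with a single vertex, which is what a contracted cycle
    becomes. *)
Definition closed' {T} (L : list T) : Prop := exists a, forall d, hd d L = a /\ last L d = a.

Lemma conn_sym Pu u v : conn Pu u v -> conn Pu v u.
Proof.
  intros [->|[H|(F & H1 & H2 & H3)]]; [now left|right; left; now apply step_sym|].
  right; right. exists F; auto.
Qed.

Lemma PL_const_hom S a : S a -> hom S (PL [a]) (PL [a; a]).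
Proof.
  intros H. apply hom_line.
  - now apply ploop_loop.
  - now apply ploop_loop.
  - intros s t _. cbn [PL]. unfold ploop. simpl.
    match goal with |- S ?z => replace z with a by cring end. auto.
Qed.

Lemma closed'_cases {T} (L : list T) : L <> [] -> closed' L -> closedL L \/ exists a, L = [a].
Proof.
  destruct L as [|a [|b l]]; intros H [c Hc]; try tauto; eauto.
  left. simpl. split; [discriminate|]. destruct (Hc a) as [H1 H2]. simpl in H1. subst c.
  change (last (b :: l) a = a). rewrite last_cons in H2. exact H2.
Qed.
Lemma last_app_cons {T} l1 (a : T) l2 d : last (l1 ++ a :: l2) d = last l2 a.
Proof. now rewrite last_app, last_cons. Qed.
Lemma hd_app_cons {T} l1 (a : T) l2 l2' d : hd d (l1 ++ a :: l2) = hd d (l1 ++ a :: l2').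
Proof. now destruct l1. Qed.

Lemma in_pos_away k Pu u : 0 < k -> away k Pu (pos k u).
Proof.
  intros Hk. assert (H := seg_conn k Pu u u Hk (or_introl eq_refl) 0 ltac:(lra)).
  match type of H with away _ _ ?z => replace z with (pos k u) in H by ring end. exact H.
Qed.

Lemma dup_hom' k Pu l1 a l2 : 0 < k -> closed' (l1 ++ a :: l2) -> pathL (conn Pu) (l1 ++ a :: l2) ->
  hom (away k Pu) (PL (map (pos k) (l1 ++ a :: l2))) (PL (map (pos k) (l1 ++ a :: a :: l2))).
Proof.
  intros Hk Hc Hp. destruct (closed'_cases (l1 ++ a :: l2)) as [H|[b Hb]]; auto.
  - now destruct l1.
  - rewrite !map_app. cbn [map]. apply dup_hom.
    + apply (closedL_map (pos k)) in H. now rewrite map_app in H.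
    + apply (pathL_map (pos k) _ (seg_in (away k Pu))) in Hp; [|intros; now apply seg_conn]. now rewrite map_app in Hp.
  - destruct l1 as [|c [|? ?]]; simpl in Hb; injection Hb as -> Hb; try discriminate. subst.
    apply PL_const_hom. now apply in_pos_away.
Qed.

Lemma swap_hom' k Pu l1 a b b' c l2 : 0 < k -> closed' (l1 ++ a :: b :: c :: l2) ->
  pathL (conn Pu) (l1 ++ a :: b :: c :: l2) ->
  quad_in (away k Pu) (pos k a) (pos k b) (pos k a) (pos k b') ->
  quad_in (away k Pu) (pos k b) (pos k c) (pos k b') (pos k c) ->
  hom (away k Pu) (PL (map (pos k) (l1 ++ a :: b :: c :: l2))) (PL (map (pos k) (l1 ++ a :: b' :: c :: l2))).
Proof.
  intros Hk Hc Hp Q1 Q2. destruct (closed'_cases (l1 ++ a :: b :: c :: l2)) as [H|[d Hd]]; auto.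
  - now destruct l1.
  - rewrite !map_app. cbn [map]. apply swap_hom; auto.
    + apply (closedL_map (pos k)) in H. now rewrite map_app in H.
    + apply (pathL_map (pos k) _ (seg_in (away k Pu))) in Hp; [|intros; now apply seg_conn]. now rewrite map_app in Hp.
  - destruct l1 as [|? [|? ?]]; discriminate.
Qed.

Lemma closed'_ends {T} (L L' : list T) : same_ends L L' -> closed' L -> closed' L'.
Proof. intros [H1 H2] [a Ha]. exists a. intros d. now rewrite <- H1, <- H2. Qed.

(** Ends, admissible segments and homotopy are treated in one induction, because the symmetric and
    transitive cases need the hypotheses for the other path. *)
Lemma peq_sound k Pu L L' : 0 < k -> peq Pu L L' ->
  same_ends L L' /\ (pathL (conn Pu) L <-> pathL (conn Pu) L') /\
  (pathL (conn Pu) L -> closed' L -> L <> [] -> hom (away k Pu) (PL (map (pos k) L)) (PL (map (pos k) L'))) /\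
  (L = [] <-> L' = []).
Proof.
  intros Hk. induction 1 as [l|l l' H IH|l l' l'' H1 IH1 H2 IH2|l1 a l2|l1 a b l2 Hs|l1 a b c d F l2 HF Ha Hb Hc Hd].
  - repeat split; auto. intros Hp Hc Hne. apply hom_refl.
    + destruct l as [|a l]; [tauto|]. cbn [map PL]. apply ploop_loop. rewrite last_map.
      destruct Hc as [b Hb]. destruct (Hb a) as [E1 E2]. simpl in E1. subst b. rewrite last_cons in E2. now rewrite E2.
    + destruct (closed'_cases l Hne Hc) as [Hcl|[a ->]].
      * destruct l as [|a l]; [tauto|]. cbn [map PL]. apply ploop_in.
        -- destruct Hcl. now destruct l.
        -- apply (path_map (pos k) (conn Pu)); auto. intros; now apply seg_conn.
      * intros t. apply in_pos_away; auto.
  - destruct IH as (E1 & E2 & E3 & E4). destruct E1 as [E5 E6].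
    split; [split; intros; symmetry; auto|]. split; [tauto|]. split; [|tauto].
    intros Hp Hc Hne. apply hom_sym, E3; [tauto| |tauto].
    apply (closed'_ends l'); auto. split; intros; symmetry; auto.
  - destruct IH1 as (E1 & E2 & E3 & E4), IH2 as (D1 & D2 & D3 & D4).
    split; [destruct E1 as [X1 X2], D1 as [X3 X4]; split; intros; [now rewrite X1|now rewrite X2]|].
    split; [tauto|]. split; [|tauto]. intros Hp Hc Hne. apply (hom_trans _ _ (PL (map (pos k) l'))); auto.
    apply D3; [tauto| |tauto]. now apply (closed'_ends l).
  - assert (Hends : same_ends (l1 ++ a :: a :: l2) (l1 ++ a :: l2)).
    { split; intros d; [apply hd_app_cons|]. now rewrite !last_app_cons, last_cons. }
    assert (Hpath : pathL (conn Pu) (l1 ++ a :: a :: l2) <-> pathL (conn Pu) (l1 ++ a :: l2)).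
    { rewrite (pathL_app _ l1 a (a :: l2)), (pathL_app _ l1 a l2). cbn [path]. unfold conn at 2. tauto. }
    split; auto. split; auto. split.
    + intros Hp Hc _. apply hom_sym, dup_hom'; auto; [|tauto]. now apply (closed'_ends (l1 ++ a :: a :: l2)).
    + split; destruct l1; discriminate.
  - assert (Hends : same_ends (l1 ++ a :: b :: a :: l2) (l1 ++ a :: l2)).
    { split; intros d; [apply hd_app_cons|]. now rewrite !last_app_cons, !last_cons. }
    assert (Hab : conn Pu a b) by (right; left; auto). assert (Hba := conn_sym _ _ _ Hab).
    assert (Haa : conn Pu a a) by now left.
    assert (Hpath : pathL (conn Pu) (l1 ++ a :: b :: a :: l2) <-> pathL (conn Pu) (l1 ++ a :: l2)).
    { rewrite (pathL_app _ l1 a (b :: a :: l2)), (pathL_app _ l1 a l2). cbn [path]. tauto. }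
    split; auto. split; auto. split.
    + intros Hp Hc _.
      assert (Hcl : closed' (l1 ++ a :: l2)) by now apply (closed'_ends (l1 ++ a :: b :: a :: l2)).
      (* The tip [b] of the spur is drawn back to [a], and the repeated vertices are then
         removed. *)
      apply (hom_trans _ _ (PL (map (pos k) (l1 ++ a :: a :: a :: l2)))).
      * apply swap_hom'; auto.
        -- intros s r Hs0 Hr. assert (G := seg_conn k Pu a b Hk Hab (s * (1 - r)) ltac:(nra)).
           match type of G with away _ _ ?z => match goal with |- away _ _ ?w => replace w with z; [exact G|] end end.
           rewrite RtoC_mult, RtoC_minus. ring.
        -- intros s r Hs0 Hr. assert (G := seg_conn k Pu b a Hk Hba (s + r - s * r) ltac:(nra)).
           match type of G with away _ _ ?z => match goal with |- away _ _ ?w => replace w with z; [exact G|] end end.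
           rewrite RtoC_minus, RtoC_plus, RtoC_mult. ring.
      * apply hom_sym. apply (hom_trans _ _ (PL (map (pos k) (l1 ++ a :: a :: l2)))).
        -- apply dup_hom'; auto. tauto.
        -- apply dup_hom'; auto.
           ++ apply (closed'_ends (l1 ++ a :: l2)); auto.
              split; intros d; [apply hd_app_cons|]. now rewrite !last_app_cons, !last_cons.
           ++ rewrite (pathL_app _ l1 a (a :: l2)). cbn [path]. rewrite Hpath, (pathL_app _ l1 a l2) in Hp. tauto.
    + split; destruct l1; discriminate.
  - assert (Hends : same_ends (l1 ++ a :: b :: c :: l2) (l1 ++ a :: d :: c :: l2)).
    { split; intros x; [apply hd_app_cons|]. now rewrite !last_app_cons, !last_cons. }
    assert (Hcn : forall u v, in_sq F u -> in_sq F v -> conn Pu u v) by (intros u v H1 H2; right; right; exists F; auto).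
    assert (H1 := Hcn a b Ha Hb). assert (H2 := Hcn b c Hb Hc). assert (H3 := Hcn a d Ha Hd). assert (H4 := Hcn d c Hd Hc).
    assert (Hpath : pathL (conn Pu) (l1 ++ a :: b :: c :: l2) <-> pathL (conn Pu) (l1 ++ a :: d :: c :: l2)).
    { rewrite (pathL_app _ l1 a (b :: c :: l2)), (pathL_app _ l1 a (d :: c :: l2)). cbn [path]. tauto. }
    split; auto. split; auto. split.
    + intros Hp Hcl _. apply swap_hom'; auto; now apply (quad_square k Pu F).
    + split; destruct l1; discriminate.
Qed.

(** A rotation moves the ends, so being closed takes the place of having the same ends in the
    invariant. *)
Lemma freeq_sound k Pu L L' : 0 < k -> freeq Pu L L' ->
  (closed' L <-> closed' L') /\ (pathL (conn Pu) L /\ closed' L <-> pathL (conn Pu) L' /\ closed' L') /\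
  (pathL (conn Pu) L -> closed' L -> L <> [] -> hom (away k Pu) (PL (map (pos k) L)) (PL (map (pos k) L'))) /\
  (L = [] <-> L' = []).
Proof.
  intros Hk. induction 1 as [l l' H|l l' H IH|l l' l'' H1 IH1 H2 IH2|x y l].
  - destruct (peq_sound k Pu l l' Hk H) as (E1 & E2 & E3 & E4).
    assert (Hcl : closed' l <-> closed' l').
    { split; apply closed'_ends; auto. destruct E1; split; intros; symmetry; auto. }
    split; auto. split; [tauto|]. split; auto.
  - destruct IH as (E1 & E2 & E3 & E4). split; [tauto|]. split; [tauto|]. split; [|tauto].
    intros Hp Hc Hne. apply hom_sym, E3; tauto.
  - destruct IH1 as (E1 & E2 & E3 & E4), IH2 as (D1 & D2 & D3 & D4).
    split; [tauto|]. split; [tauto|]. split; [|tauto].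
    intros Hp Hc Hne. apply (hom_trans _ _ (PL (map (pos k) l'))); [apply E3; tauto|apply D3; tauto].
  - assert (C1 : closed' (x :: y :: l ++ [x])).
    { exists x. intros d. split; auto. rewrite !last_cons. apply last_last. }
    assert (C2 : closed' (y :: l ++ [x; y])).
    { exists y. intros d. split; auto. rewrite last_cons. change (l ++ [x; y]) with (l ++ [x] ++ [y]).
      rewrite app_assoc. apply last_last. }
    assert (Hpath : pathL (conn Pu) (x :: y :: l ++ [x]) <-> pathL (conn Pu) (y :: l ++ [x; y])).
    { cbn [pathL path]. rewrite (path_app _ l y x [y]). cbn [path]. tauto. }
    split; [tauto|]. split; [tauto|]. split; [|split; discriminate].
    intros Hp _ _. cbn [map]. rewrite !map_app. cbn [map]. apply rot_hom.
    apply (pathL_map (pos k) _ (seg_in (away k Pu))) in Hp; [|intros; now apply seg_conn].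
    cbn [map] in Hp. now rewrite map_app in Hp.
Qed.

(** * Winding numbers of lattice polygons *)

Lemma lift_up x y : 0 < y -> lift (PI / 2 - atan (x / y)) (x, y).
Proof.
  intros Hy. replace (x, y) with (Cmult Ci (y, - x)) by (unfold Ci, Cmult; simpl; f_equal; ring).
  unfold Rminus. apply lift_mult.
  - unfold lift, cis. rewrite cos_PI2, sin_PI2, Cmod_Ci. unfold Ci, Cmult, RtoC; simpl. f_equal; ring.
  - rewrite <- atan_opp. replace (- (x / y)) with (- x / y) by (field; lra).
    apply (lift_arg (y, - x)). exact Hy.
Qed.
Lemma lift_opp a z : lift a z -> lift (a + PI) (- z)%C.
Proof. unfold lift. intros H. rewrite Cmod_opp, cis_PI. rewrite H at 1. ring. Qed.
Lemma lift_down x y : y < 0 -> lift (3 * PI / 2 - atan (x / y)) (x, y).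
Proof.
  intros Hy. assert (H := lift_opp _ _ (lift_up (- x) (- y) ltac:(lra))).
  replace (Copp (- x, - y)) with ((x, y) : C) in H by (unfold Copp; simpl; f_equal; ring).
  replace (3 * PI / 2 - atan (x / y)) with (PI / 2 - atan (- x / - y) + PI); auto.
  replace (- x / - y) with (x / y) by (field; lra). field.
Qed.
Lemma lift_right x y : 0 < x -> lift (atan (y / x)) (x, y).
Proof. intros H. apply (lift_arg (x, y)). exact H. Qed.
Lemma lift_left x y : x < 0 -> lift (atan (y / x) + PI) (x, y).
Proof.
  intros Hx. assert (H := lift_opp _ _ (lift_right (- x) (- y) ltac:(lra))).
  replace (Copp (- x, - y)) with ((x, y) : C) in H by (unfold Copp; simpl; f_equal; ring).
  replace (- y / - x) with (y / x) in H by (field; lra). exact H.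
Qed.
Lemma lift_2PI a z (n : Z) : lift a z -> lift (a + 2 * PI * IZR n) z.
Proof. unfold lift. now rewrite cis_2PI. Qed.

Lemma atan_swap_pos x y : 0 < y / x -> atan (y / x) = PI / 2 - atan (x / y).
Proof.
  intros H. assert (Hy : y <> 0) by (intros ->; unfold Rdiv in H; rewrite Rmult_0_l in H; lra).
  assert (Hx : x <> 0) by (intros ->; unfold Rdiv in H; rewrite Rinv_0, Rmult_0_r in H; lra).
  replace (x / y) with (/ (y / x)) by (field; auto). rewrite atan_inv by auto. lra.
Qed.
Lemma atan_swap_neg x y : y / x < 0 -> atan (y / x) = - PI / 2 - atan (x / y).
Proof.
  intros H. assert (Hy : y <> 0) by (intros ->; unfold Rdiv in H; rewrite Rmult_0_l in H; lra).
  assert (Hx : x <> 0) by (intros ->; unfold Rdiv in H; rewrite Rinv_0, Rmult_0_r in H; lra).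
  assert (H' := atan_swap_pos (- x) y). replace (y / - x) with (- (y / x)) in H' by (field; auto).
  replace (- x / y) with (- (x / y)) in H' by (field; auto). rewrite !atan_opp in H'.
  specialize (H' ltac:(lra)). lra.
Qed.
Lemma div_sign_pos x y : 0 < x * y -> 0 < y / x.
Proof.
  intros H. assert (x <> 0) by (intros ->; lra). replace (y / x) with (x * y * (/ x * / x)) by (field; auto).
  apply Rmult_lt_0_compat; auto. assert (/ x <> 0) by now apply Rinv_neq_0_compat. nra.
Qed.
Lemma div_sign_neg x y : x * y < 0 -> y / x < 0.
Proof.
  intros H. assert (G := div_sign_pos x (- y) ltac:(lra)). assert (x <> 0) by (intros ->; lra).
  replace (- y / x) with (- (y / x)) in G by (field; auto). lra.
Qed.

(** Argument normalised to lie between 0 and [2 * PI], with its jump on the positive horizontal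
    axis, the ray counted by [cross]. The case [y = 0] does not arise, as [rely] is half an odd
    integer. *)
Definition angle (x y : R) : R := if Rlt_dec 0 y then PI / 2 - atan (x / y) else 3 * PI / 2 - atan (x / y).
Definition relx (F u : V) : R := IZR (fst u) + 1 / 2 - IZR (fst F).
Definition rely (F u : V) : R := IZR (snd u) + 1 / 2 - IZR (snd F).
Definition vangle (F u : V) : R := angle (relx F u) (rely F u).

Lemma half_cases (x a : Z) : IZR x + 1 / 2 - IZR a <= - (1 / 2) /\ (x <= a - 1)%Z \/ 1 / 2 <= IZR x + 1 / 2 - IZR a /\ (a <= x)%Z.
Proof.
  destruct (Z_le_gt_dec a x) as [H|H]; [right|left]; split; auto; try lia.
  - apply IZR_le in H. lra.
  - assert (H' : (x + 1 <= a)%Z) by lia. apply IZR_le in H'. rewrite plus_IZR in H'. lra.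
Qed.

Definition lstep (u v : V) : Prop := u = v \/ step u v.

(** A continuous argument that starts at the normalised angle of [a] ends at that of [b], unless the
    edge crosses the ray where the normalisation jumps by [2 * PI]; [cross] records this jump with
    its sign. *)
Lemma edge_angle_scaled F a b : lstep a b -> exists om : R -> R, contR om /\
  (forall s, 0 <= s <= 1 -> lift (om s) (relx F a + s * (relx F b - relx F a), rely F a + s * (rely F b - rely F a))) /\
  om 0 = vangle F a /\ om 1 = vangle F b + 2 * PI * IZR (cross F a b).
Proof.
  intros Hs. destruct F as [p r], a as [x y], b as [x' y'].
  assert (Hcase : y' = y \/ (x' = x /\ (y' = y + 1 \/ y' = y - 1)%Z)).
  { destruct Hs as [Hs|[Hs|[Hs|[Hs|Hs]]]]; injection Hs; auto. }
  unfold vangle, relx, rely; cbn [fst snd].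
  destruct Hcase as [-> |[-> Hy]].
  - assert (Hcr : cross (p, r) (x, y) (x', y) = 0%Z) by (unfold cross; simpl; zcase).
    rewrite Hcr. set (X := IZR x + 1 / 2 - IZR p). set (X' := IZR x' + 1 / 2 - IZR p). set (Y := IZR y + 1 / 2 - IZR r).
    assert (HY : Y <> 0) by (destruct (half_cases y r) as [[? _]|[? _]]; unfold Y; lra).
    exists (fun s => (if Rlt_dec 0 Y then PI / 2 else 3 * PI / 2) - atan ((X + s * (X' - X)) / Y)).
    split; [|split; [|split]].
    + unfold Rdiv. cont.
    + intros s _. replace (Y + s * (Y - Y)) with Y by ring. destruct (Rlt_dec 0 Y).
      * now apply lift_up. * apply lift_down. lra.
    + unfold angle. replace (X + 0 * (X' - X)) with X by ring. now destruct (Rlt_dec 0 Y).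
    + unfold angle. replace (X + 1 * (X' - X)) with X' by ring. destruct (Rlt_dec 0 Y); ring.
  - set (X := IZR x + 1 / 2 - IZR p). set (Y := IZR y + 1 / 2 - IZR r). set (Y' := IZR y' + 1 / 2 - IZR r).
    destruct (half_cases x p) as [[HX Hxp]|[HX Hxp]]; fold X in HX.
    + assert (Hcr : cross (p, r) (x, y) (x, y') = 0%Z) by (unfold cross; simpl; zcase). rewrite Hcr.
      assert (Hang : forall z, (z <= - (1 / 2) \/ 1 / 2 <= z) -> atan (z / X) + PI = angle X z).
      { intros z Hz. unfold angle. destruct (Rlt_dec 0 z).
        - rewrite atan_swap_neg by (apply div_sign_neg; nra). field.
        - rewrite atan_swap_pos by (apply div_sign_pos; nra). field. }
      exists (fun s => atan ((Y + s * (Y' - Y)) / X) + PI). split; [|split; [|split]].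
      * unfold Rdiv. cont.
      * intros s _. replace (X + s * (X - X)) with X by ring. apply lift_left. lra.
      * replace (Y + 0 * (Y' - Y)) with Y by ring. apply Hang. unfold Y. destruct (half_cases y r); tauto.
      * replace (Y + 1 * (Y' - Y)) with Y' by ring. rewrite Hang; [ring|]. unfold Y'. destruct (half_cases y' r); tauto.
    + set (c := if Z_lt_dec y r then 1%Z else 0%Z).
      assert (Hang : forall z, (z <= - (1 / 2) \/ 1 / 2 <= z) -> atan (z / X) = angle X z - 2 * PI * (if Rlt_dec 0 z then 0 else 1)).
      { intros z Hz. unfold angle. destruct (Rlt_dec 0 z).
        - rewrite atan_swap_pos by (apply div_sign_pos; nra). field.
        - rewrite atan_swap_neg by (apply div_sign_neg; nra). field. }
      assert (HY : (Y <= - (1 / 2) /\ c = 1%Z) \/ (1 / 2 <= Y /\ c = 0%Z)).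
      { unfold c. unfold Y. destruct (half_cases y r) as [[? ?]|[? ?]]; destruct Z_lt_dec; auto; lia. }
      assert (HY' : (Y' <= - (1 / 2) /\ cross (p, r) (x, y) (x, y') = (c - 1)%Z) \/
                    (1 / 2 <= Y' /\ cross (p, r) (x, y) (x, y') = c)).
      { unfold c. unfold Y'. destruct (half_cases y' r) as [[? ?]|[? ?]]; [left|right]; split; auto;
        unfold cross; cbn [fst snd]; destruct Z_lt_dec; zcase. }
      exists (fun s => atan ((Y + s * (Y' - Y)) / X) + 2 * PI * IZR c). split; [|split; [|split]].
      * unfold Rdiv. cont.
      * intros s _. replace (X + s * (X - X)) with X by ring. apply lift_2PI, lift_right. lra.
      * replace (Y + 0 * (Y' - Y)) with Y by ring. rewrite Hang by tauto.
        destruct HY as [[HY ->]|[HY ->]]; destruct (Rlt_dec 0 Y); try lra; simpl; ring.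
      * replace (Y + 1 * (Y' - Y)) with Y' by ring. rewrite Hang by tauto.
        destruct HY' as [[HY2 ->]|[HY2 ->]]; destruct (Rlt_dec 0 Y'); try lra; rewrite ?minus_IZR; simpl; ring.
Qed.

Lemma edge_angle k F a b : 0 < k -> lstep a b -> exists om : R -> R, contR om /\
  (forall s, lift (om s) (pos k a + RtoC (clamp s) * (pos k b - pos k a) - ctr k F)%C) /\
  (forall s, s <= 0 -> om s = vangle F a) /\
  (forall s, 1 <= s -> om s = vangle F b + 2 * PI * IZR (cross F a b)).
Proof.
  intros Hk Hs. destruct (edge_angle_scaled F a b Hs) as (om & H1 & H2 & H3 & H4).
  exists (fun s => om (clamp s)). split; [|split; [|split]].
  - cont.
  - intros s. apply (lift_scal k); auto. assert (H := H2 (clamp s) (clamp_range s)).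
    match type of H with lift _ ?z => match goal with |- lift _ ?w => replace w with z; auto end end.
    unfold pos, ctr, relx, rely, Cminus, Cplus, Cmult, Copp, RtoC. cbn [fst snd]. f_equal; field; lra.
  - intros s Hs0. now rewrite clamp_neg.
  - intros s Hs0. now rewrite clamp_big.
Qed.

Lemma pl_angle k F l : 0 < k -> forall a, path lstep a l -> exists th : R -> R, contR th /\
  (forall t, lift (th t) (pl (pos k a) (map (pos k) l) t - ctr k F)%C) /\
  (forall t, t <= 0 -> th t = vangle F a) /\
  (forall t, INR (length l) <= t -> th t = vangle F (last l a) + 2 * PI * IZR (psum (cross F) a l)).
Proof.
  intros Hk. induction l as [|b l IH]; intros a Hp.
  - exists (fun _ => vangle F a). split; [cont|]. split; [|split].
    + intros t. destruct (edge_angle k F a a Hk) as (om & _ & H2 & H3 & _); [now left|].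
      rewrite <- (H3 0) by lra. specialize (H2 0). rewrite clamp_neg in H2 by lra. cbn [map pl].
      match type of H2 with lift _ ?z => match goal with |- lift _ ?w => replace w with z by ring end end. auto.
    + auto.
    + intros t _. simpl. ring.
  - destruct Hp as [Hab Hp]. destruct (IH b Hp) as (th & T1 & T2 & T3 & T4).
    destruct (edge_angle k F a b Hk Hab) as (om & O1 & O2 & O3 & O4).
    exists (fun t => om t + (th (t - 1) - vangle F b)). split; [|split; [|split]].
    + cont.
    + intros t. cbn [map pl]. destruct (Rle_dec t 1).
      * rewrite T3 by lra. rewrite pl_neg by lra. specialize (O2 t).
        match type of O2 with lift _ ?z => match goal with |- lift _ ?w => replace w with z by ring end end.
        replace (om t + (vangle F b - vangle F b)) with (om t) by ring. auto.
      * rewrite O4, clamp_big by lra. specialize (T2 (t - 1)).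
        match type of T2 with lift _ ?z => match goal with |- lift _ ?w => replace w with z by ring end end.
        match goal with |- lift ?w _ => replace w with (th (t - 1) + 2 * PI * IZR (cross F a b)) by ring end.
        now apply lift_2PI.
    + intros t Ht. rewrite O3, T3 by lra. ring.
    + intros t Ht. cbn [length] in Ht. rewrite S_INR in Ht. assert (Hl := pos_INR (length l)).
      rewrite O4, T4 by lra. rewrite last_cons. cbn [psum]. rewrite plus_IZR. ring.
Qed.

(** The bridge between the two notions: the analytic winding number of a lattice polygon is its
    combinatorial crossing number. *)
Lemma wind_PL k F a l : 0 < k -> path lstep a l -> last l a = a ->
  wind (PL (map (pos k) (a :: l))) (ctr k F) (psum (cross F) a l).
Proof.
  intros Hk Hp Hl. destruct (pl_angle k F l Hk a Hp) as (th & T1 & T2 & T3 & T4).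
  set (n := INR (length l)). assert (Hn := pos_INR (length l)). fold n in Hn.
  set (c := 2 * PI * IZR (psum (cross F) a l)).
  exists (fun t => th (n * (t - IZR (flr t))) + c * IZR (flr t)). split; [|split].
  - apply (floor_ext_cont (fun u => th (n * u)) c).
    + cont.
    + rewrite (T4 (n * 1)) by (unfold n; lra). rewrite (T3 (n * 0)) by lra. rewrite Hl. reflexivity.
  - intros t. cbn [map PL]. unfold ploop. rewrite length_map. fold n.
    unfold c. rewrite Rmult_assoc, <- mult_IZR. apply lift_2PI, T2.
  - intros t. rewrite flr_add1, plus_IZR.
    replace (t + 1 - (IZR (flr t) + 1)) with (t - IZR (flr t)) by ring. unfold c. ring.
Qed.

(** * Lattice approximation of simple loops *)

Lemma unif_cont g eps : loop g -> eps > 0 -> exists d, d > 0 /\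
  forall s t, Rabs (s - t) < d -> Cmod (g s - g t)%C < eps.
Proof.
  intros [Hc Hp] He.
  destruct (lebesgue_segment (fun s d => forall t, Rabs (t - s) < d -> Cmod (g t - g s)%C < eps)) as (d & Hd & Hd').
  - intros s Hs. destruct (contC_near g s (eps / 2) Hc ltac:(lra)) as [d Hd]. assert (Hdp := cond_pos d).
    exists (d / 2). split; [lra|]. intros s' Hs' t Ht.
    assert (A1 : Cmod (g s' - g s)%C < eps / 2). { apply Hd. change (Rabs (s' - s) < d). lra. }
    assert (A2 : Cmod (g t - g s)%C < eps / 2).
    { apply Hd. change (Rabs (t - s) < d). replace (t - s) with ((t - s') + (s' - s)) by ring.
      eapply Rle_lt_trans; [apply Rabs_triang|]. lra. }
    replace (g t - g s')%C with ((g t - g s) + - (g s' - g s))%C by ring.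
    eapply Rle_lt_trans; [apply Cmod_triangle|]. rewrite Cmod_opp. lra.
  - intros s d d' Hd H t Ht. apply H. lra.
  - exists d. split; auto. intros s t Hst. destruct (reduce_unit t) as (n & v & Hv & ->).
    replace s with ((s - IZR n) + IZR n) by ring. rewrite !(periodic_Z g Hp). apply Hd'; [lra|].
    replace (s - IZR n - v) with (s - (v + IZR n)) by ring. exact Hst.
Qed.

(** Compactness makes injectivity uniform: nearby values come from parameters that are nearby modulo
    1. *)
Lemma unif_inj g d : simple_loop g -> d > 0 -> exists eta, eta > 0 /\
  forall s t, Cmod (g s - g t)%C < eta -> exists n : Z, Rabs (s - t - IZR n) < d.
Proof.
  intros Hs Hd. assert (Hl : loop g) by (apply simple_loop_iff in Hs; tauto).
  destruct (lebesgue_square (fun s t e => Cmod (g s - g t)%C < e -> exists n : Z, Rabs (s - t - IZR n) < d)) as (e & He & He').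
  - intros s t _ _. destruct (classic (g s = g t)) as [Hg|Hg].
    + destruct (simple_loop_inj g s t Hs Hg) as [n ->]. exists (d / 2). split; [lra|].
      intros s' t' H1 H2 _. exists n. replace (s' - t' - IZR n) with ((s' - (t + IZR n)) - (t' - t)) by ring.
      eapply Rle_lt_trans; [apply Rabs_triang|]. rewrite Rabs_Ropp. lra.
    + set (a := Cmod (g s - g t)%C). assert (Ha : 0 < a) by (now apply Cmod_gt_0, C_neq_sub).
      destruct (unif_cont g (a / 4) Hl ltac:(lra)) as (e & He & Hue).
      exists (Rmin e (a / 2)). split; [apply Rmin_pos; lra|]. intros s' t' H1 H2 H3. exfalso.
      assert (B1 := Hue s' s (Rlt_le_trans _ _ _ H1 (Rmin_l _ _))).
      assert (B2 := Hue t' t (Rlt_le_trans _ _ _ H2 (Rmin_l _ _))).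
      assert (B3 := Rlt_le_trans _ _ _ H3 (Rmin_r _ _)).
      assert (a <= Cmod (g s' - g t') + Cmod (g s' - g s) + Cmod (g t' - g t)); [|lra].
      unfold a. replace (g s - g t)%C with (((g s' - g t') + - (g s' - g s)) + (g t' - g t))%C by ring.
      eapply Rle_trans; [apply Cmod_triangle|]. apply Rplus_le_compat_r.
      eapply Rle_trans; [apply Cmod_triangle|]. rewrite Cmod_opp. lra.
  - intros s t e e' Hle H H'. apply H. lra.
  - exists e. split; auto. intros s t Hst. destruct Hl as [_ Hp].
    destruct (reduce_unit t) as (n & v & Hv & ->), (reduce_unit s) as (m & w & Hw & ->).
    rewrite !(periodic_Z g Hp) in Hst. destruct (He' w v ltac:(lra) ltac:(lra) Hst) as [k Hk].
    exists (k + m - n)%Z. rewrite minus_IZR, plus_IZR.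
    replace (w + IZR m - (v + IZR n) - (IZR k + IZR m - IZR n)) with (w - v - IZR k) by ring. exact Hk.
Qed.

(** Models a sampled simple loop with [M] samples: returns to a vertex occur only within [D] indices
    modulo [M]. The inequality [3 * D + 3 < M] separates short returns from full turns and forces
    more than three jumps per turn. *)
Definition closed_walk (u : Z -> V) (M D : Z) : Prop :=
  (forall i, u (i + M)%Z = u i) /\ (0 <= D /\ 3 * D + 3 < M)%Z /\
  (forall i j, u i = u j -> exists n, (Z.abs (i - j - n * M) <= D)%Z) /\
  (forall i, lstep (u i) (u (i + 1)%Z)).

(* A jump moves from [u i] to [u (i + 1)] and skips a short detour back to [u (i + 1)]. *)
Definition jump (u : Z -> V) (D i j : Z) : Prop := (i < j <= i + D + 1)%Z /\ u (i + 1)%Z = u j.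
(** Indices are not reduced modulo [M], so a sequence of jumps from [i] to [i + M] goes around
    exactly once. *)
Definition jlist (u : Z -> V) (M D i : Z) (l : list Z) : Prop := path (jump u D) i (l ++ [(i + M)%Z]).

Lemma jump_shift u M D i j : closed_walk u M D -> jump u D i j -> jump u D (i + M) (j + M).
Proof.
  intros (Hper & _).  intros [H1 H2]. split; [lia|]. replace (i + M + 1)%Z with (i + 1 + M)%Z by lia. now rewrite !Hper.
Qed.
Lemma path_shift u M D l : closed_walk u M D -> forall i, path (jump u D) i l -> path (jump u D) (i + M)%Z (map (fun j => j + M)%Z l).
Proof. intros H. induction l; simpl; auto. intros i [H1 H2]. split; auto. now apply jump_shift. Qed.
Lemma path_increasing u D l : forall i j, path (jump u D) i (l ++ [j]) -> (i < j)%Z.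
Proof.
  induction l as [|a l IH]; simpl; intros i j [H1 H2].
  - destruct H1; lia.
  - specialize (IH _ _ H2). destruct H1; lia.
Qed.

(** Indices before the new start reappear one period later; the last clause locates them so that the
    list can be cut there. *)
Lemma jlist_rot u M D i l p1 j p2 : closed_walk u M D -> i :: l = p1 ++ j :: p2 -> jlist u M D i l ->
  exists p1', jlist u M D j (p2 ++ p1') /\ length (p2 ++ p1') = length l /\
    forall a q1 q2, p1 = q1 ++ a :: q2 -> exists r1 r2, p1' = r1 ++ (a + M)%Z :: r2.
Proof.
  intros HU He H. destruct p1 as [|x p1]; simpl in He; injection He as -> ->.
  - exists []. rewrite app_nil_r. split; auto. split; auto. intros a [|b q1] q2 E; discriminate.
  - unfold jlist in H. rewrite <- app_assoc in H. cbn [app] in H. apply path_app in H. destruct H as [H1 H2].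
    apply (path_shift u M D _ HU) in H1. rewrite map_app in H1. cbn [map] in H1.
    exists ((x + M)%Z :: map (fun j => j + M)%Z p1). split; [|split].
    + unfold jlist. rewrite <- app_assoc. cbn [app]. apply path_app. auto.
    + rewrite !length_app. cbn [length]. rewrite length_map. lia.
    + intros a [|b q1] q2 E; injection E as -> ->.
      * exists [], (map (fun j => j + M)%Z q2). auto.
      * exists ((b + M)%Z :: map (fun j => j + M)%Z q1), (map (fun j => j + M)%Z q2).
        now rewrite map_app.
Qed.

(** The part from [i] to [j] is dropped. The last jump, which landed at [i + M], can land at [j + M]
    instead, since both are the same vertex; the jump stays short because returns are. *)
Lemma jlist_shorten u M D i p2 j p3 : closed_walk u M D -> jlist u M D i (p2 ++ j :: p3) -> u i = u j -> (j <= i + D)%Z -> jlist u M D j p3.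
Proof.
  unfold jlist. intros (Hper & HD & Hinj & _) H Hu Hj. rewrite <- app_assoc in H. cbn [app] in H. apply path_app in H.
  destruct H as [H1 H2]. apply path_increasing in H1.
  rewrite path_app' in *. destruct H2 as [H2 [H3 _]]. split; auto. split; [|exact I].
  set (z := last p3 j) in *. destruct H3 as [H3 H4].
  assert (Hz : u (z + 1)%Z = u (j + M)%Z) by now rewrite H4, !Hper.
  split; auto. destruct (Hinj _ _ Hz) as [n Hn].
  assert (n = 0)%Z by nia. subst n. lia.
Qed.

Lemma dup_split {T} (h : Z -> T) L : ~ NoDup (map h L) ->
  exists p1 i p2 j p3, L = p1 ++ i :: p2 ++ j :: p3 /\ h i = h j.
Proof.
  induction L as [|a L IH]; intros H.
  - exfalso. apply H. constructor.
  - destruct (classic (In (h a) (map h L))) as [Hin|Hn].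
    + apply in_map_iff in Hin. destruct Hin as (j & Hj & Hin). apply in_split in Hin.
      destruct Hin as (p2 & p3 & ->). exists [], a, p2, j, p3. auto.
    + destruct IH as (p1 & i & p2 & j & p3 & -> & He).
      * intros Hd. apply H. constructor; auto.
      * exists (a :: p1), i, p2, j, p3. auto.
Qed.

(* A closed sequence of jumps with the fewest possible jumps. *)
Lemma loop_erasure u M D : closed_walk u M D -> exists i l, jlist u M D i l /\ NoDup (map u (i :: l)).
Proof.
  intros HU. assert (HU' := HU). destruct HU' as (Hper & HD & Hinj & _). assert (Hex : exists n i l, jlist u M D i l /\ length l = n).
  { exists (Z.to_nat (M - 1)), 0%Z.
    assert (Hgen : forall n i, exists l, path (jump u D) i (l ++ [(i + Z.of_nat n + 1)%Z]) /\ length l = n).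
    { induction n; intros i.
      - exists []. split; auto. simpl. split; auto. unfold jump. split; [lia|]. f_equal; lia.
      - destruct (IHn (i + 1)%Z) as (l & H1 & H2). exists ((i + 1)%Z :: l). split; [|simpl; lia].
        simpl. split; [unfold jump; split; [lia|reflexivity]|].
        replace (i + Z.pos (Pos.of_succ_nat n) + 1)%Z with (i + 1 + Z.of_nat n + 1)%Z by lia. exact H1. }
    destruct (Hgen (Z.to_nat (M - 1)) 0%Z) as (l & H1 & H2). exists l. split; auto.
    unfold jlist. replace (0 + M)%Z with (0 + Z.of_nat (Z.to_nat (M - 1)) + 1)%Z by lia. exact H1. }
  destruct (dec_inh_nat_subset_has_unique_least_element _ (fun n => classic _) Hex) as (n & [(i & l & Hl & Hn) Hmin] & _).
  exists i, l. split; auto. apply NNPP. intros Hd.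
  destruct (dup_split u (i :: l) Hd) as (p1 & a & p2 & b & p3 & He & Hab).
  destruct (jlist_rot u M D i l p1 a (p2 ++ b :: p3) HU He Hl) as (p1' & R1 & R2 & _).
  rewrite <- app_assoc in R1, R2. cbn [app] in R1, R2.
  assert (Hord : (a < b < a + M)%Z).
  { unfold jlist in R1. rewrite <- app_assoc in R1. cbn [app] in R1. apply path_app in R1. destruct R1 as [Q1 Q2].
    apply path_increasing in Q1. apply path_increasing in Q2. lia. }
  destruct (Hinj _ _ Hab) as [k Hk].
  (* Around the period the two visits are close in one of the two directions. Either way the short
     part is dropped, contradicting minimality. *)
  assert (Hcase : (b <= a + D \/ a + M <= b + D)%Z).
  { destruct (Z.eq_dec k 0); [subst; lia|]. destruct (Z.eq_dec k (-1)); [subst; lia|]. exfalso. nia. }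
  destruct Hcase as [Hc|Hc].
  - assert (R3 := jlist_shorten u M D a p2 b (p3 ++ p1') HU R1 Hab Hc).
    assert (Hle := Hmin _ (ex_intro _ b (ex_intro _ _ (conj R3 eq_refl)))).
    rewrite length_app in Hle. rewrite length_app in R2. cbn [length] in R2. rewrite length_app in R2. lia.
  - destruct (jlist_rot u M D a (p2 ++ b :: p3 ++ p1') (a :: p2) b (p3 ++ p1') HU eq_refl R1) as (p2' & R3 & R4 & R5).
    destruct (R5 a [] p2 eq_refl) as (r1 & r2 & ->).
    rewrite app_assoc in R3. rewrite app_assoc in R4.
    assert (R6 := jlist_shorten u M D b _ (a + M)%Z r2 HU R3 ltac:(now rewrite Hper) Hc).
    assert (Hle := Hmin _ (ex_intro _ (a + M)%Z (ex_intro _ _ (conj R6 eq_refl)))).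
    rewrite R2, length_app in R4. cbn [length] in R4. rewrite length_app in R4. cbn [length] in R4. lia.
Qed.

Lemma jump_lstep u M D i j : closed_walk u M D -> jump u D i j -> lstep (u i) (u j).
Proof. intros (_ & _ & _ & H) [_ <-]. apply H. Qed.

Lemma jlist_span u D l : forall i j, path (jump u D) i (l ++ [j]) -> (j - i <= Z.of_nat (length l + 1) * (D + 1))%Z.
Proof.
  induction l as [|a l IH]; cbn [app path length]; intros i j [H1 H2].
  - destruct H1; lia.
  - specialize (IH _ _ H2). destruct H1. nia.
Qed.

Lemma step_of_lstep x l : forall a, NoDup (a :: l) -> ~ In x l -> (l <> [] \/ a <> x) ->
  path lstep a (l ++ [x]) -> path step a (l ++ [x]).
Proof.
  induction l as [|b l IH]; simpl; intros a Hnd Hx Hne [[H1|H1] H2].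
  - destruct Hne; tauto.
  - auto.
  - inversion Hnd; subst. simpl in *. tauto.
  - split; auto. apply IH; auto. now inversion Hnd.
Qed.

(** A turn longer than [3 * (D + 1)] takes more than three jumps, so the cycle is not degenerate; as
    its vertices are distinct, no [lstep] in it is stationary. *)
Lemma erased_cycle u M D i l : closed_walk u M D -> jlist u M D i l -> NoDup (map u (i :: l)) -> cycle (u i) (map u l).
Proof.
  intros HU H Hnd. assert (Hsp := jlist_span u D l i (i + M)%Z H). assert (HU' := HU). destruct HU' as (Hper & HD & _).
  assert (Hlen : (2 <= length l)%nat) by nia.
  split; [exact Hnd|]. split; [now rewrite length_map|].
  apply step_of_lstep; auto.
  - simpl in Hnd. now inversion Hnd.
  - left. destruct l; [simpl in Hlen; lia|discriminate].
  - unfold jlist in H. apply (path_map u (jump u D) lstep) in H; [|intros a b; now apply (jump_lstep u M D)].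
    rewrite map_app in H. cbn [map] in H. now rewrite Hper in H.
Qed.

(** Spreads each jump over its duration by repeating the landing vertex. The result has [M] edges
    again and keeps pace with the sampled loop, while [peq] sees no difference. *)
Fixpoint expand (u : Z -> V) (i : Z) (l : list Z) : list V :=
  match l with [] => [] | j :: l' => repeat (u j) (Z.to_nat (j - i)) ++ expand u j l' end.

Lemma peq_repeat Pu a b n r : peq Pu (a :: repeat b (S n) ++ r) (a :: b :: r).
Proof.
  induction n; [apply peq_refl|]. eapply peq_trans; [|exact IHn].
  apply (peq_dup Pu [a] b (repeat b n ++ r)).
Qed.
Lemma expand_peq Pu u D l : forall i a, path (jump u D) i l -> peq Pu (a :: expand u i l) (a :: map u l).
Proof.
  induction l as [|j l IH]; intros i a H; [apply peq_refl|]. destruct H as [H1 H2]. cbn [expand map].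
  destruct (Z.to_nat (j - i)) as [|n] eqn:En; [destruct H1; lia|].
  eapply peq_trans; [apply peq_repeat|].
  assert (B := peq_app Pu [a] [] _ _ (IH j (u j) H2)). rewrite !app_nil_r in B. exact B.
Qed.
Lemma expand_length u D l : forall i, path (jump u D) i l -> Z.of_nat (length (expand u i l)) = (last l i - i)%Z.
Proof.
  induction l as [|j l IH]; intros i H; [simpl; lia|]. destruct H as [H1 H2]. rewrite last_cons. cbn [expand].
  rewrite length_app, repeat_length, Nat2Z.inj_add, IH by auto. destruct H1; lia.
Qed.
Fixpoint near (G : R -> C) (r : R) (l : list C) (t : R) : Prop :=
  match l with [] => True | b :: l' => Cmod (b - G t)%C <= r /\ near G r l' (t + 1) end.

Lemma near_app G r l1 : forall l2 t, near G r l1 t -> near G r l2 (t + INR (length l1)) -> near G r (l1 ++ l2) t.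
Proof.
  induction l1 as [|a l1 IH]; intros l2 t H1 H2.
  - simpl in H2. now rewrite Rplus_0_r in H2.
  - destruct H1 as [H1 H3]. split; auto. apply IH; auto. cbn [length] in H2. rewrite S_INR in H2.
    replace (t + 1 + INR (length l1)) with (t + (INR (length l1) + 1)) by ring. exact H2.
Qed.

Lemma pl_near G r r2 : (forall s s', Rabs (s - s') <= 1 -> Cmod (G s - G s')%C <= r2) ->
  forall l a t0, Cmod (a - G t0)%C <= r -> near G r l (t0 + 1) ->
  forall t, 0 <= t <= INR (length l) -> Cmod (pl a l t - G (t0 + t)%R)%C <= r + r2.
Proof.
  intros HG. induction l as [|b l IH]; intros a t0 Ha Hl t Ht.
  - simpl in *. replace (a - G (t0 + t)%R)%C with ((a - G t0) + (G t0 - G (t0 + t)%R))%C by ring.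
    eapply Rle_trans; [apply Cmod_triangle|]. apply Rplus_le_compat; auto. apply HG.
    replace (t0 - (t0 + t)) with (- t) by ring. rewrite Rabs_Ropp, Rabs_right; lra.
  - destruct Hl as [Hb Hl]. cbn [length] in Ht. rewrite S_INR in Ht. cbn [pl].
    destruct (Rle_dec t 1) as [H1|H1].
    + rewrite pl_neg by lra. rewrite clamp_id by lra.
      replace (a + RtoC t * (b - a) + (b - b) - G (t0 + t)%R)%C with
        ((RtoC (1 - t) * ((a - G t0) + (G t0 - G (t0 + t)%R))) + RtoC t * ((b - G (t0 + 1)%R) + (G (t0 + 1)%R - G (t0 + t)%R)))%C
        by (rewrite RtoC_minus; ring).
      assert (B1 : Cmod (G t0 - G (t0 + t)%R) <= r2).
      { apply HG. replace (t0 - (t0 + t)) with (- t) by ring. rewrite Rabs_Ropp, Rabs_right; lra. }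
      assert (B2 : Cmod (G (t0 + 1)%R - G (t0 + t)%R) <= r2).
      { apply HG. replace (t0 + 1 - (t0 + t)) with (1 - t) by ring. rewrite Rabs_right; lra. }
      eapply Rle_trans; [apply Cmod_triangle|]. rewrite !Cmod_mult, !Cmod_RtoC_pos by lra.
      assert (B3 := Cmod_triangle (a - G t0) (G t0 - G (t0 + t)%R)).
      assert (B4 := Cmod_triangle (b - G (t0 + 1)%R) (G (t0 + 1)%R - G (t0 + t)%R)).
      apply Rle_trans with ((1 - t) * (r + r2) + t * (r + r2)); [|right; ring].
      apply Rplus_le_compat; apply Rmult_le_compat_l; lra.
    + rewrite clamp_big by lra.
      replace (a + RtoC 1 * (b - a) + (pl b l (t - 1)%R - b) - G (t0 + t)%R)%C with (pl b l (t - 1)%R - G ((t0 + 1) + (t - 1))%R)%C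
        by (replace (t0 + 1 + (t - 1)) with (t0 + t) by ring; ring).
      apply IH; auto. lra.
Qed.

(** The two coordinates are read at different times and advance alternately, so that consecutive
    samples differ in one coordinate only. Otherwise a step could be diagonal. *)
Definition sample (g : R -> C) (K m j : Z) : V :=
  (flr (IZR K * fst (g (IZR ((j + 1) / 2) / IZR m))), flr (IZR K * snd (g (IZR (j / 2) / IZR m)))).

Lemma flr_dist K v : 0 < K -> Rabs ((IZR (flr (K * v)) + 1 / 2) / K - v) <= 1 / K.
Proof.
  intros HK. assert (H := flr_spec (K * v)).
  replace ((IZR (flr (K * v)) + 1 / 2) / K - v) with ((IZR (flr (K * v)) + 1 / 2 - K * v) / K) by (field; lra).
  unfold Rdiv. rewrite Rabs_mult, (Rabs_right (/ K)) by (apply Rle_ge; left; now apply Rinv_0_lt_compat).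
  apply Rmult_le_compat_r; [left; now apply Rinv_0_lt_compat|]. apply Rabs_le. lra.
Qed.

Lemma flr_close a b : Rabs (a - b) < 1 -> (flr b = flr a \/ flr b = flr a + 1 \/ flr b = flr a - 1)%Z.
Proof.
  intros H. apply Rabs_def2 in H. assert (Ha := flr_spec a). assert (Hb := flr_spec b).
  assert (A1 : IZR (flr b) < IZR (flr a + 2)) by (rewrite plus_IZR; lra).
  assert (A2 : IZR (flr a) < IZR (flr b + 2)) by (rewrite plus_IZR; lra).
  apply lt_IZR in A1, A2. lia.
Qed.

Lemma half_div j m : (0 < m)%Z -> Rabs (IZR (j / 2) / IZR m - IZR j / IZR (2 * m)) <= / IZR (2 * m) /\
  Rabs (IZR ((j + 1) / 2) / IZR m - IZR j / IZR (2 * m)) <= / IZR (2 * m).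
Proof.
  intros Hm. assert (Hm' : 0 < IZR m) by (now apply IZR_lt). rewrite mult_IZR.
  assert (Hi : 0 < / (2 * IZR m)) by (apply Rinv_0_lt_compat; lra).
  assert (Hgen : forall a, (2 * a = j \/ 2 * a = j - 1 \/ 2 * a = j + 1)%Z ->
    Rabs (IZR a / IZR m - IZR j / (2 * IZR m)) <= / (2 * IZR m)).
  { intros a Ha. replace (IZR a / IZR m - IZR j / (2 * IZR m)) with (IZR (2 * a - j) * / (2 * IZR m))
      by (rewrite minus_IZR, mult_IZR; field; lra).
    rewrite Rabs_mult, (Rabs_right (/ _)) by lra.
    rewrite <- (Rmult_1_l (/ (2 * IZR m))) at 2. apply Rmult_le_compat_r; [lra|].
    rewrite <- abs_IZR. apply IZR_le. lia. }
  split; apply Hgen.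
  - assert (H := Z.div_mod j 2 ltac:(lia)). assert (H2 := Z.mod_pos_bound j 2 ltac:(lia)). lia.
  - assert (H := Z.div_mod (j + 1) 2 ltac:(lia)). assert (H2 := Z.mod_pos_bound (j + 1) 2 ltac:(lia)). lia.
Qed.

Lemma near_repeat G r b n : forall t, (forall k : nat, (k < n)%nat -> Cmod (b - G (t + INR k)%R)%C <= r) ->
  near G r (repeat b n) t.
Proof.
  induction n; intros t H; [exact I|]. cbn [repeat near]. split.
  - specialize (H 0%nat ltac:(lia)). simpl in H. now rewrite Rplus_0_r in H.
  - apply IHn. intros k Hk. specialize (H (S k) ltac:(lia)). rewrite S_INR in H.
    replace (t + 1 + INR k) with (t + (INR k + 1)) by ring. exact H.
Qed.
Lemma map_repeat' {T T'} (h : T -> T') a n : map h (repeat a n) = repeat (h a) n.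
Proof. induction n; simpl; auto. now f_equal. Qed.

Lemma near_expand G r K u D l : (0 <= D)%Z ->
  (forall j t, Rabs (t - IZR j) <= IZR D -> Cmod (pos K (u j) - G t)%C <= r) ->
  forall i, path (jump u D) i l -> near G r (map (pos K) (expand u i l)) (IZR i + 1).
Proof.
  intros HD HG. induction l as [|j l IH]; intros i H; [exact I|]. destruct H as [[H1 _] H2].
  cbn [expand]. rewrite map_app, map_repeat'. apply near_app.
  - apply near_repeat. intros k Hk. apply HG. rewrite INR_IZR_INZ, <- !plus_IZR, <- minus_IZR, <- abs_IZR.
    apply IZR_le. lia.
  - rewrite repeat_length. specialize (IH j H2).
    replace (IZR i + 1 + INR (Z.to_nat (j - i))) with (IZR j + 1); [exact IH|].
    rewrite INR_IZR_INZ, Z2Nat.id, minus_IZR by lia. ring.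
Qed.

Lemma sample_near g K m j e : (0 < m)%Z -> (0 < K)%Z ->
  (forall s t, Rabs (s - t) <= / IZR (2 * m) -> Cmod (g s - g t)%C <= e) ->
  Cmod (pos (IZR K) (sample g K m j) - g (IZR j / IZR (2 * m))%R)%C <= 2 / IZR K + 2 * e.
Proof.
  intros Hm HK He. apply IZR_lt in HK. destruct (half_div j m Hm) as [H1 H2].
  apply He in H1, H2. set (c := g (IZR j / IZR (2 * m))%R) in *.
  eapply Rle_trans; [apply Cmod_le_sum|]. unfold pos, sample. cbn [fst snd Cminus Cplus Copp].
  set (a := g (IZR ((j + 1) / 2) / IZR m)) in *. set (b := g (IZR (j / 2) / IZR m)) in *.
  assert (A1 := flr_dist (IZR K) (fst a) HK). assert (A2 := flr_dist (IZR K) (snd b) HK).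
  assert (A3 := Rle_trans _ _ _ (fst_le_Cmod _) H2). assert (A4 := Rle_trans _ _ _ (snd_le_Cmod _) H1).
  unfold Cminus, Cplus, Copp in A3, A4. cbn [fst snd] in A3, A4.
  assert (B1 := Rabs_triang ((IZR (flr (IZR K * fst a)) + 1 / 2) / IZR K - fst a) (fst a + - fst c)).
  assert (B2 := Rabs_triang ((IZR (flr (IZR K * snd b)) + 1 / 2) / IZR K - snd b) (snd b + - snd c)).
  match type of B1 with Rabs ?w <= _ => replace w with ((IZR (flr (IZR K * fst a)) + 1 / 2) / IZR K + - fst c) in B1 by ring end.
  match type of B2 with Rabs ?w <= _ => replace w with ((IZR (flr (IZR K * snd b)) + 1 / 2) / IZR K + - snd c) in B2 by ring end.
  unfold Cminus, Cplus, Copp. cbn [fst snd]. lra.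
Qed.

(** Erasing the short returns of a fine sampling gives the cycle. An erased part lasts less than
    [d1], during which [g] moves by less than [rho / 8]; hence the expanded polygon stays within
    [rho] of [g], and the straight-line homotopy avoids [Pts]. *)
Theorem lattice_approx g (Pts : C -> Prop) rho : simple_loop g -> rho > 0 ->
  (forall p t, Pts p -> rho <= Cmod (g t - p)%C) ->
  exists (K : Z) x l, (0 < K)%Z /\ cycle x l /\
    hom (away (IZR K) (fun F => Pts (ctr (IZR K) F))) g (PL (map (pos (IZR K)) (x :: l ++ [x]))).
Proof.
  intros Hs Hrho HP. assert (Hl : loop g) by (apply simple_loop_iff in Hs; tauto).
  destruct (unif_cont g (rho / 8) Hl ltac:(lra)) as (d1 & Hd1 & U1).
  set (dl := Rmin (d1 / 2) (1 / 8)).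
  assert (Hdl : 0 < dl /\ dl < d1 /\ dl <= 1 / 8) by (unfold dl, Rmin; destruct Rle_dec; lra).
  destruct (unif_inj g dl Hs ltac:(lra)) as (eta & Heta & U2).
  (* This ensures [8 / K < eta], so that equal samples have nearby times, and [4 / K < rho / 8], for
     the rounding error. *)
  set (K := up (8 / eta + 32 / rho)).
  assert (He8 : 0 < 8 / eta) by (apply Rmult_lt_0_compat; [lra|now apply Rinv_0_lt_compat]).
  assert (Hr8 : 0 < 32 / rho) by (apply Rmult_lt_0_compat; [lra|now apply Rinv_0_lt_compat]).
  assert (HKr : 8 / eta + 32 / rho < IZR K) by apply archimed.
  assert (HK0 : 0 < IZR K) by lra. assert (HK : (0 < K)%Z) by now apply lt_IZR.
  assert (HKi : 0 < / IZR K) by now apply Rinv_0_lt_compat.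
  assert (HK1 : 8 / IZR K < eta).
  { apply (Rmult_lt_reg_r (IZR K / eta)); [apply Rmult_lt_0_compat; auto; now apply Rinv_0_lt_compat|].
    replace (8 / IZR K * (IZR K / eta)) with (8 / eta) by (field; lra).
    replace (eta * (IZR K / eta)) with (IZR K) by (field; lra). lra. }
  assert (HK2 : 4 / IZR K < rho / 8).
  { apply (Rmult_lt_reg_r (8 * IZR K / rho)); [apply Rmult_lt_0_compat; [lra|now apply Rinv_0_lt_compat]|].
    replace (4 / IZR K * (8 * IZR K / rho)) with (32 / rho) by (field; lra).
    replace (rho / 8 * (8 * IZR K / rho)) with (IZR K) by (field; lra). lra. }
  destruct (unif_cont g (/ IZR K) Hl HKi) as (d2 & Hd2 & U3).
  (* The lower bound 4 gives [M >= 8], which with [dl <= 1 / 8] yields [3 * D + 3 < M]. *)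
  set (m := Z.max 4 (up (/ d2))).
  assert (Hm4 : (4 <= m)%Z) by (unfold m; lia). assert (Hm0 : 0 < IZR m) by (apply IZR_lt; lia).
  assert (Hmd : / IZR m < d2).
  { rewrite <- (Rinv_inv d2). apply Rinv_lt_contravar.
    - apply Rmult_lt_0_compat; auto. now apply Rinv_0_lt_compat.
    - apply Rlt_le_trans with (IZR (up (/ d2))); [apply archimed|]. apply IZR_le. unfold m; lia. }
  set (M := (2 * m)%Z). assert (HM : IZR M = 2 * IZR m) by (unfold M; apply mult_IZR).
  assert (HMi : / IZR M < / IZR m) by (rewrite HM; apply Rinv_lt_contravar; nra).
  assert (HMi0 : 0 < / IZR M) by (apply Rinv_0_lt_compat; lra).
  set (D := flr (dl * IZR M)). assert (HDs := flr_spec (dl * IZR M)). fold D in HDs.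
  set (u := sample g K m).
  assert (Hfine : forall s t, Rabs (s - t) <= / IZR M -> Cmod (g s - g t)%C <= / IZR K).
  { intros s t Hst. left. apply U3. lra. }
  assert (Hu : forall j, Cmod (pos (IZR K) (u j) - g (IZR j / IZR M)%R)%C <= 4 / IZR K).
  { intros j. eapply Rle_trans; [apply (sample_near g K m j (/ IZR K)); auto; lia|]. right. field. lra. }
  assert (Hper : forall i, u (i + M)%Z = u i).
  { intros i. unfold u, sample, M. replace (i + 2 * m + 1)%Z with (i + 1 + m * 2)%Z by ring.
    replace (i + 2 * m)%Z with (i + m * 2)%Z by ring. rewrite !Z.div_add by lia. rewrite !plus_IZR.
    assert (Hsh : forall a, g ((a + IZR m) / IZR m) = g (a / IZR m)).
    { intros a. replace ((a + IZR m) / IZR m) with (a / IZR m + 1) by (field; lra). apply Hl. }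
    now rewrite !Hsh. }
  assert (Hwalk : closed_walk u M D).
  { split; [exact Hper|]. split; [|split].
    - assert (0 <= dl * IZR M) by nra. split.
      + assert (IZR (-1) < IZR D) by lra. apply lt_IZR in H0. lia.
      + apply lt_IZR. rewrite plus_IZR, mult_IZR. assert (4 <= IZR m) by (now apply IZR_le). nra.
    (* Equal samples come from values less than [eta] apart, hence from times within [dl] modulo 1,
       that is, from indices at most [D] apart modulo [M]. *)
    - intros i j Hij. destruct (U2 (IZR i / IZR M) (IZR j / IZR M)) as [n Hn].
      { replace (g (IZR i / IZR M)%R - g (IZR j / IZR M)%R)%C with
          (- (pos (IZR K) (u i) - g (IZR i / IZR M)%R) + (pos (IZR K) (u j) - g (IZR j / IZR M)%R))%C by (rewrite Hij; ring).
        eapply Rle_lt_trans; [apply Cmod_triangle|]. rewrite Cmod_opp. generalize (Hu i) (Hu j). lra. }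
      exists n. assert (Hlt : IZR (Z.abs (i - j - n * M)) < IZR (D + 1)).
      { rewrite abs_IZR, !minus_IZR, mult_IZR, plus_IZR.
        replace (IZR i - IZR j - IZR n * IZR M) with ((IZR i / IZR M - IZR j / IZR M - IZR n) * IZR M) by (field; lra).
        rewrite Rabs_mult, (Rabs_right (IZR M)) by lra. nra. }
      apply lt_IZR in Hlt. lia.
    - intros i. unfold lstep, step, u, sample.
      destruct (Z.Even_or_Odd i) as [[a ->]|[a ->]].
      + replace ((2 * a + 1) / 2)%Z with a by (Z.div_mod_to_equations; lia).
        replace ((2 * a + 1 + 1) / 2)%Z with (a + 1)%Z by (Z.div_mod_to_equations; lia).
        replace ((2 * a) / 2)%Z with a by (Z.div_mod_to_equations; lia).
        cbn [fst snd].
        destruct (flr_close (IZR K * fst (g (IZR a / IZR m))) (IZR K * fst (g (IZR (a + 1) / IZR m)))) as [H|[H|H]];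
          [|rewrite H; auto|rewrite H; auto|rewrite H; auto].
        rewrite <- Rmult_minus_distr_l, Rabs_mult, (Rabs_right (IZR K)) by lra.
        apply (Rmult_lt_reg_l (/ IZR K)); auto. rewrite <- Rmult_assoc, Rinv_l, Rmult_1_l, Rmult_1_r by lra.
        eapply Rle_lt_trans; [apply (fst_le_Cmod (g (IZR a / IZR m)%R - g (IZR (a + 1) / IZR m)%R)%C)|]. apply U3.
        rewrite plus_IZR. replace (IZR a / IZR m - (IZR a + 1) / IZR m) with (- / IZR m) by (field; lra).
        rewrite Rabs_Ropp, Rabs_right; auto. left. now apply Rinv_0_lt_compat.
      + replace ((2 * a + 1 + 1) / 2)%Z with (a + 1)%Z by (Z.div_mod_to_equations; lia).
        replace ((2 * a + 1 + 1 + 1) / 2)%Z with (a + 1)%Z by (Z.div_mod_to_equations; lia).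
        replace ((2 * a + 1) / 2)%Z with a by (Z.div_mod_to_equations; lia).
        cbn [fst snd].
        destruct (flr_close (IZR K * snd (g (IZR a / IZR m))) (IZR K * snd (g (IZR (a + 1) / IZR m)))) as [H|[H|H]];
          [|rewrite H; auto|rewrite H; auto|rewrite H; auto 6].
        rewrite <- Rmult_minus_distr_l, Rabs_mult, (Rabs_right (IZR K)) by lra.
        apply (Rmult_lt_reg_l (/ IZR K)); auto. rewrite <- Rmult_assoc, Rinv_l, Rmult_1_l, Rmult_1_r by lra.
        eapply Rle_lt_trans; [apply (snd_le_Cmod (g (IZR a / IZR m)%R - g (IZR (a + 1) / IZR m)%R)%C)|]. apply U3.
        rewrite plus_IZR. replace (IZR a / IZR m - (IZR a + 1) / IZR m) with (- / IZR m) by (field; lra).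
        rewrite Rabs_Ropp, Rabs_right; auto. left. now apply Rinv_0_lt_compat. }
  destruct (loop_erasure u M D Hwalk) as (i & l & Hj & Hnd).
  assert (Hcyc := erased_cycle u M D i l Hwalk Hj Hnd).
  exists K, (u i), (map u l). split; auto. split; auto.
  set (Pu := fun F => Pts (ctr (IZR K) F)).
  set (ex := expand u i (l ++ [(i + M)%Z])).
  assert (Hlast : last (l ++ [(i + M)%Z]) i = (i + M)%Z) by apply last_last.
  assert (Hexl : Z.of_nat (length ex) = M).
  { unfold ex. rewrite (expand_length u D) by exact Hj. rewrite Hlast. ring. }
  assert (Hpeq : peq Pu (u i :: ex) (u i :: map u l ++ [u i])).
  { assert (B := expand_peq Pu u D _ i (u i) Hj). rewrite map_app in B. cbn [map] in B. rewrite Hper in B. exact B. }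
  destruct (peq_sound (IZR K) Pu _ _ HK0 Hpeq) as (Hends & Hpath & Hhom & _).
  assert (Hcl2 : closed' (u i :: map u l ++ [u i])).
  { exists (u i). intros d. split; auto. rewrite last_cons. apply last_last. }
  assert (Hcl1 : closed' (u i :: ex)).
  { apply (closed'_ends (u i :: map u l ++ [u i])); auto. destruct Hends as [E1 E2]. split; intros; symmetry; auto. }
  apply (hom_trans _ _ (PL (map (pos (IZR K)) (u i :: ex)))).
  2:{ apply Hhom; auto; [|discriminate]. apply Hpath. cbn [pathL].
      replace (map u l ++ [u i]) with (map (fun v : V => v) (map u l ++ [u i])) by apply map_id.
      apply (path_map (fun v => v) step (conn Pu)); [|apply Hcyc]. intros a b Hab. right; left; exact Hab. }
  clear Hhom Hpath Hpeq.
  (* The erased walk starts at the index [i], so the polygon is compared with the loop shifted by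
     this time. *)
  set (c := IZR i / IZR M).
  assert (Hnear : forall t, Cmod (PL (map (pos (IZR K)) (u i :: ex)) t - g (t + c)%R)%C < rho).
  { intros t. cbn [map PL]. unfold ploop. rewrite length_map, INR_IZR_INZ, Hexl.
    set (v := t - IZR (flr t)). assert (Hv : 0 <= v < 1) by (unfold v; generalize (flr_spec t); lra).
    replace (g (t + c)) with (g ((IZR i + IZR M * v) / IZR M)).
    2:{ rewrite <- (periodic_Z g (proj2 Hl) (flr t)). f_equal. unfold v, c. field. lra. }
    eapply Rle_lt_trans; [apply (pl_near (fun t => g (t / IZR M)) (4 / IZR K + rho / 8) (/ IZR K))|].
    - intros s s' Hss. apply Hfine. replace (s / IZR M - s' / IZR M) with ((s - s') * / IZR M) by (field; lra).
      rewrite Rabs_mult, (Rabs_right (/ IZR M)) by lra. rewrite <- (Rmult_1_l (/ IZR M)) at 2. apply Rmult_le_compat_r; lra.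
    - eapply Rle_trans; [apply Hu|]. lra.
    - unfold ex. destruct Hwalk as (_ & [HD0 _] & _). apply (near_expand _ _ _ u D); auto.
      intros j s Hjs. replace (pos (IZR K) (u j) - g (s / IZR M)%R)%C with
        ((pos (IZR K) (u j) - g (IZR j / IZR M)%R) + - (g (s / IZR M)%R - g (IZR j / IZR M)%R))%C by ring.
      eapply Rle_trans; [apply Cmod_triangle|]. rewrite Cmod_opp. apply Rplus_le_compat; auto.
      left. apply U1. replace (s / IZR M - IZR j / IZR M) with ((s - IZR j) * / IZR M) by (field; lra).
      rewrite Rabs_mult, (Rabs_right (/ IZR M)) by lra.
      apply Rle_lt_trans with (dl * IZR M * / IZR M); [|rewrite Rmult_assoc, Rinv_r by lra; lra].
      apply Rmult_le_compat_r; lra.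
    - rewrite length_map, INR_IZR_INZ, Hexl. nra.
    - replace (/ IZR K) with (1 / IZR K) by (field; lra). unfold Rdiv in *. lra. }
  apply (hom_trans _ _ (fun t => g (t + c))).
  - apply hom_reparam; auto.
    + intros t F HF He. specialize (HP _ t HF). rewrite He in HP.
      replace (ctr (IZR K) F - ctr (IZR K) F)%C with (RtoC 0) in HP by ring. rewrite Cmod_0 in HP. lra.
    + cont.
    + intros t. ring.
  - apply hom_line.
    + now apply loop_shift.
    + cbn [map PL]. apply ploop_loop. rewrite last_map. f_equal.
      destruct Hcl1 as [a Ha]. destruct (Ha (u i)) as [E1 E2]. rewrite last_cons in E2. simpl in E1. now rewrite E2.
    + intros s t Hs01 F HF He. specialize (HP _ (t + c) HF). specialize (Hnear t).
      assert (Cmod (g (t + c)%R - ctr (IZR K) F)%C < rho); [|lra].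
      rewrite <- He.
      replace (g (t + c)%R - (g (t + c)%R + RtoC s * (PL (map (pos (IZR K)) (u i :: ex)) t - g (t + c)%R)))%C
        with (- (RtoC s * (PL (map (pos (IZR K)) (u i :: ex)) t - g (t + c)%R)))%C by ring.
      rewrite Cmod_opp, Cmod_mult, Cmod_RtoC_pos by lra.
      generalize (Cmod_ge_0 (PL (map (pos (IZR K)) (u i :: ex)) t - g (t + c)%R)%C). nra.
Qed.

(** * Winding numbers of simple loops *)

(** The point [- q] is added to the finite postcritical points so that both preimages of [q] and
    both preimages of [- Ci] are covered; [wind_f] needs them in pairs. *)
Definition special (p : C) : Prop := p = Ci \/ p = (- Ci)%C \/ p = q \/ p = (- q)%C.

Lemma special_ctr K p : (0 < K)%Z -> special p -> exists F, p = ctr (IZR K) F /\ (Z.abs (fst F) <= K /\ Z.abs (snd F) <= K)%Z.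
Proof.
  intros HK H. assert (HK' := IZR_lt _ _ HK).
  assert (Hgen : forall a b : Z, p = (IZR a, IZR b) -> (Z.abs a <= 1 /\ Z.abs b <= 1)%Z ->
    exists F, p = ctr (IZR K) F /\ (Z.abs (fst F) <= K /\ Z.abs (snd F) <= K)%Z).
  { intros a b -> [Ha Hb]. exists (a * K, b * K)%Z. split; [|cbn [fst snd]; nia].
    unfold ctr. cbn [fst snd]. rewrite !mult_IZR. f_equal; field; lra. }
  destruct H as [H|[H|[H|H]]].
  - apply (Hgen 0 1)%Z; [exact H|lia].
  - apply (Hgen 0 (-1))%Z; [rewrite H; unfold Ci, Copp; simpl; f_equal; lra|lia].
  - apply (Hgen (-1) 1)%Z; [exact H|lia].
  - apply (Hgen 1 (-1))%Z; [rewrite H; unfold q, Copp; simpl; f_equal; lra|lia].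
Qed.
Lemma Pfin_special p : Pfin p -> special p.
Proof. rewrite Pfin_iff. unfold special. tauto. Qed.

Lemma hom_right S g1 g2 : hom S g1 g2 -> forall t, S (g2 t).
Proof. intros (H & _ & _ & H1 & _ & HS) t. rewrite <- H1. apply HS. lra. Qed.

Lemma loop_gap g p : loop g -> (forall t, g t <> p) -> exists rho, rho > 0 /\ forall t, rho <= Cmod (g t - p)%C.
Proof.
  intros [Hc Hp] Hn. destruct (periodic_bounds (fun t => Cmod (g t - p)%C)) as (a & b & Hab).
  - cont.
  - intros t. now rewrite Hp.
  - exists (Cmod (g a - p)%C). split; [apply Cmod_gt_0, C_neq_sub, Hn|]. intros t. apply Hab.
Qed.

Lemma path_lstep x l : path step x l -> path lstep x l.
Proof.
  intros H. rewrite <- (map_id l). apply (path_map (fun v : V => v) step lstep); auto. intros u v Huv. now right.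
Qed.

Lemma wind_cycle g K Pu x l F n : (0 < K)%Z -> Pu F -> cycle x l ->
  hom (away (IZR K) Pu) g (PL (map (pos (IZR K)) (x :: l ++ [x]))) ->
  wind g (ctr (IZR K) F) n -> n = cw x l F.
Proof.
  intros HK HF Hc Hh Hw. assert (HK' := IZR_lt _ _ HK).
  assert (Hh' : hom (fun z => z <> ctr (IZR K) F) g (PL (map (pos (IZR K)) (x :: l ++ [x])))).
  { apply (hom_mono (away (IZR K) Pu)); auto. }
  apply (wind_unique (PL (map (pos (IZR K)) (x :: l ++ [x]))) (ctr (IZR K) F)).
  - apply (hom_right _ _ _ Hh').
  - now apply (wind_hom g).
  - apply wind_PL; auto; [|apply last_last]. apply path_lstep, Hc.
Qed.

(** The substitute for the Jordan curve theorem: both points are face centres for one approximating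
    cycle, and [cycle_cw] allows it a single sign. *)
Lemma simple_wind g p p' n n' : simple_loop g -> special p -> special p' ->
  (forall t, g t <> p) -> (forall t, g t <> p') -> wind g p n -> wind g p' n' ->
  (Z.abs n <= 1 /\ 0 <= n * n')%Z.
Proof.
  intros Hs Sp Sp' Hp Hp' Hw Hw'. assert (Hl : loop g) by (apply simple_loop_iff in Hs; tauto).
  destruct (loop_gap g p Hl Hp) as (r & Hr & Hr'), (loop_gap g p' Hl Hp') as (r2 & Hr2 & Hr2').
  destruct (lattice_approx g (fun z => z = p \/ z = p') (Rmin r r2) Hs) as (K & x & l & HK & Hc & Hh).
  - now apply Rmin_pos.
  - intros z t [-> | ->]; eapply Rle_trans; [apply Rmin_l|auto|apply Rmin_r|auto].
  - destruct (special_ctr K p HK Sp) as (F & HF & _), (special_ctr K p' HK Sp') as (F' & HF' & _).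
    rewrite HF in Hw. rewrite HF' in Hw'.
    assert (En := wind_cycle g K _ x l F n HK (or_introl (eq_sym HF)) Hc Hh Hw).
    assert (En' := wind_cycle g K _ x l F' n' HK (or_intror (eq_sym HF')) Hc Hh Hw').
    destruct (cycle_cw x l Hc) as [C1|C1]; destruct (C1 F), (C1 F'); subst; nia.
Qed.

Lemma simple_approx g : simple_loop g -> exists K x l, (0 < K)%Z /\ cycle x l /\
  hom (away (IZR K) (fun F => Pfin (ctr (IZR K) F))) g (PL (map (pos (IZR K)) (x :: l ++ [x]))).
Proof.
  intros Hs. assert (Hs' := Hs). apply simple_loop_iff in Hs'. destruct Hs' as (Hl & HX & _).
  assert (Hg : forall p, Pfin p -> exists rho, rho > 0 /\ forall t, rho <= Cmod (g t - p)%C).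
  { intros p Hp. apply loop_gap; auto. intros t <-. now apply (HX t). }
  destruct (Hg Ci) as (r1 & P1 & R1); [apply Pfin_iff; auto|].
  destruct (Hg q) as (r2 & P2 & R2); [apply Pfin_iff; auto|].
  destruct (Hg (- Ci)%C) as (r3 & P3 & R3); [apply Pfin_iff; auto|].
  apply (lattice_approx g Pfin (Rmin r1 (Rmin r2 r3)) Hs).
  - repeat apply Rmin_pos; auto.
  - intros p t Hp. apply Pfin_iff in Hp.
    assert (A1 := Rmin_l r1 (Rmin r2 r3)). assert (A2 := Rmin_r r1 (Rmin r2 r3)).
    assert (A3 := Rmin_l r2 r3). assert (A4 := Rmin_r r2 r3).
    destruct Hp as [-> |[-> | ->]]; [specialize (R1 t)|specialize (R2 t)|specialize (R3 t)]; lra.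
Qed.

Lemma away_X K z : (0 < K)%Z -> away (IZR K) (fun F => Pfin (ctr (IZR K) F)) z -> X z.
Proof.
  intros HK H Hz. destruct (special_ctr K z HK (Pfin_special z Hz)) as (F & HF & _).
  apply (H F); auto. now rewrite <- HF.
Qed.

Lemma pl_lipschitz l : forall a, exists K, 0 <= K /\ forall s t, Cmod (pl a l t - pl a l s)%C <= K * Rabs (t - s).
Proof.
  induction l as [|b l IH]; intros a.
  - exists 0. split; [lra|]. intros s t. cbn [pl]. replace (a - a)%C with (RtoC 0) by ring. rewrite Cmod_0. lra.
  - destruct (IH b) as (K & HK & HL). exists (Cmod (b - a)%C + K). split; [generalize (Cmod_ge_0 (b - a)%C); lra|].
    intros s t. cbn [pl].
    replace (a + RtoC (clamp t) * (b - a) + (pl b l (t - 1)%R - b) - (a + RtoC (clamp s) * (b - a) + (pl b l (s - 1)%R - b)))%C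
      with (RtoC (clamp t - clamp s) * (b - a) + (pl b l (t - 1)%R - pl b l (s - 1)%R))%C by (rewrite RtoC_minus; ring).
    eapply Rle_trans; [apply Cmod_triangle|]. rewrite Cmod_mult, Cmod_R.
    assert (A1 := clamp_lip t s). assert (A2 := HL (s - 1) (t - 1)).
    replace (t - 1 - (s - 1)) with (t - s) in A2 by ring. generalize (Cmod_ge_0 (b - a)%C). nra.
Qed.

Lemma ploop_lipschitz a l : last l a = a -> exists K, 0 <= K /\ forall s t, Cmod (ploop a l t - ploop a l s)%C <= K * Rabs (t - s).
Proof.
  intros Hl. destruct (pl_lipschitz l a) as (K & HK & HL). set (n := INR (length l)). assert (Hn := pos_INR (length l)). fold n in Hn.
  exists (K * n). assert (HKn : 0 <= K * n) by nra. split; auto.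
  assert (Hu : forall u v, Cmod (pl a l (n * u) - pl a l (n * v))%C <= K * n * Rabs (u - v)).
  { intros u v. eapply Rle_trans; [apply HL|]. rewrite <- Rmult_minus_distr_l, Rabs_mult, (Rabs_right n) by lra. right; ring. }
  assert (Hord : forall s t, s <= t <= s + 1 -> Cmod (ploop a l t - ploop a l s)%C <= K * n * (t - s)).
  { intros s t Hst. assert (Hfs := flr_spec s). set (k := flr s) in *.
    destruct (Rle_dec t (IZR k + 1)) as [H1|H1].
    - replace t with (IZR k + (t - IZR k)) at 1 by ring. replace s with (IZR k + (s - IZR k)) at 1 by ring.
      rewrite !ploop_at by (auto; lra). fold n. eapply Rle_trans; [apply Hu|]. rewrite Rabs_right by lra. right; ring.
    - replace t with (IZR (k + 1) + (t - (IZR k + 1))) at 1 by (rewrite plus_IZR; ring).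
      replace s with (IZR k + (s - IZR k)) at 1 by ring.
      rewrite !ploop_at by (auto; lra). fold n.
      assert (B1 := Hu (t - (IZR k + 1)) 0). assert (B2 := Hu 1 (s - IZR k)).
      rewrite Rabs_right in B1, B2 by lra.
      rewrite (pl_neg l a (n * 0)) in B1 by lra. rewrite (pl_end l a (n * 1)) in B2 by (unfold n; lra). rewrite Hl in B2.
      replace (pl a l (n * (t - (IZR k + 1)))%R - pl a l (n * (s - IZR k))%R)%C with
        ((pl a l (n * (t - (IZR k + 1)))%R - a) + (a - pl a l (n * (s - IZR k))%R))%C by ring.
      eapply Rle_trans; [apply Cmod_triangle|]. eapply Rle_trans; [apply Rplus_le_compat; [exact B1|exact B2]|]. right; ring. }
  apply local_lipschitz. intros t eps He. exists 1. split; [lra|]. intros t' Ht'.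
  apply Rabs_def2 in Ht'. apply Rle_trans with (K * n * Rabs (t' - t)).
  - destruct (Rle_dec t t').
    + rewrite Rabs_right by lra. apply Hord. lra.
    + rewrite Rabs_left by lra. replace (ploop a l t' - ploop a l t)%C with (- (ploop a l t - ploop a l t'))%C by ring.
      rewrite Cmod_opp. replace (- (t' - t)) with (t - t') by ring. apply Hord. lra.
  - apply Rmult_le_compat_r; [apply Rabs_pos|lra].
Qed.

(** A continuous simple loop may have infinite length; a polygon in its homotopy class has bounded
    speed. *)
Lemma lipschitz_approx g : simple_loop g -> exists g' K, loop g' /\ (forall t, X (g' t)) /\
  hom X g g' /\ 0 <= K /\ (forall s t, Cmod (g' t - g' s)%C <= K * Rabs (t - s)).
Proof.
  intros Hs. destruct (simple_approx g Hs) as (K & x & l & HK & Hc & Hh).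
  apply (hom_mono _ X) in Hh; [|intros z Hz; now apply (away_X K)].
  cbn [map PL] in Hh. set (L := map (pos (IZR K)) (l ++ [x])) in *.
  assert (Hl : last L (pos (IZR K) x) = pos (IZR K) x) by (unfold L; rewrite last_map, last_last; reflexivity).
  destruct (ploop_lipschitz _ _ Hl) as (K' & HK' & HL).
  exists (ploop (pos (IZR K) x) L), K'. split; [now apply ploop_loop|]. split; [|auto].
  apply (hom_right _ _ _ Hh).
Qed.

(** In lattice units, the half-integer offset and the step along the edge move a coordinate by at
    most 3/2, which the margin 2 absorbs. *)
Lemma far_norm K N M u v s : (0 < K)%Z -> far N u -> step u v -> 0 <= s <= 1 -> IZR K * M + 2 <= IZR N ->
  M < Cmod (pos (IZR K) u + RtoC s * (pos (IZR K) v - pos (IZR K) u))%C.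
Proof.
  intros HK Hf Hst Hs HN. assert (HK' := IZR_lt _ _ HK).
  assert (Hd : Rabs (IZR (fst v) - IZR (fst u)) <= 1 /\ Rabs (IZR (snd v) - IZR (snd u)) <= 1).
  { rewrite <- !minus_IZR, <- !abs_IZR. destruct u as [x y].
    destruct Hst as [->|[->|[->| ->]]]; cbn [fst snd]; split; apply IZR_le; lia. }
  set (z := (pos (IZR K) u + RtoC s * (pos (IZR K) v - pos (IZR K) u))%C).
  assert (Hgen : forall a b w, IZR N <= Rabs a -> Rabs (b - a) <= 1 ->
     w = (a + 1 / 2) / IZR K + s * ((b + 1 / 2) / IZR K - (a + 1 / 2) / IZR K) -> M < Rabs w).
  { intros a b w Ha Hb ->. apply (Rmult_lt_reg_l (IZR K)); auto.
    replace ((a + 1 / 2) / IZR K + s * ((b + 1 / 2) / IZR K - (a + 1 / 2) / IZR K))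
      with ((a + (1 / 2 + s * (b - a))) * / IZR K) by (field; lra).
    rewrite Rabs_mult, (Rabs_right (/ IZR K)) by (apply Rle_ge; left; now apply Rinv_0_lt_compat).
    replace (IZR K * (Rabs (a + (1 / 2 + s * (b - a))) * / IZR K)) with (Rabs (a + (1 / 2 + s * (b - a)))) by (field; lra).
    assert (B : Rabs (1 / 2 + s * (b - a)) <= 3 / 2).
    { eapply Rle_trans; [apply Rabs_triang|]. rewrite Rabs_mult, (Rabs_right s), (Rabs_right (1 / 2)) by lra.
      generalize (Rabs_pos (b - a)). nra. }
    assert (B2 := Rabs_triang (a + (1 / 2 + s * (b - a))) (- (1 / 2 + s * (b - a)))). rewrite Rabs_Ropp in B2.
    replace (a + (1 / 2 + s * (b - a)) + - (1 / 2 + s * (b - a))) with a in B2 by ring. lra. }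
  destruct Hf as [Hf|Hf]; apply IZR_le in Hf; rewrite abs_IZR in Hf.
  - eapply Rlt_le_trans; [|apply (fst_le_Cmod z)]. apply (Hgen (IZR (fst u)) (IZR (fst v))); auto; [apply Hd|].
    unfold z, pos, Cminus, Cplus, Cmult, Copp, RtoC. cbn [fst snd]. ring.
  - eapply Rlt_le_trans; [|apply (snd_le_Cmod z)]. apply (Hgen (IZR (snd u)) (IZR (snd v))); auto; [apply Hd|].
    unfold z, pos, Cminus, Cplus, Cmult, Copp, RtoC. cbn [fst snd]. ring.
Qed.

Lemma far_all2 K N M b B : (0 < K)%Z -> path step b B -> (forall u : V, In u (b :: B) -> far N u) -> IZR K * M + 2 <= IZR N ->
  all2 (fun u v _ _ => forall s, 0 <= s <= 1 -> M < Cmod (u + RtoC s * (v - u))%C)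
    (pos (IZR K) b) (map (pos (IZR K)) B) (pos (IZR K) b) (map (pos (IZR K)) B).
Proof.
  intros HK. revert b. induction B as [|c B IH]; intros b Hp Hf HN; [exact I|]. destruct Hp as [H1 H2].
  cbn [map all2]. split.
  - intros s Hs. apply (far_norm K N); auto. apply Hf. now left.
  - apply IH; auto. intros u Hu. apply Hf. now right.
Qed.

Lemma simple_outer g n : simple_loop g -> n <> 0%Z -> wind g Ci n -> wind g q n -> wind g (- Ci)%C n ->
  trivial_curve g.
Proof.
  intros Hs Hn W1 W2 W3. right. right. intros M.
  destruct (simple_approx g Hs) as (K & x & l & HK & Hc & Hh). assert (HK' := IZR_lt _ _ HK).
  set (Pu := fun F => Pfin (ctr (IZR K) F)) in *.
  assert (Hcw : forall F, Pu F -> cw x l F <> 0%Z).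
  { intros F HF. assert (Hw : wind g (ctr (IZR K) F) n).
    { unfold Pu in HF. apply Pfin_iff in HF. destruct HF as [-> |[-> | ->]]; auto. }
    now rewrite <- (wind_cycle g K Pu x l F n HK HF Hc Hh Hw). }
  destruct (list_bound (fun u => Z.max (Z.abs (fst u)) (Z.abs (snd u))) (x :: l)) as [B0 HB0].
  (* [B0] makes the box contain the cycle and [K + 1] the punctures, whose coordinates are at most
     [K]; the last term puts its boundary beyond radius [M]. *)
  set (N := Z.max (Z.max B0 (K + 1)) (up (IZR K * M + 2))).
  assert (HNM : IZR K * M + 2 <= IZR N).
  { apply Rle_trans with (IZR (up (IZR K * M + 2))); [left; apply archimed|]. apply IZR_le. unfold N; lia. }
  destruct (outer_cycle Pu N x l Hc Hcw) as (b & B & Hfq & HpB & Hfar).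
  - intros u Hu. specialize (HB0 u Hu). cbv beta in HB0. unfold N. lia.
  - intros F HF. destruct (special_ctr K (ctr (IZR K) F) HK (Pfin_special _ HF)) as (F' & HF' & HB').
    assert (F = F').
    { unfold ctr in HF'. injection HF' as E1 E2. destruct F as [f1 f2], F' as [f3 f4]. cbn [fst snd] in *.
      apply (Rmult_eq_reg_r (/ IZR K)) in E1; [|apply Rinv_neq_0_compat; lra].
      apply (Rmult_eq_reg_r (/ IZR K)) in E2; [|apply Rinv_neq_0_compat; lra].
      apply eq_IZR in E1, E2. now subst. }
    subst F'. unfold N. lia.
  - destruct (freeq_sound (IZR K) Pu _ _ HK' Hfq) as (_ & _ & Hhom & _).
    assert (Hh2 : hom X g (PL (map (pos (IZR K)) (b :: B ++ [b])))).
    { apply (hom_mono (away (IZR K) Pu)); [intros z Hz; now apply (away_X K)|].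
      eapply hom_trans; [exact Hh|]. apply Hhom; [| |discriminate].
      - cbn [pathL]. rewrite <- (map_id (l ++ [x])). apply (path_map (fun v : V => v) step (conn Pu)); [|apply Hc].
        intros u v Huv. right; left; exact Huv.
      - exists x. intros d. split; auto. rewrite last_cons. apply last_last. }
    exists (PL (map (pos (IZR K)) (b :: B ++ [b]))). split; [|split].
    + apply loop_in_X_iff. split; [|apply (hom_right _ _ _ Hh2)].
      cbn [map PL]. apply ploop_loop. rewrite last_map, last_last. reflexivity.
    + exact Hh2.
    + intros t. cbn [map PL]. rewrite cnorm_Cmod. unfold ploop.
      assert (HA : forall u : V, In u (b :: B ++ [b]) -> far N u).
      { intros u [Hu|Hu]; [apply Hfar; now left|]. apply in_app_iff in Hu. destruct Hu as [Hu|[Hu|[]]]; apply Hfar; [now right|now left]. }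
      destruct (pl_seg _ _ _ _ _ (far_all2 K N M b (B ++ [b]) HK HpB HA HNM)) with
        (t := INR (length (map (pos (IZR K)) (B ++ [b]))) * (t - IZR (flr t))) as (u & v & u' & v' & s & Hs01 & HQ & E1 & _).
      * destruct B; discriminate.
      * apply Rlt_gt. rewrite E1. now apply HQ.
Qed.

(** * Components of iterated preimages *)

(** The root follows a continuous argument of [g - Ci], which gains [2 * PI * n] per period; half of
    this gain changes the sign exactly when [n] is odd. *)
Lemma root_of_loop g : loop g -> (forall t, X (g t)) -> exists (d : R -> C) (n : Z),
  contC d /\ wind g Ci n /\ (forall t, f (d t) = g t) /\
  (forall t, d (t + 1) = if Z.even n then d t else (- d t)%C).
Proof.
  intros [Hc Hp] HX.
  destruct (loop_lift (fun t => g t - Ci)%C) as (th & n & T1 & T2 & T3).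
  - cont.
  - intros t. now rewrite Hp.
  - intros t. now apply C_neq_sub, X_neq_i.
  - exists (fun t => csqrt (th t) (g t - Ci)%C), n. split; [|split; [|split]].
    + apply contC_csqrt; cont.
    + exists th. auto.
    + intros t. rewrite f_C, csqrt_sqr by auto. cring.
    + intros t. unfold csqrt. rewrite Hp, T3.
      destruct (Z.even n) eqn:Hn.
      * apply Z.even_spec in Hn. destruct Hn as [k ->].
        replace ((th t + 2 * PI * IZR (2 * k)) / 2) with (th t / 2 + 2 * PI * IZR k) by (rewrite mult_IZR; field).
        now rewrite cis_2PI.
      * assert (Hn' : Z.odd n = true) by (rewrite <- Z.negb_even, Hn; reflexivity).
        apply Z.odd_spec in Hn'. destruct Hn' as [k ->].
        replace ((th t + 2 * PI * IZR (2 * k + 1)) / 2) with (th t / 2 + PI + 2 * PI * IZR k)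
          by (rewrite plus_IZR, mult_IZR; field).
        rewrite cis_2PI, cis_PI. cring.
Qed.

Definition im (g : R -> C) (z : C) : Prop := exists t, g t = z.

Lemma neq_neg (d : C) : X (f d) -> d <> (- d)%C.
Proof.
  intros H Hd. apply H. left.
  assert (d = RtoC 0).
  { destruct d as [x y]. unfold Copp in Hd; simpl in Hd. injection Hd as A B. unfold RtoC. f_equal; lra. }
  subst. unfold f, RtoC; simpl. f_equal; cring.
Qed.

(** For even [n] the two roots are disjoint simple lifts, and the one through [z] is chosen. For odd
    [n] they join into one loop that covers [g] twice, opposite points being half a turn apart. *)
Lemma simple_lift g z : simple_loop g -> im g (f z) -> exists (d : R -> C) (n : Z),
  simple_loop d /\ im d z /\ wind g Ci n /\
  (if Z.even n then (forall t, f (d t) = g t) /\ (forall s t, d s <> (- d t)%C)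
   else (forall t, f (d t) = g (2 * t)) /\ (forall t, d (t + 1 / 2) = (- d t)%C)).
Proof.
  intros Hs [t0 Hz]. assert (Hs' := Hs). apply simple_loop_iff in Hs'.
  destruct Hs' as (Hl & HX & Hi).
  destruct (root_of_loop g Hl HX) as (d & n & Hc & Hw & Hf & Hd).
  assert (HXd : forall t, X (d t)) by (intros t; apply X_f; rewrite Hf; apply HX).
  assert (Hneg : forall t, d t <> (- d t)%C) by (intros t; apply neq_neg; rewrite Hf; apply HX).
  destruct (Z.even n) eqn:Hn.
  - assert (Hdis : forall s t, d s <> (- d t)%C).
    { intros s t Hst. destruct (simple_loop_inj g s t Hs) as [k ->].
      - rewrite <- !Hf, Hst, !f_C. cring.
      - rewrite (periodic_Z d Hd) in Hst. now apply (Hneg t). }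
    destruct (f_eq z (d t0)) as [->|Hz']. { rewrite Hf. auto. }
    + exists d, n. rewrite Hn. split; [|split; [|split; [|split]]]; auto.
      * apply simple_loop_intro; auto. intros s t Hs0 Ht0 He. apply Hi; auto. now rewrite <- !Hf, He.
      * now exists t0.
    + exists (fun t => - d t)%C, n. rewrite Hn.
      assert (Hf' : forall t, f (- d t)%C = g t) by (intros t; rewrite <- Hf, !f_C; cring).
      split; [|split; [|split; [|split]]]; auto.
      * apply simple_loop_intro. -- now apply contC_opp.
        -- intros t. now rewrite Hd.
        -- intros t. apply X_f. rewrite Hf'. apply HX.
        -- intros s t Hs0 Ht0 He. apply Hi; auto. now rewrite <- !Hf', He.
      * now exists t0.
      * intros s t He. apply (Hdis s (t)).
        replace (d s) with (- - d s)%C by cring. rewrite He. cring.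
  - set (e := fun t => d (2 * t)).
    assert (Hhalf : forall t, e (t + 1 / 2) = (- e t)%C).
    { intros t. unfold e. rewrite <- Hd. f_equal; field. }
    exists e, n. rewrite Hn. split; [|split; [|split; [|split]]]; auto.
    + apply simple_loop_intro.
      * unfold e. cont.
      * intros t. replace (t + 1) with (t + 1 / 2 + 1 / 2) by field. rewrite !Hhalf. cring.
      * intros t. apply HXd.
      * intros s t Hs0 Ht0 He. destruct (simple_loop_inj g (2 * s) (2 * t) Hs) as [k Hk].
        { rewrite <- !Hf. fold (e s) (e t). now rewrite He. }
        (* For [k = 1] or [k = -1] the times [s] and [t] would be half a turn apart, where [e] takes
           opposite nonzero values. *)
        assert (Hk2 : (-2 < k < 2)%Z) by (split; apply lt_IZR; lra).
        assert (Hkc : (k = -1 \/ k = 0 \/ k = 1)%Z) by lia.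
        destruct Hkc as [->|[->| ->]].
        -- exfalso. apply (Hneg (2 * s)). fold (e s). rewrite <- Hhalf, He. f_equal. lra.
        -- lra.
        -- exfalso. apply (Hneg (2 * t)). fold (e t). rewrite <- Hhalf, <- He. f_equal. lra.
    + destruct (f_eq z (d t0)) as [->|Hz']. { rewrite Hf. auto. }
      * exists (t0 / 2). unfold e. f_equal; field.
      * exists (t0 / 2 + 1 / 2). rewrite Hhalf, Hz'. unfold e. do 2 f_equal; field.
    + intros t. exact (Hf (2 * t)).
Qed.

(** * Recognising a component of a preimage *)

Definition closed_set (A : C -> Prop) : Prop := open_set (fun z => ~ A z).

Lemma closed_im g : loop g -> closed_set (im g).
Proof.
  intros [Hc Hp] z Hz.
  destruct (periodic_bounds (fun t => Cmod (g t - z)%C)) as (a & b & Hab).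
  - cont.
  - intros t. now rewrite Hp.
  - exists (Cmod (g a - z)%C). split.
    + apply Cmod_gt_0, C_neq_sub. intros He. apply Hz. now exists a.
    + intros w Hw [t <-]. rewrite cdist_Cmod in Hw. generalize (Hab t). lra.
Qed.

Lemma contC_f : forall z eps, eps > 0 -> exists d, d > 0 /\ forall w, cdist w z < d -> cdist (f w) (f z) < eps.
Proof.
  intros z eps He. set (M := 2 * Cmod z + 1).
  assert (HM : 0 < M) by (unfold M; generalize (Cmod_ge_0 z); lra).
  exists (Rmin 1 (eps / M)). split.
  - apply Rmin_pos; [lra|]. apply Rmult_lt_0_compat; auto. now apply Rinv_0_lt_compat.
  - intros w Hw. rewrite cdist_Cmod in *. rewrite !f_C.
    replace (w * w + Ci - (z * z + Ci))%C with ((w - z) * ((w - z) + 2 * z))%C by cring.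
    rewrite Cmod_mult.
    assert (H1 := Rlt_le_trans _ _ _ Hw (Rmin_l _ _)). assert (H2 := Rlt_le_trans _ _ _ Hw (Rmin_r _ _)).
    assert (H3 : Cmod ((w - z) + 2 * z) < M).
    { eapply Rle_lt_trans; [apply Cmod_triangle|]. rewrite Cmod_mult, Cmod_RtoC_pos by lra. unfold M; lra. }
    apply Rle_lt_trans with (Cmod (w - z) * M).
    + apply Rmult_le_compat_l; [apply Cmod_ge_0|lra].
    + apply (Rmult_lt_reg_r (/ M)); [now apply Rinv_0_lt_compat|].
      rewrite Rmult_assoc, Rinv_r by lra. rewrite Rmult_1_r. exact H2.
Qed.

Lemma closed_preim A : closed_set A -> closed_set (fun z => A (f z)).
Proof.
  intros H z Hz. destruct (H (f z) Hz) as (e & He & He').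
  destruct (contC_f z e He) as (d & Hd & Hd'). exists d; split; auto.
Qed.
Lemma closed_union A A' : closed_set A -> closed_set A' -> closed_set (fun z => A z \/ A' z).
Proof.
  intros H H' z Hz. destruct (H z) as (e & He & He'); [tauto|].
  destruct (H' z) as (e2 & He2 & He2'); [tauto|].
  exists (Rmin e e2). split; [now apply Rmin_pos|]. intros w Hw.
  specialize (He' w (Rlt_le_trans _ _ _ Hw (Rmin_l _ _))). specialize (He2' w (Rlt_le_trans _ _ _ Hw (Rmin_r _ _))). tauto.
Qed.
Lemma closed_ext A A' : (forall z, A z <-> A' z) -> closed_set A -> closed_set A'.
Proof.
  intros He H z Hz. destruct (H z) as (e & H1 & H2); [now rewrite He|].
  exists e; split; auto. intros w Hw. rewrite <- He. auto.
Qed.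
Lemma closed_empty : closed_set (fun _ => False).
Proof. intros z _. exists 1. split; [lra|tauto]. Qed.

(** A separation of the image would give a continuous function of the parameter with values 0 and 1
    only. *)
Lemma connected_im g : contC g -> connected (im g).
Proof.
  intros Hc U V HU HV Hcov [z [[a Ha] Hz]] [w [[b Hb] Hw]].
  apply NNPP. intros N.
  assert (Hex : forall t, U (g t) -> ~ V (g t)).
  { intros t A1 A2. apply N. exists (g t). split; [now exists t|auto]. }
  destruct (choice_fun (fun t r => (U (g t) -> r = 0) /\ (V (g t) -> r = 1))) as [phi Hphi].
  { intros t. destruct (classic (U (g t))).
    - exists 0. split; auto. intros HVt. exfalso. now apply (Hex t).
    - exists 1. split; tauto. }
  assert (Hphic : contR phi).
  { intros t. apply continuous_eps. intros eps He.
    assert (Hgt : U (g t) \/ V (g t)) by (apply Hcov; now exists t).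
    assert (Hn : exists W : C -> Prop, open_set W /\ W (g t) /\ forall s, W (g s) -> phi s = phi t).
    { destruct Hgt as [Hg|Hg].
      - exists U. repeat split; auto. intros s Hs. now rewrite (proj1 (Hphi s) Hs), (proj1 (Hphi t) Hg).
      - exists V. repeat split; auto. intros s Hs. now rewrite (proj2 (Hphi s) Hs), (proj2 (Hphi t) Hg). }
    destruct Hn as (W & HW & HWt & HWs). destruct (HW _ HWt) as (e & He1 & He2).
    generalize (contC_near g t e Hc He1). apply filter_imp. intros s Hs.
    rewrite (HWs s); [rewrite Rminus_diag, Rabs_R0; lra|]. now apply He2. }
  subst z w.
  assert (H0 : phi a = 0) by now apply Hphi. assert (H1 : phi b = 1) by now apply Hphi.
  destruct (IVT_gen phi a b (1 / 2)) as [x [_ Hx]].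
  - intros x. apply continuity_pt_filterlim, Hphic.
  - rewrite H0, H1, Rmin_left, Rmax_right; lra.
  - destruct (Hcov (g x)) as [G|G]; [now exists x| |].
    + rewrite (proj1 (Hphi x) G) in Hx. lra.
    + rewrite (proj2 (Hphi x) G) in Hx. lra.
Qed.

(** The image of [d] is connected, and both it and the rest of [S] are closed, so the component
    through a point of the image is the image. *)
Lemma component_clopen S K d z : component S K -> K z -> im d z -> contC d -> loop d ->
  (forall w, im d w -> S w) -> closed_set (fun w => S w /\ ~ im d w) ->
  forall w, K w <-> im d w.
Proof.
  intros (_ & HKS & HKc & HKm) HKz Hdz Hcd Hl HdS Hcl.
  assert (H1 : forall w, K w -> im d w).
  { intros w Hw. apply NNPP. intros N.
    (* The open sets are the complement of the rest of [S] and the complement of the image of [d];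
       within [K] they are disjoint. *)
    destruct (HKc (fun w => ~ (S w /\ ~ im d w)) (fun w => ~ im d w)) as (x & Hx1 & Hx2 & Hx3); auto.
    - now apply closed_im.
    - intros v Hv. destruct (classic (im d v)); tauto.
    - exists z. tauto.
    - exists w. tauto. }
  intros w; split; auto. apply (HKm (im d)); auto. now apply connected_im.
Qed.

(** * Counting double covers *)

Lemma chain_scale c n d (m : Z) : chain c n d -> chain (fun t => c (IZR m * t)) n (fun t => d (IZR m * t)).
Proof.
  induction 1.
  - constructor. now apply loop_comp_lin.
  - econstructor; [exact IHchain| |].
    + now apply loop_comp_lin.
    + intros t. apply H1.
Qed.

(* Bounds the number of double covers among the successive lifts of a loop with winding numbers [a], [b], [c]
   about [i], [q], [- i].  In absolute value, a double lift takes [(1, b, c)] to [(b, c, b)], and a simple lift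
   takes [(0, b, c)] to some [(a', b', c')] with [a' + c' = b] and [b' <= c]. *)
Definition doublings (a b c : Z) : Z :=
  if (a =? 0)%Z then (if (b =? 0)%Z then (if (c =? 0)%Z then 0 else 1) else (if (c =? 0)%Z then 1 else 3))
  else (if (b =? 0)%Z then (if (c =? 0)%Z then 1 else 2) else 3).

Definition inner (g : R -> C) (a b c : Z) : Prop :=
  wind g Ci a /\ wind g q b /\ wind g (- Ci)%C c /\ ~ (a <> 0 /\ b <> 0 /\ c <> 0)%Z.

(** [f] sends all four special points to finite postcritical points, so a lift of a loop in [X]
    avoids them. *)
Lemma special_off (d : R -> C) p : special p -> (forall t, X (f (d t))) -> (forall t, d t <> p).
Proof.
  intros Hp HX t He. apply (HX t). rewrite He.
  replace (f p) with (if excluded_middle_informative (p = Ci \/ p = (- Ci)%C) then q else (- Ci)%C).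
  - apply Pfin_iff. destruct excluded_middle_informative; auto.
  - destruct excluded_middle_informative as [H|H].
    + symmetry. rewrite f_C. unfold q.
      destruct H as [-> | ->]; unfold Ci, Cmult, Copp, Cplus; simpl; f_equal; cring.
    + destruct Hp as [-> | [-> | [-> | ->]]]; try (exfalso; tauto);
      rewrite f_C; unfold q, Ci, Cmult, Copp, Cplus; simpl; f_equal; cring.
Qed.

Lemma f_values : f Ci = q /\ f (- Ci)%C = q /\ f q = (- Ci)%C /\ f (- q)%C = (- Ci)%C.
Proof.
  rewrite !f_C. unfold q, Ci, Cmult, Copp, Cplus; simpl. repeat split; f_equal; cring.
Qed.

(** An even winding number of a simple loop is 0, so [a = 0]. By [wind_f], [b = a' + c'] and
    [c = b' + e'], with summands of one sign and sums of absolute value at most 1; hence [a'] and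
    [c'] are not both nonzero, and the rest is a finite check. *)
Lemma inner_even g d a b c : simple_loop g -> simple_loop d -> (forall t, f (d t) = g t) ->
  inner g a b c -> Z.even a = true -> exists a' b' c', inner d a' b' c' /\ (doublings a' b' c' <= doublings a b c)%Z.
Proof.
  intros Hg Hd Hf (Wa & Wb & Wc & Hn) Hev.
  assert (HXg : forall t, X (g t)) by (apply simple_loop_iff in Hg; tauto).
  assert (Hoff : forall p, special p -> forall t, d t <> p).
  { intros p Hp. apply special_off; auto. intros t. rewrite Hf. auto. }
  assert (Hld : loop d) by (apply simple_loop_iff in Hd; tauto).
  assert (Hlg : forall p, Pfin p -> forall t, g t <> p) by (intros p Hp t <-; now apply (HXg t)).
  destruct (wind_exists d Ci Hld) as [a' Wa']; [apply Hoff; unfold special; auto|].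
  destruct (wind_exists d (- Ci)%C Hld) as [c' Wc']; [apply Hoff; unfold special; auto|].
  destruct (wind_exists d q Hld) as [b' Wb']; [apply Hoff; unfold special; auto|].
  destruct (wind_exists d (- q)%C Hld) as [e' We']; [apply Hoff; unfold special; auto|].
  destruct f_values as (V1 & V2 & V3 & V4).
  assert (Q1 := wind_f d Ci a' c' Wa' Wc'). rewrite V1 in Q1. apply (wind_ext _ g) in Q1; auto.
  assert (Q2 := wind_f d q b' e' Wb' We'). rewrite V3 in Q2. apply (wind_ext _ g) in Q2; auto.
  assert (b = a' + c')%Z by (apply (wind_unique g q); auto; apply Hlg, Pfin_iff; auto).
  assert (c = b' + e')%Z by (apply (wind_unique g (- Ci)%C); auto; apply Hlg, Pfin_iff; auto).
  assert (SW := fun p p' n n' Hp Hp' => simple_wind d p p' n n' Hd Hp Hp' (Hoff p Hp) (Hoff p' Hp')).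
  assert (SWg := fun p p' n n' Hp Hp' (Fp : Pfin p) (Fp' : Pfin p') => simple_wind g p p' n n' Hg Hp Hp' (Hlg p Fp) (Hlg p' Fp')).
  assert (Si : special Ci) by (unfold special; auto). assert (Smi : special (- Ci)%C) by (unfold special; auto).
  assert (Sq : special q) by (unfold special; auto). assert (Smq : special (- q)%C) by (unfold special; auto).
  assert (Fi : Pfin Ci) by (apply Pfin_iff; auto). assert (Fq : Pfin q) by (apply Pfin_iff; auto).
  assert (Fmi : Pfin (- Ci)%C) by (apply Pfin_iff; auto).
  destruct (SW Ci (- Ci)%C a' c') as [R1 R2]; auto. destruct (SW (- Ci)%C q c' b') as [R3 R4]; auto.
  destruct (SW q (- q)%C b' e') as [R5 R6]; auto. destruct (SW (- q)%C Ci e' a') as [R7 R8]; auto.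
  destruct (SWg Ci q a b) as [R9 R10]; auto. destruct (SWg q (- Ci)%C b c) as [R11 R12]; auto.
  destruct (SWg (- Ci)%C Ci c a) as [R13 R14]; auto.
  assert (a = 0)%Z. { destruct (Z.eq_dec a 0); auto. assert (E1 : (a = 1 \/ a = -1)%Z) by lia. destruct E1; subst; discriminate. }
  exists a', b', c'. split.
  - repeat split; auto. nia.
  - unfold doublings. subst a. rewrite Z.eqb_refl.
    repeat match goal with |- context [(?x =? 0)%Z] => destruct (Z.eqb_spec x 0) end; try lia; exfalso; nia.
Qed.

(** The half-turn symmetry equates the winding numbers about [p] and [- p]. With the double cover,
    [wind_f] then gives [a' = b], [b' = c] and [c' = b]. *)
Lemma inner_odd g d a b c : simple_loop g -> simple_loop d -> (forall t, f (d t) = g (2 * t)) ->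
  (forall t, d (t + 1 / 2) = (- d t)%C) ->
  inner g a b c -> Z.even a = false -> exists a' b' c', inner d a' b' c' /\ (doublings a' b' c' + 1 <= doublings a b c)%Z.
Proof.
  intros Hg Hd Hf Hh (Wa & Wb & Wc & Hn) Hev.
  assert (HXg : forall t, X (g t)) by (apply simple_loop_iff in Hg; tauto).
  assert (Hoff : forall p, special p -> forall t, d t <> p).
  { intros p Hp. apply special_off; auto. intros t. rewrite Hf. auto. }
  assert (Hld : loop d) by (apply simple_loop_iff in Hd; tauto).
  assert (Hlg : forall p, Pfin p -> forall t, g (2 * t) <> p) by (intros p Hp t A; apply (HXg (2 * t)); now rewrite A).
  assert (Hsym : forall p n, wind d p n -> wind d (- p)%C n).
  { intros p n Hw. apply (wind_ext (fun t => - - d t)%C); [intros; cring|]. apply wind_neg.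
    apply (wind_ext (fun t => d (t + 1 / 2))); auto. now apply wind_shift. }
  destruct (wind_exists d Ci Hld) as [a' Wa']; [apply Hoff; unfold special; auto|].
  destruct (wind_exists d q Hld) as [b' Wb']; [apply Hoff; unfold special; auto|].
  destruct f_values as (V1 & V2 & V3 & V4).
  assert (Wc' := Hsym _ _ Wa'). assert (We' := Hsym _ _ Wb').
  assert (Q1 := wind_f d Ci a' a' Wa' Wc'). rewrite V1 in Q1. apply (wind_ext _ (fun t => g (2 * t))) in Q1; auto.
  assert (Q2 := wind_f d q b' b' Wb' We'). rewrite V3 in Q2. apply (wind_ext _ (fun t => g (2 * t))) in Q2; auto.
  apply wind_double in Wb. apply wind_double in Wc.
  assert (2 * b = a' + a')%Z by (apply (wind_unique (fun t => g (2 * t)) q); auto; apply Hlg, Pfin_iff; auto).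
  assert (2 * c = b' + b')%Z by (apply (wind_unique (fun t => g (2 * t)) (- Ci)%C); auto; apply Hlg, Pfin_iff; auto).
  assert (a <> 0)%Z by (intros ->; discriminate).
  exists a', b', a'. split.
  - repeat split; auto. nia.
  - unfold doublings.
    repeat match goal with |- context [(?x =? 0)%Z] => destruct (Z.eqb_spec x 0) end; try lia; exfalso; nia.
Qed.

Lemma doublings_range a b c : (0 <= doublings a b c <= 3)%Z.
Proof. unfold doublings. repeat match goal with |- context [(?x =? 0)%Z] => destruct (Z.eqb_spec x 0) end; lia. Qed.

(** Each double lift doubles [k] and lowers [doublings] by at least one, so [k * 2 ^ doublings]
    never exceeds its initial bound [2 ^ 3]. Closedness of the rest of the preimage is carried along
    in order to recognise the component. *)
Lemma chain_to g a b c : simple_loop g -> inner g a b c ->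
  forall n z, im g (Nat.iter n f z) -> exists (d : R -> C) (k : Z) a' b' c',
    simple_loop d /\ im d z /\ inner d a' b' c' /\ (1 <= k)%Z /\ (k * 2 ^ doublings a' b' c' <= 8)%Z /\
    chain (fun t => g (IZR k * t)) n d /\
    (forall w, im d w -> im g (Nat.iter n f w)) /\
    closed_set (fun w => im g (Nat.iter n f w) /\ ~ im d w).
Proof.
  intros Hg Hin. induction n; intros z Hz.
  - exists g, 1%Z, a, b, c. split; [|split; [|split; [|split; [|split; [|split; [|split]]]]]]; auto; try lia.
    + assert (Hr := doublings_range a b c).
      assert ((2 ^ doublings a b c <= 2 ^ 3)%Z) by (apply Z.pow_le_mono_r; lia). lia.
    + replace (fun t => g (1 * t)) with g.
      2:{ apply FunctionalExtensionality.functional_extensionality. intros t. now rewrite Rmult_1_l. }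
      constructor. apply simple_loop_iff in Hg; tauto.
    + apply (closed_ext (fun _ => False)); [|apply closed_empty]. simpl. intros w; tauto.
  - rewrite Nat.iter_succ_r in Hz. destruct (IHn (f z) Hz) as (d & k & a' & b' & c' & Hd & Hdz & Hdin & Hk & Hpot & Hch & Him & Hcl).
    destruct (simple_lift d z Hd Hdz) as (e & m & He & Hez & Hm & Hcase).
    assert (m = a').
    { apply (wind_unique d Ci); auto; [|apply Hdin]. intros t. apply X_neq_i. apply simple_loop_iff in Hd. apply Hd. }
    subst m.
    assert (Hle : loop e) by (apply simple_loop_iff in He; tauto).
    (* A remaining point at level [S n] lies over the old remainder, or over [d] but off [e]. The
       second set [A] is the opposite lift in the even case and empty in the odd case. *)
    assert (Hclosed : forall A : C -> Prop, closed_set A ->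
       (forall w, im d (f w) /\ ~ im e w <-> A w) -> (forall t, im d (f (e t))) ->
       closed_set (fun w => im g (Nat.iter (S n) f w) /\ ~ im e w)).
    { intros A HA HAw Hed.
      apply (closed_ext (fun w => (im g (Nat.iter n f (f w)) /\ ~ im d (f w)) \/ A w)).
      - intros w. rewrite Nat.iter_succ_r. rewrite <- HAw. specialize (Him (f w)).
        assert (im e w -> im d (f w)) by (intros [t <-]; apply Hed).
        destruct (classic (im d (f w))); destruct (classic (im e w)); tauto.
      - apply closed_union; auto. apply (closed_preim _ Hcl). }
    destruct (Z.even a') eqn:Hev.
    + destruct Hcase as [Hf Hdis].
      destruct (inner_even d e a' b' c' Hd He Hf Hdin Hev) as (a2 & b2 & c2 & Hin2 & Hp2).
      assert (Hed : forall t, im d (f (e t))) by (intros t; rewrite Hf; now exists t).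
      exists e, k, a2, b2, c2. split; [|split; [|split; [|split; [|split; [|split; [|split]]]]]]; auto.
      * assert ((2 ^ doublings a2 b2 c2 <= 2 ^ doublings a' b' c')%Z) by (apply Z.pow_le_mono_r; lia). nia.
      * econstructor; eauto.
      * intros w [t <-]. rewrite Nat.iter_succ_r. apply Him, Hed.
      * apply (Hclosed (im (fun t => - e t)%C)); auto.
        -- apply closed_im. destruct Hle as [L1 L2]. split; [now apply contC_opp|]. intros t; now rewrite L2.
        -- intros w. split.
           ++ intros [[t Ht] Hn]. destruct (f_eq w (e t)) as [->| ->]; [now rewrite Hf| |].
              ** exfalso. apply Hn. now exists t.
              ** now exists t.
           ++ intros [t <-]. split.
              ** exists t. rewrite <- Hf, !f_C. cring.
              ** intros [s Hs]. now apply (Hdis s t).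
    + destruct Hcase as [Hf Hhalf].
      destruct (inner_odd d e a' b' c' Hd He Hf Hhalf Hdin Hev) as (a2 & b2 & c2 & Hin2 & Hp2).
      assert (Hed : forall t, im d (f (e t))) by (intros t; rewrite Hf; now exists (2 * t)).
      exists e, (k * 2)%Z, a2, b2, c2. split; [|split; [|split; [|split; [|split; [|split; [|split]]]]]]; auto; try lia.
      * assert ((2 ^ (doublings a2 b2 c2 + 1) <= 2 ^ doublings a' b' c')%Z) by (apply Z.pow_le_mono_r; lia).
        rewrite Z.pow_add_r in H by (generalize (doublings_range a2 b2 c2); lia). nia.
      * apply (chain_S _ n (fun t => d (IZR 2 * t))); auto.
        replace (fun t => g (IZR (k * 2) * t)) with (fun t => (fun t => g (IZR k * t)) (IZR 2 * t)).
        -- exact (chain_scale (fun t => g (IZR k * t)) n d 2 Hch).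
        -- apply FunctionalExtensionality.functional_extensionality. intros t. rewrite mult_IZR. f_equal; cring.
      * intros w [t <-]. rewrite Nat.iter_succ_r. apply Him, Hed.
      * apply (Hclosed (fun _ => False)); auto using closed_empty.
        intros w. split; [|tauto]. intros [[t Ht] Hn]. apply Hn.
        destruct (f_eq w (e (t / 2))) as [->| ->].
        { rewrite Hf, <- Ht. f_equal; field. }
        -- now exists (t / 2).
        -- exists (t / 2 + 1 / 2). apply Hhalf.
Qed.

Theorem theorem4 :
  forall g : R -> Cpx,
    simple_loop g -> ~ trivial_curve g ->
    exists n : nat, (1 <= n)%nat /\
      forall K : Cpx -> Prop, component (preimage_curve n g) K ->
        exists d : R -> Cpx, simple_loop d /\
          (forall z, K z <-> exists t, d t = z) /\ trivial_curve d.
Proof.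
  intros g Hg Hnt. assert (Hg' := Hg). apply simple_loop_iff in Hg'. destruct Hg' as (Hl & HX & _).
  assert (Hoff : forall p, Pfin p -> forall t, g t <> p) by (intros p Hp t <-; now apply (HX t)).
  assert (Fi : Pfin Ci) by (apply Pfin_iff; auto). assert (Fq : Pfin q) by (apply Pfin_iff; auto).
  assert (Fmi : Pfin (- Ci)%C) by (apply Pfin_iff; auto).
  destruct (wind_exists g Ci Hl) as [a Wa]; auto. destruct (wind_exists g q Hl) as [b Wb]; auto.
  destruct (wind_exists g (- Ci)%C Hl) as [c Wc]; auto.
  (* If all three numbers were nonzero, they would have one sign and absolute value 1, hence be
     equal; by [simple_outer] the loop would be trivial. *)
  assert (Hin : inner g a b c).
  { repeat split; auto. intros (Ha & Hb & Hc). apply Hnt.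
    destruct (simple_wind g Ci q a b) as [R1 R2]; unfold special; auto.
    destruct (simple_wind g q (- Ci)%C b c) as [R3 R4]; unfold special; auto.
    destruct (simple_wind g (- Ci)%C Ci c a) as [R5 R6]; unfold special; auto.
    apply (simple_outer g a); auto.
    - replace a with b by nia. auto. - replace a with c by nia. auto. }
  destruct (lipschitz_approx g Hg) as (g' & K0 & Hl' & HX' & Hh & HK & HL).
  (* The 8 is the bound on the multiplicity [k] from [chain_to]; [N] is fixed before any component
     is given. *)
  destruct (lifts_eventually_trivial g g' K0 8 Hl' HX' Hh HK HL) as (N & HN & Htriv); [lia|].
  exists N. split; auto. intros K HK0. assert (HK1 := HK0). destruct HK1 as ((z & Hz) & HKS & _).
  assert (Hpre : forall w, preimage_curve N g w <-> im g (Nat.iter N f w)).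
  { intros w. split; intros [t Ht]; exists t; auto. }
  destruct (chain_to g a b c Hg Hin N z) as (d & k & a' & b' & c' & Hd & Hdz & _ & Hk & Hk8 & Hch & Him & Hcl).
  { apply Hpre, HKS, Hz. }
  assert (Hld : loop d) by (apply simple_loop_iff in Hd; tauto).
  exists d. split; [|split]; auto.
  - apply (component_clopen (preimage_curve N g) K d z); auto; try apply Hld.
    + intros w Hw. now apply Hpre, Him.
    + apply (closed_ext (fun w => im g (Nat.iter N f w) /\ ~ im d w)); auto. intros w. now rewrite Hpre.
  - apply (Htriv k d); auto.
    assert ((2 ^ 0 <= 2 ^ doublings a' b' c')%Z) by (apply Z.pow_le_mono_r; generalize (doublings_range a' b' c'); lia).
    simpl in H. nia.
Qed.
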